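(* Let $(M,g)$ be a $3$-manifold with empty boundary and let $X\in\mathcal{V}(M)$ be a weak Beltrami field whose proportionality function is $C^\infty$-bounded near $K:=\{p\in M\mid X(p)=0\}$. If $X$ is not the zero vector field, then $M\setminus K$ is path-connected, i.e. there is exactly one nodal domain.
   Context: A ''$3$-manifold $(M,g)$'' means a connected, oriented, $C^\infty$-smooth, Hausdorff, second countable $3$-dimensional manifold (here without boundary), equipped with a smooth Riemannian metric $g$. $\mathcal{V}(M)$ is the set of all smooth vector fields on $M$. For a vector field $X$, $\operatorname{div}(X)$ is the Riemannian divergence and $\operatorname{curl}(X)$ is the vector field whose associated $1$-form (via $g$) is $\star d\omega^1_X$, where $\omega^1_X=g(X,\cdot)$ and $\star$ is the Hodge star. A vector field $X\in\mathcal{V}(M)$ is a weak Beltrami field if there exists a locally bounded function $\lambda:M\to\mathbb{R}$ (the proportionality function) such that $\operatorname{curl}(X)=\lambda X$ and $\operatorname{div}(X)=0$. With $K=\{p\in M\mid X(p)=0\}$, the function $\lambda$ is automatically smooth on $M\setminus K$. One says that $\lambda$ is $C^\infty$-bounded near $K$ if for every $p\in K$ there exists a chart $(\mu,U)$ around $p$ such that for every multi-index $\alpha\in\mathbb{N}_0^3$ we have $\|\partial^\alpha(\lambda\circ\mu^{-1})\|_{L^\infty(\mu(U\setminus K))}<\infty$ (the norm being set to zero if $U\setminus K$ is empty). Nodal domains of $X$ are the connected components of $M\setminus K$. *)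

(* Defs.v *)
(* Tensor fields on a smooth 3-manifold are given by their components in the
   charts of an oriented smooth atlas, with the usual transformation laws.
   Vectors and covectors of R^3 are row vectors; accordingly the library
   Jacobian ['J f x] acts on the right: its (i, j) entry is d f_j / d x_i. *)
From HB Require Import structures.
From mathcomp Require Import all_boot all_order all_algebra.
From mathcomp Require Import all_classical all_reals all_analysis.

Set Implicit Arguments.
Unset Strict Implicit.
Unset Printing Implicit Defensive.

Import Order.TTheory GRing.Theory Num.Theory.
Import numFieldNormedType.Exports.

Local Open Scope classical_set_scope.
Local Open Scope ring_scope.

Section calculus.
Context {R : realType}.
Local Notation E := 'rV[R]_3.

Definition partial (W : normedModType R) (i : 'I_3) (f : E -> W) : E -> W :=
  fun x => 'D_(delta_mx 0 i) f x.

Definition partials (W : normedModType R) (s : seq 'I_3) (f : E -> W) : E -> W :=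
  foldr (fun i h => partial i h) f s.

Definition multi_partial (W : normedModType R) (alpha : 'I_3 -> nat)
    (f : E -> W) : E -> W :=
  partials (flatten [seq nseq (alpha i) i | i <- enum 'I_3]) f.

(* Only meant for open [V]: derivatives and continuity are not relative to V. *)
Definition smooth_on (W : normedModType R) (V : set E) (f : E -> W) : Prop :=
  forall (s : seq 'I_3) (x : E), V x ->
    {for x, continuous (partials s f)} /\
    forall i, derivable (partials s f) x (delta_mx 0 i).

Definition vec3 (t : measurableTypeR R * measurableTypeR R * measurableTypeR R)
    : E :=
  \row_(i < 3) nth 0 [:: t.1.1; t.1.2; t.2] i.

Definition lebesgue3 :=
  ((@lebesgue_measure R \x @lebesgue_measure R) \x @lebesgue_measure R)%E.

(* The norm of [f] in L^oo(V), as that of the extension of [f|V] by zero to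
   R^3; it is 0 when [V] is empty. *)
Definition Linfty_norm (V : set E) (f : E -> R) : \bar R :=
  (Lnorm lebesgue3 +oo (EFin \o (f \_ V) \o vec3))%E.

End calculus.

Section manifolds.
Context (R : realType).
Local Notation E := 'rV[R]_3.

(* A topological chart (mu, U): [dom] is U, [chart_map] is mu and [chart_inv]
   its inverse; these are junk outside U and mu(U) respectively. *)
Record chart (M : topologicalType) := Chart {
  dom : set M;
  chart_map : M -> E;
  chart_inv : E -> M;
  dom_open : open dom;
  img_open : open (chart_map @` dom);
  chart_mapK : {in dom, cancel chart_map chart_inv};
  chart_map_continuous : {within dom, continuous chart_map};
  chart_inv_continuous : {within chart_map @` dom, continuous chart_inv} }.

Definition img (M : topologicalType) (c : chart M) : set E :=
  chart_map c @` dom c.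

Definition overlap (M : topologicalType) (c c' : chart M) : set E :=
  chart_map c @` (dom c `&` dom c').

Definition transition (M : topologicalType) (c c' : chart M) : E -> E :=
  chart_map c' \o chart_inv c.

Record manifold3 := Manifold3 {
  space :> topologicalType;
  space_hausdorff : hausdorff_space space;
  space_second_countable : second_countable (T := space);
  space_connected : connected [set: space];
  idx : Type;
  atlas : idx -> chart space;
  atlas_cover : forall p, exists i, dom (atlas i) p;
  atlas_smooth : forall i j,
    smooth_on (overlap (atlas i) (atlas j)) (transition (atlas i) (atlas j));
  atlas_oriented : forall i j x, overlap (atlas i) (atlas j) x ->
    0 < \det ('J (transition (atlas i) (atlas j)) x) }.

(* The charts of the smooth structure, of either orientation. *)
Definition smooth_chart (M : manifold3) (c : chart M) : Prop :=
  forall i : idx M,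
    smooth_on (overlap c (atlas i)) (transition c (atlas i)) /\
    smooth_on (overlap (atlas i) c) (transition (atlas i) c).

Record riemannian_metric (M : manifold3) := RiemannianMetric {
  metric :> idx M -> E -> 'M[R]_3;
  metric_smooth : forall i, smooth_on (img (atlas i)) (metric i);
  metric_sym : forall i x, img (atlas i) x -> (metric i x)^T = metric i x;
  metric_pos : forall i x, img (atlas i) x -> forall v : E, v != 0 ->
    0 < (v *m metric i x *m v^T) 0 0;
  metric_transform : forall i j x, overlap (atlas i) (atlas j) x ->
    let tau := transition (atlas i) (atlas j) in
    metric i x = 'J tau x *m metric j (tau x) *m ('J tau x)^T }.

Record vector_field (M : manifold3) := VectorField {
  components :> idx M -> E -> E;
  components_smooth : forall i, smooth_on (img (atlas i)) (components i);
  components_transform : forall i j x, overlap (atlas i) (atlas j) x ->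
    let tau := transition (atlas i) (atlas j) in
    components j (tau x) = components i x *m 'J tau x }.

Definition zero_set (M : manifold3) (X : vector_field M) : set M :=
  [set p | forall i, dom (atlas i) p -> X i (chart_map (atlas i) p) = 0].

End manifolds.

(* Riemannian operations in one positively oriented chart, where the metric
   has matrix [g]. A 2-form F is represented by the antisymmetric matrix of
   its values F(e_j, e_k). *)
Section local_operators.
Context {R : realType}.
Local Notation E := 'rV[R]_3.
Implicit Types (g : E -> 'M[R]_3) (X omega : E -> E) (F : E -> 'M[R]_3).

Definition levi_civita (i j k : 'I_3) : R :=
  \det (\matrix_(a < 3) (delta_mx 0 (nth i [:: i; j; k] a) : E)).

Definition vol g (x : E) : R := Num.sqrt (\det (g x)).

Definition flat g X : E -> E := fun x => X x *m g x.

Definition sharp g omega : E -> E := fun x => omega x *m invmx (g x).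

Definition ext_deriv omega : E -> 'M[R]_3 := fun x =>
  \matrix_(j, k) (partial j (fun y => omega y 0 k) x
                  - partial k (fun y => omega y 0 j) x).

(* ( *F)_i = 1/2 sqrt(det g) F^{jk} eps_{jki}, with both indices of F raised;
   this is alpha /\ *F = <alpha, F> dvol. *)
Definition hodge2 g F : E -> E := fun x =>
  \row_i (2^-1 * vol g x * \sum_j \sum_k
    (invmx (g x) *m F x *m invmx (g x)) j k * levi_civita j k i).

Definition local_curl g X : E -> E := sharp g (hodge2 g (ext_deriv (flat g X))).

Definition local_div g X : E -> R := fun x =>
  (vol g x)^-1 * \sum_k partial k (fun y => vol g y * X y 0 k) x.

End local_operators.

Section beltrami.
Context {R : realType} {M : manifold3 R}.
Local Notation E := 'rV[R]_3.

Definition curl_eq (g : riemannian_metric M) (X : vector_field M)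
    (lambda : M -> R) : Prop :=
  forall i p, dom (atlas i) p ->
    local_curl (g i) (X i) (chart_map (atlas i) p)
    = lambda p *: X i (chart_map (atlas i) p).

Definition div_free (g : riemannian_metric M) (X : vector_field M) : Prop :=
  forall i p, dom (atlas i) p ->
    local_div (g i) (X i) (chart_map (atlas i) p) = 0.

Definition locally_bounded (lambda : M -> R) : Prop :=
  forall p : M, bounded_near lambda (nbhs p).

(* X is a weak Beltrami field with proportionality function lambda. *)
Definition weak_beltrami (g : riemannian_metric M) (X : vector_field M)
    (lambda : M -> R) : Prop :=
  [/\ locally_bounded lambda, curl_eq g X lambda & div_free g X].

Definition Cinfty_bounded_near (K : set M) (lambda : M -> R) : Prop :=
  forall p, K p -> exists c : chart R M,
    [/\ smooth_chart c, dom c p &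
      forall alpha : 'I_3 -> nat,
        (Linfty_norm (chart_map c @` (dom c `\` K))
          (multi_partial alpha (lambda \o chart_inv c)) < +oo)%E].

Definition path_connected (A : set M) : Prop :=
  A !=set0 /\
  forall p q, A p -> A q -> exists gamma : R -> M,
    [/\ {within `[0, 1], continuous gamma}, gamma 0 = p, gamma 1 = q &
      forall t, t \in `[0, 1] -> A (gamma t)].

Definition nodal_domain (X : vector_field M) (N : set M) : Prop :=
  exists2 p, (~` zero_set X) p & N = connected_component (~` zero_set X) p.

End beltrami.

(* Main.v *)
Require Import Defs.
From HB Require Import structures.
From mathcomp Require Import all_boot all_order all_algebra.
From mathcomp Require Import all_classical all_reals all_analysis.
From mathcomp Require Import perm.
From mathcomp Require Import ring lra.

Set Implicit Arguments.
Unset Strict Implicit.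
Unset Printing Implicit Defensive.

Import Order.TTheory GRing.Theory Num.Theory.
Import numFieldNormedType.Exports.

Local Open Scope classical_set_scope.
Local Open Scope ring_scope.

(** The statement is a unique continuation property across the zero set K of X,
about whose shape nothing is known. Let A be the complement of K and let N be
an open subset of A whose complement in A is open too. It is shown that the
interior of the complement of N is closed ([vanishing_closed]). As the manifold
is connected, a nonempty N is then dense and hence all of A
([nonzero_clopen]); so A is connected, and the points that can be joined to a
given one inside A make up A.

In a chart, let omega be the covector field g X and a = sqrt (det g) g^-1. Since
lambda is locally bounded, the Beltrami equations give
  |d omega|^2 + (sum_jk a_jk d_j omega_k)^2 <= K |omega|^2
([chart_beltrami]). Let O be the part of N in a ball; omega vanishes at those
boundary points of O that lie in the ball. If O stays outside the sphere
|x - x0|^2 = sig, then it stays outside a slightly larger one, by a step that is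
bounded below ([local_continuation]). As N misses a small ball around some
x0 close to the given point, it misses a neighbourhood of that point.

The step from one sphere to the next is a Carleman estimate for
v = exp (tau phi) chi omega, where phi is a convex function of |x - x0|^2 and chi
vanishes on a slightly larger sphere. The estimate concerns v on the part
Omega of O between the two spheres, where v vanishes on the whole boundary. The
extension of v by zero need not be C^1, for the gradient of omega need not
vanish on K; so integrations by parts would meet boundary terms on an
arbitrary closed set. To avoid them, everything is integrated against
|v|^(2 / tau). For b of class C^1, the function |v|^(2 / tau) v_i b extended by
zero is C^1 on the whole space, so its derivatives integrate to zero without
any assumption on Omega ([asneg_cut_divergence]), and differentiating the new factor
costs only terms of size (1 / tau) |grad v| |b|, which are comparable to the errors
tau |v|^2 + |grad v|^2 / tau.

With n half the gradient of |x - x0|^2, N = a n, s = tau theta the conjugation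
parameter, and f, h the conjugated curl and divergence of v, one has
  n_i h - sum_k N_k f_ik = P_i + Q_i + s (n.N) v_i,
where P_i = sum_l N_l d_l v_i and Q_i contains derivatives of v only as well
([contractionE]). Hence 4 a(P, Q + s (n.N) v) is at most a quadratic form in
(f, h). Here a(P, Q) is a combination of null forms
d_l v_i d_j v_k - d_j v_i d_l v_k, whose integrals are of lower order
([wneg_null]), while an integration by parts turns a(P, s (n.N) v) into
a zeroth-order term, which is positive and of size gam tau |v|^2 because phi is
convex ([flux_neg]). The gradient in the error terms is recovered from f and h
by the ellipticity of a ([gradient_neg]). For gam large this gives
tau |v|^2 <= C (|f|^2 + h^2) in the mean ([carleman]). As curl and divergence of
omega are bounded by omega, the right-hand side is essentially carried by the
outer half of the shell, where exp (tau phi) is smaller than on the inner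
half; letting tau grow, v vanishes in the inner half
([shell_contradiction]).

The only integrals to be evaluated are those of derivatives, and otherwise only
signs matter; so integrals are replaced by Riemann sums over cubic grids:
[asneg] says that the upper limit of these sums is at most 0. The theorem that
integrals of derivatives vanish becomes a telescoping sum. *)

(** * Functions with continuous partial derivatives up to order k *)

Section calculus.
Context {R : realType}.
Local Notation E := 'rV[R]_3.
Implicit Types (B : set E) (f g : E -> R) (x : E).

Definition basis (l : 'I_3) : E := delta_mx 0 l.

Lemma partialE f l x : partial l f x = 'D_(basis l) f x.
Proof. by []. Qed.

(** Finite order, because products, inverses and square roots are handled by
induction on the number of derivatives. The derivatives are those of a function
on the whole space, so the notion is meant for open B. *)
Fixpoint Ck (k : nat) B f : Prop :=
  (forall x, B x -> {for x, continuous f}) /\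
  if k is k'.+1 then
    forall l, (forall x, B x -> derivable f x (basis l)) /\ Ck k' B (partial l f)
  else True.

Lemma Ck_continuous k B f x : Ck k B f -> B x -> {for x, continuous f}.
Proof. by case: k => [|k] [cf _] /cf. Qed.

Lemma Ck_derivable k B f x : Ck k.+1 B f -> B x ->
  forall l, derivable f x (basis l).
Proof. by move=> [_ df] Bx l; apply: (df l).1. Qed.

Arguments Ck_derivable {k B f x} _ _ l.

Lemma Ck_is_derive k B f x : Ck k.+1 B f -> B x ->
  forall l, is_derive x (basis l) f (partial l f x).
Proof. by move=> Cf Bx l; apply/derivableP/(Ck_derivable Cf Bx). Qed.

Lemma Ck_partial k B f : Ck k.+1 B f -> forall l, Ck k B (partial l f).
Proof. by move=> [_ df] l; case: (df l). Qed.

Lemma CkW k B f : Ck k.+1 B f -> Ck k B f.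
Proof.
elim: k f => [|k IH] f [cf df]; split => // l.
by have [dl cl] := df l; split => //; apply: IH.
Qed.

Lemma Ck_subset k B B' f : B' `<=` B -> Ck k B f -> Ck k B' f.
Proof.
move=> sB; elim: k f => [|k IH] f [cf df]; split => //; try by move=> x /sB/cf.
by move=> l; have [dl cl] := df l; split; [move=> x /sB/dl|exact: IH].
Qed.

Lemma Ck_ext k B f g : open B -> {in B, f =1 g} -> Ck k B f -> Ck k B g.
Proof.
move=> oB; elim: k f g => [|k IH] f g fg Cf.
  split => // x Bx; have nfg : {near x, f =1 g}.
    by near=> y; apply: fg; rewrite inE; near: y; exact: open_nbhs_nbhs.
  rewrite /prop_for /continuous_at -(fg _ (mem_set Bx)).
  exact: cvg_trans (near_eq_cvg nfg) (Ck_continuous Cf Bx).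
have nfg x : B x -> {near x, f =1 g}.
  by move=> Bx; near=> y; apply: fg; rewrite inE; near: y; exact: open_nbhs_nbhs.
split=> [x Bx|l].
  rewrite /prop_for /continuous_at -(fg _ (mem_set Bx)).
  exact: cvg_trans (near_eq_cvg (nfg _ Bx)) (Ck_continuous Cf Bx).
split=> [x Bx|].
  exact: (@near_eq_derivable R _ _ f g x (basis l) (nfg _ Bx)
    (Ck_derivable Cf Bx l)).
apply: (IH (partial l f)); last exact: Ck_partial Cf l.
move=> x /set_mem Bx.
exact: (@near_eq_derive R _ _ f g x (basis l) (nfg _ Bx)).
Unshelve. all: by end_near. Qed.

(** This makes the induction on k work for each operation: it is enough to
exhibit the partial derivatives by a formula in functions already treated. *)
Lemma Ck_intro k B f (df : 'I_3 -> E -> R) : open B ->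
  (forall x, B x -> {for x, continuous f}) ->
  (forall l x, B x -> is_derive x (basis l) f (df l x)) ->
  (forall l, Ck k B (df l)) -> Ck k.+1 B f.
Proof.
move=> oB cf ddf Cdf; split => // l; split => [x Bx|].
  by have := ddf l x Bx; case.
apply: Ck_ext (Cdf l) => // x /set_mem Bx.
by have := ddf l x Bx; case.
Qed.

Lemma Ck_cst k B (c : R) : Ck k B (fun=> c).
Proof.
elim: k c => [|k IH] c; first by split => // x _; exact: cst_continuous.
split => [x _|l]; first exact: cst_continuous.
split => [x _|]; first exact: derivable_cst.
rewrite (_ : partial l _ = fun=> 0) //.
by apply/funext => x; exact: derive_cst.
Qed.

Lemma CkD k B f g : open B -> Ck k B f -> Ck k B g -> Ck k B (fun x => f x + g x).
Proof.
move=> oB; elim: k f g => [|k IH] f g Cf Cg.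
  by split => // x Bx; apply: continuousD; [exact: Cf.1|exact: Cg.1].
apply: (@Ck_intro _ _ _ (fun l x => partial l f x + partial l g x)) => //.
- by move=> x Bx; apply: continuousD; [exact: Cf.1|exact: Cg.1].
- by move=> l x Bx; exact: is_deriveD (Ck_is_derive Cf Bx l) (Ck_is_derive Cg Bx l).
- by move=> l; apply: IH; [exact: (Ck_partial Cf l)|exact: (Ck_partial Cg l)].
Qed.

Lemma CkM k B f g : open B -> Ck k B f -> Ck k B g -> Ck k B (fun x => f x * g x).
Proof.
move=> oB; elim: k f g => [|k IH] f g Cf Cg.
  by split => // x Bx; apply: continuousM; [exact: Cf.1|exact: Cg.1].
apply: (@Ck_intro _ _ _
  (fun l x => f x * partial l g x + g x * partial l f x)) => //.
- by move=> x Bx; apply: continuousM; [exact: Cf.1|exact: Cg.1].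
- by move=> l x Bx; exact: is_deriveM (Ck_is_derive Cf Bx l) (Ck_is_derive Cg Bx l).
- move=> l; apply: CkD => //; apply: IH; do ?[exact: CkW].
    exact: (Ck_partial Cg l).
  exact: (Ck_partial Cf l).
Qed.

Lemma CkZ k B (c : R) f : open B -> Ck k B f -> Ck k B (fun x => c * f x).
Proof. by move=> oB; apply: CkM => //; exact: Ck_cst. Qed.

Lemma CkN k B f : open B -> Ck k B f -> Ck k B (fun x => - f x).
Proof.
move=> oB Cf; apply: (Ck_ext oB _ (CkZ (-1) oB Cf)) => x _.
by rewrite mulN1r.
Qed.

Lemma CkB k B f g : open B -> Ck k B f -> Ck k B g -> Ck k B (fun x => f x - g x).
Proof. by move=> oB Cf Cg; apply: CkD => //; exact: CkN. Qed.

Lemma Ck_sum k B (I : Type) (r : seq I) (P : pred I) (F : I -> E -> R) : open B ->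
  (forall i, Ck k B (F i)) -> Ck k B (fun x => \sum_(i <- r | P i) F i x).
Proof.
move=> oB CF; elim: r => [|i r IH].
  by apply: (Ck_ext oB _ (Ck_cst k B 0)) => x _; rewrite big_nil.
have [Pi|Pi] := boolP (P i).
  by apply: (Ck_ext oB _ (CkD oB (CF i) IH)) => x _; rewrite big_cons Pi.
by apply: (Ck_ext oB _ IH) => x _; rewrite big_cons (negbTE Pi).
Qed.

Lemma Ck_prod k B (I : Type) (r : seq I) (P : pred I) (F : I -> E -> R) : open B ->
  (forall i, Ck k B (F i)) -> Ck k B (fun x => \prod_(i <- r | P i) F i x).
Proof.
move=> oB CF; elim: r => [|i r IH].
  by apply: (Ck_ext oB _ (Ck_cst k B 1)) => x _; rewrite big_nil.
have [Pi|Pi] := boolP (P i).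
  by apply: (Ck_ext oB _ (CkM oB (CF i) IH)) => x _; rewrite big_cons Pi.
by apply: (Ck_ext oB _ IH) => x _; rewrite big_cons (negbTE Pi).
Qed.

Lemma CkV k B f : open B -> (forall x, B x -> f x != 0) -> Ck k B f ->
  Ck k B (fun x => (f x)^-1).
Proof.
move=> oB f0; elim: k f f0 => [|k IH] f f0 Cf.
  by split => // x Bx; apply: continuousV; [exact: f0|exact: Cf.1].
apply: (@Ck_intro _ _ _ (fun l x => - ((f x)^-1 * (f x)^-1) * partial l f x)) => //.
- by move=> x Bx; apply: continuousV; [exact: f0|exact: Cf.1].
- move=> l x Bx; have fd : derivable f x (basis l) := Ck_derivable Cf Bx l; apply: DeriveDef.
    by apply: derivableV => //; exact: f0.
  by rewrite (deriveV (f0 _ Bx) fd) expr2 invfM.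
- move=> l; apply: CkM => //; last exact: (Ck_partial Cf l).
  by apply: CkN => //; apply: CkM => //; apply: IH => //; exact: CkW.
Qed.

(** Restriction to the line through x in the direction v reduces the chain
rule to the one-variable one, so that f need only be derivable in that direction. *)
Lemma is_derive_comp (phi : R -> R) f x (v : E) (a b : R) :
  is_derive (f x) 1 phi a -> is_derive x v f b ->
  is_derive x v (phi \o f) (a * b).
Proof.
move=> [dphi aE] [df bE].
pose F := fun h : R => f (h *: v + x).
have F0 : F 0 = f x by rewrite /F scale0r add0r.
have dvF : derivable F 0 1 := (derivable1P f x v).1 df.
have dphi' : derivable phi (F 0) 1 by rewrite F0.
have lineE g : 'D_v g x = 'D_1 (fun h : R => g (h *: v + x)) 0.
  rewrite /derive; set p := fun h => h^-1 *: _; set q := fun h => h^-1 *: _.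
  suff -> : p = q by [].
  apply/funext => h; rewrite /p /q /=.
  by rewrite scale0r add0r addr0 [_%:A]mulr1.
apply: DeriveDef.
  apply/(derivable1P (phi \o f) x v); rewrite -[fun h => _]/(phi \o F).
  have dF : differentiable F 0 by exact/derivable1_diffP.
  have dp : differentiable phi (F 0) by exact/derivable1_diffP.
  exact/derivable1_diffP/differentiable_comp.
rewrite lineE -[fun h => _]/(phi \o F) -derive1E (derive1_comp dvF dphi').
by rewrite !derive1E F0 aE -bE lineE.
Qed.

Lemma Ck_expR k B f : open B -> Ck k B f -> Ck k B (fun x => expR (f x)).
Proof.
move=> oB; elim: k f => [|k IH] f Cf.
  split => // x Bx; apply: (@continuous_comp _ _ _ f expR); first exact: Cf.1.
  exact: continuous_expR.
apply: (@Ck_intro _ _ _ (fun l x => expR (f x) * partial l f x)) => //.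
- move=> x Bx; apply: (@continuous_comp _ _ _ f expR); first exact: Cf.1.
  exact: continuous_expR.
- move=> l x Bx; apply: is_derive_comp; last exact: (Ck_is_derive Cf Bx l).
- move=> l; apply: CkM => //; last exact: (Ck_partial Cf l).
  by apply: IH; exact: CkW.
Qed.

Lemma Ck_sqrt k B f : open B -> (forall x, B x -> 0 < f x) -> Ck k B f ->
  Ck k B (fun x => Num.sqrt (f x)).
Proof.
move=> oB f0; elim: k => [|k IH] Cf.
  split => // x Bx; apply: (@continuous_comp _ _ _ f Num.sqrt); first exact: Cf.1.
  exact: sqrt_continuous.
apply: (@Ck_intro _ _ _ (fun l x => (2 * Num.sqrt (f x))^-1 * partial l f x)) => //.
- move=> x Bx; apply: (@continuous_comp _ _ _ f Num.sqrt); first exact: Cf.1.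
  exact: sqrt_continuous.
- move=> l x Bx; apply: is_derive_comp; last exact: (Ck_is_derive Cf Bx l).
  by apply: is_derive1_sqrt; exact: f0.
- move=> l; apply: CkM => //; last exact: (Ck_partial Cf l).
  apply: CkV => //.
    by move=> x Bx; rewrite mulf_neq0// gt_eqF// sqrtr_gt0 f0.
  by apply: CkZ => //; apply: IH; exact: CkW.
Qed.

Lemma is_derive_coord (i l : 'I_3) x :
  is_derive x (basis l) (fun y : E => y 0 i) ((i == l)%:R : R).
Proof.
have idd : derivable (@id E) x (basis l) by exact: derivable_id.
apply: DeriveDef.
  by have /derivable_mxP/(_ 0 i) := idd.
have := derive_mx idd; rewrite derive_id => /(congr1 (fun m : E => m 0 i)).
by rewrite /basis !mxE eqxx /= => ->.
Qed.

Lemma Ck_coord k B (i : 'I_3) : open B -> Ck k B (fun y : E => y 0 i).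
Proof.
move=> oB; case: k => [|k].
  by split => // x _; exact: coord_continuous.
apply: (@Ck_intro _ _ _ (fun l _ => (i == l)%:R)) => //.
- by move=> x _; exact: coord_continuous.
- by move=> l x _; exact: is_derive_coord.
- by move=> l; exact: Ck_cst.
Qed.

End calculus.

Arguments Ck_derivable {R k B f x} _ _ l.

(** * Symmetry of second derivatives *)

Section schwarz.
Context {R : realType}.
Local Notation E := 'rV[R]_3.
Implicit Types (B : set E) (f g : E -> R) (x : E).

Lemma is_derive_line f x (v : E) (s : R) : derivable f (s *: v + x) v ->
  is_derive s 1 (fun t : R => f (t *: v + x)) ('D_v f (s *: v + x)).
Proof.
move=> df.
have E1 : (fun h : R => h^-1 *: (((fun t : R => f (t *: v + x)) \o shift s)
      (h *: 1) - f (s *: v + x))) =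
    (fun h : R => h^-1 *: ((f \o shift (s *: v + x)) (h *: v) - f (s *: v + x))).
  by apply/funext => h /=; rewrite [h%:A]mulr1 scalerDl addrA.
by apply: DeriveDef; rewrite ?/derivable ?/derive E1.
Qed.

Lemma MVT_line f x (v : E) (h : R) : 0 < h ->
  (forall s : R, 0 <= s <= h -> derivable f (s *: v + x) v) ->
  exists2 s : R, 0 < s < h & f (h *: v + x) - f x = h * 'D_v f (s *: v + x).
Proof.
move=> h0 df; pose F := fun t : R => f (t *: v + x).
have [||c] := @MVT R F (fun s => 'D_v f (s *: v + x)) 0 h h0.
- move=> s; rewrite in_itv /= => /andP[s0 sh]; apply: is_derive_line.
  by apply: df; rewrite !ltW.
- apply: derivable_within_continuous => s; rewrite in_itv /= => sh.
  by have [] := is_derive_line (df s sh).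
- rewrite in_itv /= => ch; rewrite /F scale0r add0r subr0 => ->.
  by exists c => //; rewrite mulrC.
Qed.

Lemma coord_le_norm x i : `|x 0 i| <= `|x|.
Proof.
rewrite [leRHS]/Num.Def.normr/= mx_normrE.
exact: (le_bigmax 0 (fun j : 'I_1 * 'I_3 => `|x j.1 j.2|) (0, i)).
Qed.

Lemma norm_le_coord x (r : R) : 0 <= r -> (forall i, `|x 0 i| <= r) -> `|x| <= r.
Proof.
move=> r0 xr; rewrite [leLHS]/Num.Def.normr/= mx_normrE bigmax_le// => -[i j] _ /=.
by rewrite ord1.
Qed.

Lemma norm_basis l : `|basis l : E| = 1.
Proof.
apply/le_anti/andP; split.
  by apply: norm_le_coord => // i; rewrite mxE; case: (_ && _); rewrite ?normr1 ?normr0.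
by have := coord_le_norm (basis l) l; rewrite mxE !eqxx normr1.
Qed.

(** Two applications of the mean value theorem, first to a difference of f
and then to a partial derivative, so only these two derivatives need to exist. *)
Lemma second_difference f x k l (h : R) : 0 < h ->
  (forall s t : R, 0 <= s <= h -> 0 <= t <= h ->
     derivable f (s *: basis k + (t *: basis l + x)) (basis k) /\
     derivable (partial k f) (s *: basis k + (t *: basis l + x)) (basis l)) ->
  exists s t : R, [/\ 0 < s < h, 0 < t < h &
    f (h *: basis k + (h *: basis l + x)) - f (h *: basis k + x)
      - (f (h *: basis l + x) - f x) =
    h * (h * partial l (partial k f) (s *: basis k + (t *: basis l + x)))].
Proof.
move=> h0 df.
have h00 : 0 <= (0 : R) <= h by rewrite lexx ltW.
have hhh : 0 <= h <= h by rewrite lexx ltW.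
pose F y := f (h *: basis l + y) - f y.
have dF (s : R) : 0 <= s <= h -> is_derive (s *: basis k + x) (basis k) F
   (partial k f (s *: basis k + (h *: basis l + x)) - partial k f (s *: basis k + x)).
  move=> sh; apply: is_deriveB; last first.
    by apply: derivableP; have [+ _] := df s 0 sh h00; rewrite scale0r add0r.
  have [+ _] := df s h sh hhh; rewrite addrCA => dfl.
  have E1 : (fun t : R => t^-1 *: (((fun y => f (h *: basis l + y)) \o
      shift (s *: basis k + x)) (t *: basis k) -
      f (h *: basis l + (s *: basis k + x)))) =
    (fun t : R => t^-1 *: ((f \o shift (h *: basis l + (s *: basis k + x)))
      (t *: basis k) - f (h *: basis l + (s *: basis k + x)))).
    by apply/funext => t /=; rewrite addrCA.
  apply: DeriveDef; rewrite ?/derivable ?/derive E1 //.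
have [|s sh] := @MVT_line F x (basis k) h h0.
  by move=> s /dF [].
have sh' : 0 <= s <= h by case/andP: sh => ? ?; rewrite !ltW.
have [_ ->] := dF _ sh'; rewrite /F addrCA => ->.
have [|t th] := @MVT_line (partial k f) (s *: basis k + x) (basis l) h h0.
  by move=> t th; have [_] := df s t sh' th; rewrite addrCA.
move=> D; exists s, t; split => //; congr (_ * _).
rewrite (addrCA (s *: basis k) (h *: basis l) x) D.
rewrite partialE (addrCA (t *: basis l) (s *: basis k) x).
reflexivity.
Qed.

Lemma continuous_near f x (e : R) : {for x, continuous f} -> 0 < e ->
  \forall y \near x, `|f x - f y| < e.
Proof. by move=> /cvgrPdist_lt; apply. Qed.

Lemma ler_dist_half (a b c e : R) :
  `|a - c| < e / 2 -> `|b - c| < e / 2 -> `|a - b| <= e.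
Proof.
move=> ac bc; rewrite (le_trans (ler_distD c _ _))// [`|c - b|]distrC.
by rewrite (splitr e) lerD// ltW.
Qed.

(** The same second difference is a value of each of the two mixed derivatives
near x; both are continuous at x. *)
Lemma Ck_schwarz B f x k l : open B -> Ck 2 B f -> B x ->
  partial k (partial l f) x = partial l (partial k f) x.
Proof.
move=> oB Cf Bx.
have cont i j : {for x, continuous (partial i (partial j f))}.
  exact: Ck_continuous (Ck_partial (Ck_partial Cf j) i) Bx.
(* Both mixed derivatives are within e / 2 of a common value. *)
apply/eqP; rewrite -subr_eq0 -normr_eq0; apply/eqP/le_anti.
rewrite normr_ge0 andbT; apply/ler_addgt0Pl => e e0; rewrite addr0.
have e20 : 0 < e / 2 by rewrite divr_gt0.
have n1 := continuous_near (cont k l) e20.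
have n2 := continuous_near (cont l k) e20.
have n3 : nbhs x B by exact: open_nbhs_nbhs.
have [r /= r0 br] := (nbhs_ballP x _).1 (filterI n3 (filterI n1 n2)).
pose h := r / 3; have h0 : 0 < h by rewrite divr_gt0.
have close s t i j : 0 <= s <= h -> 0 <= t <= h ->
    ball x r (s *: basis i + (t *: basis j + x)).
  move=> /andP[s0 sh] /andP[t0 th].
  rewrite -ball_normE /ball_ /= addrA opprD addrCA subrr addr0 normrN.
  rewrite (le_lt_trans (ler_normD _ _))// !normrZ !norm_basis !mulr1 !ger0_norm//.
  by move: r0 sh th; rewrite /h; lra.
have [|s [t [sh th D1]]] := @second_difference f x k l h h0.
  move=> s t sh th; have [By _] := br _ (close s t k l sh th).
  by split; [exact: (Ck_derivable Cf By k)|exact: (Ck_derivable (Ck_partial Cf k) By l)].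
have [|s' [t' [sh' th' D2]]] := @second_difference f x l k h h0.
  move=> s' t' sh' th'; have [By _] := br _ (close s' t' l k sh' th').
  by split; [exact: (Ck_derivable Cf By l)|exact: (Ck_derivable (Ck_partial Cf l) By k)].
have ww (a b : R) : 0 < a < b -> 0 <= a <= b by case/andP => *; rewrite !ltW.
have [_ [_ C1]] := br _ (close s t k l (ww _ _ sh) (ww _ _ th)).
have [_ [C2 _]] := br _ (close s' t' l k (ww _ _ sh') (ww _ _ th')).
have E1 : partial l (partial k f) (s *: basis k + (t *: basis l + x)) =
          partial k (partial l f) (s' *: basis l + (t' *: basis k + x)).
  apply: (mulfI (lt0r_neq0 h0)); apply: (mulfI (lt0r_neq0 h0)).
  have swap (a b c d : R) : a - b - (c - d) = a - c - (b - d) by ring.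
  apply: etrans (esym D1) _; apply: etrans _ D2.
  rewrite (addrCA (h *: basis k) (h *: basis l) x); exact: swap.
rewrite E1 in C1.
exact (ler_dist_half C2 C1).
Qed.

End schwarz.

(** * Components of smooth matrix fields *)

Section smooth_components.
Context {R : realType}.
Local Notation E := 'rV[R]_3.

Lemma smooth_on_partial (W : normedModType R) (V : set E) (f : E -> W) l :
  smooth_on V f -> smooth_on V (partial l f).
Proof.
move=> Sf s x Vx; have := Sf (rcons s l) x Vx.
by rewrite /partials foldr_rcons.
Qed.

(** The bridge from vector-valued smoothness to the scalar calculus used
below. *)
Lemma smooth_on_Ck m n (V : set E) (f : E -> 'M[R]_(m, n)) i j k : open V ->
  smooth_on V f -> Ck k V (fun x => f x i j).
Proof.
move=> oV; have cont (h : E -> 'M[R]_(m, n)) x : smooth_on V h -> V x ->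
    {for x, continuous (fun x => h x i j)}.
  move=> Sh Vx; have [ch _] := Sh [::] x Vx.
  by apply: (@continuous_comp _ _ _ h (fun M : 'M[R]_(m, n) => M i j)) => //;
    exact: coord_continuous.
elim: k f => [|k IH] f Sf; first by split => // x; exact: cont.
apply: (@Ck_intro _ _ _ _ (fun l x => partial l f x i j)) => //.
- by move=> x; exact: cont.
- move=> l x Vx; have [_ /(_ l) df] := Sf [::] x Vx; rewrite /= in df.
  apply: DeriveDef; first by have /derivable_mxP := df.
  by rewrite /partial (derive_mx df) mxE.
- by move=> l; apply: IH; exact: smooth_on_partial.
Qed.

Lemma Ck_det m k (V : set E) (f : E -> 'M[R]_m) : open V ->
  (forall i j, Ck k V (fun x => f x i j)) -> Ck k V (fun x => \det (f x)).
Proof.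
move=> oV Cf; rewrite /determinant.
apply: (@Ck_sum _ k V _ _ _ (fun (s : 'S_m) x => (-1) ^+ s * \prod_i f x i (s i)) oV) => s.
apply: (CkZ ((-1) ^+ s) oV).
by apply: (@Ck_prod _ k V _ _ _ (fun i x => f x i (s i)) oV) => i; exact: Cf.
Qed.

Lemma Ck_invmx m k (V : set E) (f : E -> 'M[R]_m) i j : open V ->
  (forall i j, Ck k V (fun x => f x i j)) ->
  (forall x, V x -> \det (f x) != 0) -> Ck k V (fun x => invmx (f x) i j).
Proof.
move=> oV Cf df.
have Ccof p q : Ck k V (fun x => cofactor (f x) p q).
  apply: (CkZ ((-1) ^+ (p + q)) oV); apply: (Ck_det oV) => u w.
  by apply: (Ck_ext oV _ (Cf (lift p u) (lift q w))) => x _; rewrite !mxE.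
apply: (Ck_ext oV _ (CkM oV (CkV oV df (Ck_det oV Cf)) (Ccof j i))) => x /set_mem Vx.
by rewrite /invmx unitmxE unitfE df// !mxE.
Qed.

End smooth_components.

(** * Riemann sums over cubic grids *)

Section grid.
Context {R : realType} (L : nat).
Local Notation E := 'rV[R]_3.
Implicit Types (f g : E -> R) (x : E) (n : nat).

Definition mesh n : R := n.+1%:R^-1.

(** The n-th grid cuts the cube [-L, L]^3 into cells of side 1 / (n + 1). *)
Definition node n (i : nat) : R := i%:R * mesh n - L%:R.

Definition grid_point n (i j k : nat) : E :=
  \row_(q < 3) node n (nth 0%N [:: i; j; k] q).

Definition grid_size n : nat := (2 * L * n.+1)%N.

Definition grid_sum n (f : E -> R) : R :=
  mesh n ^+ 3 * \sum_(0 <= i < grid_size n) \sum_(0 <= j < grid_size n)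
    \sum_(0 <= k < grid_size n) f (grid_point n i j k).

(** For a continuous f supported in the cube this says that the integral of f
is at most 0. *)
Definition asneg f : Prop :=
  forall e, 0 < e -> \forall n \near \oo, grid_sum n f <= e.

Lemma mesh_gt0 n : 0 < mesh n.
Proof. by rewrite invr_gt0. Qed.

Lemma mesh_near (e : R) : 0 < e -> \forall n \near \oo, mesh n < e.
Proof. by move=> e0; apply: near_infty_natSinv_lt (PosNum e0). Qed.

Lemma grid_sum_le n f g : (forall x, f x <= g x) -> grid_sum n f <= grid_sum n g.
Proof.
move=> fg; apply: ler_wpM2l; first by rewrite exprn_ge0// ltW// mesh_gt0.
by do 3 (apply: ler_sum => ? _).
Qed.

Lemma grid_sumD n f g :
  grid_sum n (fun x => f x + g x) = grid_sum n f + grid_sum n g.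
Proof.
rewrite /grid_sum -mulrDr; congr (_ * _); rewrite -big_split /=.
apply: eq_bigr => i _; rewrite -big_split /=; apply: eq_bigr => j _.
by rewrite -big_split.
Qed.

Lemma grid_sumZ n (c : R) f : grid_sum n (fun x => c * f x) = c * grid_sum n f.
Proof.
rewrite /grid_sum mulrCA; congr (_ * _); rewrite mulr_sumr.
apply: eq_bigr => i _; rewrite mulr_sumr; apply: eq_bigr => j _.
by rewrite mulr_sumr.
Qed.

Lemma asneg_le f g : (forall x, f x <= g x) -> asneg g -> asneg f.
Proof.
move=> fg ng e e0; near=> n; apply: le_trans (grid_sum_le n fg) _.
by near: n; exact: ng.
Unshelve. all: by end_near. Qed.

Lemma asnegD f g : asneg f -> asneg g -> asneg (fun x => f x + g x).
Proof.
move=> nf ng e e0; near=> n; rewrite grid_sumD (splitr e) lerD//.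
  by near: n; apply: nf; rewrite divr_gt0.
by near: n; apply: ng; rewrite divr_gt0.
Unshelve. all: by end_near. Qed.

Lemma asneg0 : asneg (fun=> 0).
Proof.
move=> e e0; near=> n; rewrite (_ : (fun=> 0) = (fun=> 0 * 0)); last first.
  by rewrite mul0r.
by rewrite (grid_sumZ n 0 (fun=> 0)) mul0r ltW.
Unshelve. all: by end_near. Qed.

Lemma asnegZ (c : R) f : 0 <= c -> asneg f -> asneg (fun x => c * f x).
Proof.
rewrite le_eqVlt => /orP[/eqP<- _|c0 nf e e0].
  by apply: asneg_le asneg0 => x; rewrite mul0r.
near=> n; rewrite grid_sumZ mulrC -ler_pdivlMr//.
by near: n; apply: nf; rewrite divr_gt0.
Unshelve. all: by end_near. Qed.

Lemma node_bound n i : (i < grid_size n)%N -> - L%:R <= node n i < L%:R.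
Proof.
move=> iM; apply/andP; split.
  by rewrite /node lerBrDr addNr mulr_ge0// ltW// mesh_gt0.
rewrite /node ltrBlDr /mesh ltr_pdivrMr// -natrD -natrM ltr_nat addnn -mul2n.
exact: iM.
Qed.

Lemma node_last n : node n (grid_size n) = L%:R.
Proof.
rewrite /node /grid_size natrM mulfK ?pnatr_eq0//.
by rewrite mul2n -addnn natrD addrK.
Qed.

Lemma node0 n : node n 0 = - L%:R.
Proof. by rewrite /node mul0r sub0r. Qed.

Lemma grid_point_shift n i j k :
  (mesh n *: basis 0 + grid_point n i j k = grid_point n i.+1 j k) *
  (mesh n *: basis 1 + grid_point n i j k = grid_point n i j.+1 k) *
  (mesh n *: basis 2 + grid_point n i j k = grid_point n i j k.+1).
Proof.
have nodeS i' : mesh n * 1 + node n i' = node n i'.+1.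
  by rewrite /node -[in RHS]natr1; ring.
by do ![split]; apply/rowP => q; rewrite !mxE; case: q => [[|[|[|q]]] Hq] //=;
  rewrite ?mulr0 ?add0r ?nodeS.
Qed.

Lemma ord3_cases (P : 'I_3 -> Prop) : P 0 -> P 1 -> P 2 -> forall l, P l.
Proof.
move=> P0 P1 P2 [[|[|[|l]]] Hl] //.
- by rewrite (_ : Ordinal Hl = 0) //; apply: val_inj.
- by rewrite (_ : Ordinal Hl = 1) //; apply: val_inj.
- by rewrite (_ : Ordinal Hl = 2) //; apply: val_inj.
Qed.

(** The difference quotients of a function that vanishes outside the open
cube telescope along the grid lines of their direction. *)
Lemma telescope_grid n f (l : 'I_3) :
  (forall x q, L%:R <= `|x 0 q| -> f x = 0) ->
  \sum_(0 <= i < grid_size n) \sum_(0 <= j < grid_size n)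
    \sum_(0 <= k < grid_size n)
    (f (mesh n *: basis l + grid_point n i j k) - f (grid_point n i j k)) = 0.
Proof.
move=> f0.
have tel (F : nat -> R) : F 0%N = 0 -> F (grid_size n) = 0 ->
    \sum_(0 <= i < grid_size n) (F i.+1 - F i) = 0.
  by move=> F0 F1; rewrite telescope_sumr// F0 F1 subrr.
have L0 (i j k : nat) (q : 'I_3) : nth 0%N [:: i; j; k] q = 0%N ->
    f (grid_point n i j k) = 0.
  by move=> q0; apply: (f0 _ q); rewrite mxE q0 node0 normrN ger0_norm.
have LM (i j k : nat) (q : 'I_3) : nth 0%N [:: i; j; k] q = grid_size n ->
    f (grid_point n i j k) = 0.
  by move=> q0; apply: (f0 _ q); rewrite mxE q0 node_last ger0_norm.
elim/ord3_cases: l.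
- rewrite exchange_big big1// => j _; rewrite exchange_big big1// => k _.
  under eq_bigr do rewrite grid_point_shift.
  apply: (tel (fun i => f (grid_point n i j k))).
    exact: (L0 _ _ _ 0).
  exact: (LM _ _ _ 0).
- rewrite big1// => i _; rewrite exchange_big big1// => k _.
  under eq_bigr do rewrite grid_point_shift.
  apply: (tel (fun j => f (grid_point n i j k))).
    exact: (L0 _ _ _ 1).
  exact: (LM _ _ _ 1).
- rewrite big1// => i _; rewrite big1// => j _.
  under eq_bigr do rewrite grid_point_shift.
  apply: (tel (fun k => f (grid_point n i j k))).
    exact: (L0 _ _ _ 2).
  exact: (LM _ _ _ 2).
Qed.

(** Uniform continuity on the compact cube, in the form needed to compare
values at grid points with values at distance at most one mesh. *)
Lemma box_uniform f (e : R) : continuous f -> 0 < e ->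
  \forall n \near \oo, forall x, (forall q, - L%:R <= x 0 q <= L%:R) ->
    forall y, `|x - y| <= mesh n -> `|f x - f y| <= e.
Proof.
move=> cf e0.
pose A : 'I_3 -> set R := fun=> `[(- L%:R), L%:R]%classic.
have cK : compact [set v : E | forall q, A q (v ord0 q)].
  by apply: rV_compact => i; exact: segment_compact.
have /compact_near_coveringP ncov := cK.
have := ncov nat \oo
  (fun n x => forall y, `|x - y| <= mesh n -> `|f x - f y| <= e) _ _.
have cov x : [set v : E | forall q, A q (v ord0 q)] x ->
    \forall x' \near x & n \near \oo,
      forall y, `|x' - y| <= mesh n -> `|f x' - f y| <= e.
  move=> _; have e2 : 0 < e / 2 by rewrite divr_gt0.
  have [r /= r0 br] := (nbhs_ballP x _).1 (continuous_near (cf x) e2).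
  have r2 : 0 < r / 2 by rewrite divr_gt0.
  exists (ball x (r / 2), [set n | mesh n < r / 2]) => /=.
    by split; [exact: nbhsx_ballx|exact: mesh_near].
  move=> [x' n] /= [xx' nr] y x'y.
  have bx' : ball x r x' by apply: le_ball xx'; rewrite ler_pdivrMr// ler_peMr ?ler1n// ltW.
  have by' : ball x r y.
    move: xx'; rewrite -!ball_normE /= => xx'.
    rewrite (le_lt_trans (ler_distD x' _ _))// (splitr r) ltr_leD//.
    exact: le_trans x'y (ltW nr).
  have := br _ bx'; have := br _ by'; rewrite /= => A1 A2.
  by apply: (@ler_dist_half R _ _ (f x)); rewrite distrC.
move=> /(_ _ cov); apply: filterS => n sub x xL y; apply: sub => q.
by rewrite /A /= in_itv /=.
Qed.

Lemma sum3_const (m : nat) (c : R) :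
  \sum_(0 <= i < m) \sum_(0 <= j < m) \sum_(0 <= k < m) c = c * m%:R ^+ 3.
Proof.
have S (b : R) : \sum_(0 <= i < m) b = b * m%:R.
  by rewrite sumr_const_nat subn0 mulr_natr.
under eq_bigr do (under eq_bigr do rewrite S; rewrite S).
by rewrite S; ring.
Qed.

Lemma grid_volume n : mesh n ^+ 3 * (grid_size n)%:R ^+ 3 = (2 * L%:R) ^+ 3.
Proof.
by rewrite -exprMn /grid_size !natrM /mesh mulrC mulfK ?pnatr_eq0.
Qed.

Lemma grid_sum_bounded n f (c : R) :
  (forall x, (forall q, - L%:R <= x 0 q < L%:R) -> f x <= c) ->
  grid_sum n f <= c * (2 * L%:R) ^+ 3.
Proof.
move=> fc; rewrite -(grid_volume n) mulrCA -sum3_const.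
apply: ler_wpM2l; first by rewrite exprn_ge0// ltW// mesh_gt0.
rewrite !big_nat; apply: ler_sum => i /andP[_ iM].
rewrite !big_nat; apply: ler_sum => j /andP[_ jM].
rewrite !big_nat; apply: ler_sum => k /andP[_ kM].
apply: fc; elim/ord3_cases; rewrite mxE; exact: node_bound.
Qed.

(** The derivative at a grid point differs little from the difference
quotient over one mesh, and the sum of the latter vanishes. *)
Lemma asneg_divergence f (l : 'I_3) :
  (forall x, derivable f x (basis l)) -> continuous (partial l f) ->
  (forall x q, L%:R <= `|x 0 q| -> f x = 0) -> asneg (partial l f).
Proof.
move=> df cdf f0 e e0.
pose e' := e / ((2 * L%:R) ^+ 3 + 1).
have V0 : 0 < (2 * L%:R) ^+ 3 + 1 :> R by rewrite ltr_wpDl// exprn_ge0// mulr_ge0.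
have e'0 : 0 < e' by rewrite divr_gt0.
have := box_uniform cdf e'0; apply: filterS => n un.
have h0 := mesh_gt0 n.
pose D x := (mesh n)^-1 * (f (mesh n *: basis l + x) - f x).
have : grid_sum n (fun x => partial l f x - D x) <= e' * (2 * L%:R) ^+ 3.
  apply: grid_sum_bounded => x xL.
  have [|s /andP[s0 sh] fE] := @MVT_line R f x (basis l) _ h0.
    by move=> s _; exact: df.
  rewrite /D fE mulKf ?gt_eqF//; apply: le_trans (ler_norm _) _.
  apply: un => [q|]; first by have /andP[-> /ltW ->] := xL q.
  by rewrite opprD addrCA subrr addr0 normrN normrZ norm_basis mulr1 ger0_norm ltW.
have -> : grid_sum n (fun x => partial l f x - D x) = grid_sum n (partial l f).
  have -> : (fun x => partial l f x - D x) = (fun x => partial l f x + (- 1) * D x).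
    by apply/funext => x; rewrite mulN1r.
  rewrite grid_sumD grid_sumZ grid_sumZ [X in _ * (_ * X)]/grid_sum.
  by rewrite telescope_grid// !mulr0 addr0.
move=> /le_trans; apply; rewrite /e' mulrAC ler_pdivrMr// ler_pM2l//.
by rewrite lerDl.
Qed.

(** An interval of half-width d contains at least d / 4 of the total mesh length
once the mesh is below d / 4: the nodes right of its centre up to distance
about d / 2 already suffice. *)
Lemma sum_bump n (c d : R) : 0 < d -> - L%:R < c -> c + d < L%:R ->
  mesh n < d / 4 -> d / 4 <=
  mesh n * \sum_(0 <= i < grid_size n) (`|node n i - c| < d)%R%:R.
Proof.
move=> d0 cL cdL hd.
have h0 := mesh_gt0 n; have hn : (n.+1%:R : R) * mesh n = 1 by rewrite mulfV// pnatr_eq0.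
(* The nodes p, ..., p + m - 1 lie between c and c + d / 2 + mesh. *)
pose p := (Num.truncn ((c + L%:R) * n.+1%:R)).+1.
pose m := Num.truncn (d / 2 * n.+1%:R).
have [p1 p2] : (c + L%:R) < p%:R * mesh n /\ p%:R * mesh n <= c + L%:R + mesh n.
  have /andP[t1 t2] : (Num.truncn ((c + L%:R) * n.+1%:R))%:R <= (c + L%:R) * n.+1%:R
     < p%:R.
    by apply: truncn_itv; rewrite mulr_ge0// -[L%:R]opprK subr_ge0 ltW.
  split; first by rewrite /mesh ltr_pdivlMr.
  rewrite /p -natr1 mulrDl mul1r lerD2r.
  by rewrite /mesh ler_pdivrMr.
have [m1 m2] : m%:R * mesh n <= d / 2 /\ d / 2 - mesh n < m%:R * mesh n.
  have /andP[t1 t2] : (m%:R) <= d / 2 * n.+1%:R < m.+1%:R.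
    by apply: truncn_itv; rewrite mulr_ge0// divr_ge0// ltW.
  split; first by rewrite /mesh ler_pdivrMr.
  rewrite ltrBlDr -[X in _ < _ + X]mul1r -mulrDl natr1.
  by rewrite /mesh ltr_pdivlMr.
have pmM : (p + m <= grid_size n)%N.
  rewrite -(ler_nat R) -(ler_pM2r h0) /grid_size [in leRHS]natrM natrM -mulrA hn mulr1.
  rewrite natrD mulrDl; move: p2 m1 hd cdL d0 h0; clear; lra.
rewrite (@big_cat_nat _ _ _ (p + m)%N)//= (@big_cat_nat _ _ _ p 0 (p + m)%N) ?leq_addr//=.
apply: (@le_trans _ _ (mesh n * m%:R)).
  by rewrite mulrC; move: m2 hd; clear; lra.
rewrite ler_pM2l// -addrA addrCA; apply: ler_wpDr.
  by rewrite addr_ge0// sumr_ge0.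
have -> : m%:R = \sum_(p <= i < p + m) (1 : R).
  by rewrite sumr_const_nat addKn.
apply: ler_sum_nat => i /andP[pi ipm].
rewrite (_ : (`|_ - c| < d) = true)//; apply/idP.
have i1 : p%:R * mesh n <= i%:R * mesh n by rewrite ler_pM2r// ler_nat.
have i2 : i%:R * mesh n <= (p%:R + m%:R) * mesh n.
  by rewrite ler_pM2r// -natrD ler_nat ltnW.
rewrite ltr_norml /node; move: i1 i2 p1 p2 m1 hd d0 h0; clear.
rewrite mulrDl => *; apply/andP; split; lra.
Qed.

(** On all fine grids the indicator of a cube of half-side d has sums at least
(d / 4)^3, by [sum_bump] in each coordinate. This crude bound suffices, because
the factor a will be arbitrarily large compared to b. *)
Lemma bump_not_asneg (c : E) (d a b : R) : 0 < d -> 0 < a ->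
  (forall q, - L%:R < c 0 q /\ c 0 q + d < L%:R) ->
  b * (2 * L%:R) ^+ 3 < a * (d / 4) ^+ 3 ->
  ~ asneg (fun x => a * [forall q, `|x 0 q - c 0 q| < d]%:R - b).
Proof.
move=> d0 a0 cL ab nf.
pose f x : R := [forall q, `|x 0 q - c 0 q| < d]%:R.
pose e := (a * (d / 4) ^+ 3 - b * (2 * L%:R) ^+ 3) / 2.
have e0 : 0 < e by rewrite divr_gt0// subr_gt0.
have d4 : 0 < d / 4 by rewrite divr_gt0.
have : \forall n \near \oo, grid_sum n (fun x => a * f x - b) <= e /\ mesh n < d / 4.
  by apply: filterI; [exact: nf|exact: mesh_near].
move=> [N _ /(_ N (leqnn N)) /= [s1 hd]].
have s2 : (d / 4) ^+ 3 <= grid_sum N f.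
  pose u (q : 'I_3) i : R := (`|node N i - c 0 q| < d)%R%:R.
  have -> : grid_sum N f = \prod_(q < 3)
      (mesh N * \sum_(0 <= i < grid_size N) u q i).
    rewrite !big_ord_recl big_ord0 mulr1 /grid_sum.
    transitivity (mesh N ^+ 3 * ((\sum_(0 <= i < grid_size N) u 0 i) *
       ((\sum_(0 <= j < grid_size N) u 1 j) * (\sum_(0 <= k < grid_size N) u 2 k)))).
      congr (_ * _); rewrite mulr_suml; apply: eq_bigr => i _.
      rewrite mulr_suml mulr_sumr; apply: eq_bigr => j _.
      rewrite !mulr_sumr; apply: eq_bigr => k _.
      rewrite /f /u -!natrM !mulnb; congr (_%:R); congr nat_of_bool.
      apply/forallP/idP => [H|/and3P[H0 H1 H2]].
        by have := H 0; have := H 1; have := H 2; rewrite !mxE /= => -> -> ->.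
      by apply: ord3_cases; rewrite !mxE.
    rewrite (_ : lift ord0 ord0 = 1 :> 'I_3); last exact: val_inj.
    rewrite (_ : lift ord0 (lift ord0 ord0) = 2 :> 'I_3); last exact: val_inj.
    by rewrite exprS expr2; ring.
  have -> : (d / 4) ^+ 3 = \prod_(q < 3) (d / 4).
    by rewrite prodr_const card_ord.
  apply: ler_prod => q _; rewrite ltW//=.
  by have [cq1 cq2] := cL q; exact: sum_bump.
move: s1; have -> : (fun x => a * f x - b) = (fun x => a * f x + (- b) * 1).
  by apply/funext => x; rewrite mulr1.
rewrite grid_sumD !grid_sumZ.
have -> : grid_sum N (fun=> 1) = (2 * L%:R) ^+ 3.
  by rewrite /grid_sum sum3_const mul1r grid_volume.
have s3 : a * (d / 4) ^+ 3 <= a * grid_sum N f by rewrite ler_pM2l.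
move: s3 ab; rewrite /e; clear.
set V := (_ ^+ 3); set A := a * V; set B := b * _; set C := a * _.
by rewrite mulNr -/B; lra.
Qed.

End grid.

(** * Pointwise algebra of the conjugated system *)

Section pointwise.
Context {R : realType}.
Implicit Types (a f D : 'I_3 -> 'I_3 -> R) (n N v P G : 'I_3 -> R).

Lemma sum3E (F : 'I_3 -> R) : \sum_(i < 3) F i = F 0 + F 1 + F 2.
Proof.
rewrite !big_ord_recl big_ord0 addr0 addrA; congr (_ + F _ + F _); exact: val_inj.
Qed.

Lemma ler_sum3 (F G : 'I_3 -> R) : (forall i, F i <= G i) ->
  \sum_(i < 3) F i <= \sum_(i < 3) G i.
Proof. by move=> FG; apply: ler_sum => i _. Qed.

Lemma sum3_const_ord (c : R) : \sum_(i < 3) c = 3 * c.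
Proof. by rewrite sumr_const card_ord mulr_natl. Qed.

(** Stated for opaque summands because normalizing the expanded sums of the
applications would be much more costly. *)
Lemma sum3_4NB (F : 'I_3 -> 'I_3 -> 'I_3 -> 'I_3 -> R) (c : R) :
  \sum_(l < 3) \sum_(i < 3) \sum_(j < 3) \sum_(k < 3) (- F l i j k - c) =
  - (\sum_(l < 3) \sum_(i < 3) \sum_(j < 3) \sum_(k < 3) F l i j k) - 81 * c.
Proof. by rewrite !sum3E; ring. Qed.

Lemma sum3_3B (F : 'I_3 -> 'I_3 -> 'I_3 -> R) (c : R) :
  \sum_(l < 3) \sum_(i < 3) \sum_(j < 3) (F l i j - c) =
  \sum_(l < 3) \sum_(i < 3) \sum_(j < 3) F l i j - 27 * c.
Proof. by rewrite !sum3E; ring. Qed.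

Lemma sum3_3NB (F : 'I_3 -> 'I_3 -> 'I_3 -> R) (c : R) :
  \sum_(l < 3) \sum_(i < 3) \sum_(j < 3) (- F l i j - c) =
  - (\sum_(l < 3) \sum_(i < 3) \sum_(j < 3) F l i j) - 27 * c.
Proof. by rewrite !sum3E; ring. Qed.

Definition quad a n v : R := \sum_(i < 3) \sum_(j < 3) a i j * n i * v j.
Definition sumsq v : R := \sum_(i < 3) v i ^+ 2.
Definition sumsq2 D : R := \sum_(i < 3) \sum_(j < 3) D i j ^+ 2.

Lemma sumsq_ge v i : v i ^+ 2 <= sumsq v.
Proof. by rewrite /sumsq (bigD1 i)//= lerDl sumr_ge0// => k _; exact: sqr_ge0. Qed.

Lemma sumsq_ge0 v : 0 <= sumsq v.
Proof. by apply: sumr_ge0 => k _; exact: sqr_ge0. Qed.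

Lemma sumsq2_row D i : sumsq (D i) <= sumsq2 D.
Proof.
rewrite /sumsq2 (bigD1 i)//= lerDl; apply: sumr_ge0 => k _; exact: sumsq_ge0.
Qed.

Lemma sumsq2_ge D i j : D i j ^+ 2 <= sumsq2 D.
Proof.
apply: (@le_trans _ _ (sumsq (D i))); first exact: sumsq_ge.
rewrite /sumsq2 (bigD1 i)//= lerDl; apply: sumr_ge0 => k _; exact: sumsq_ge0.
Qed.

Lemma sumsq2_ge0 D : 0 <= sumsq2 D.
Proof. by apply: sumr_ge0 => k _; exact: sumsq_ge0. Qed.

(** The inequality of arithmetic and geometric means with a free parameter. *)
Lemma young (x y t : R) : 0 < t -> `|x * y| <= (t * x ^+ 2 + y ^+ 2 / t) / 2.
Proof.
move=> t0; have t1 : t * t^-1 = 1 by rewrite mulfV// gt_eqF.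
have ti : 0 < t^-1 by rewrite invr_gt0.
have p1 : 0 <= t^-1 * (t * x - y) ^+ 2 by rewrite mulr_ge0 ?sqr_ge0// ltW.
have p2 : 0 <= t^-1 * (t * x + y) ^+ 2 by rewrite mulr_ge0 ?sqr_ge0// ltW.
have E1 : t^-1 * (t * x - y) ^+ 2 = t * x ^+ 2 * (t * t^-1) - 2 * x * y * (t * t^-1) + y ^+ 2 * t^-1.
  by ring.
have E2 : t^-1 * (t * x + y) ^+ 2 = t * x ^+ 2 * (t * t^-1) + 2 * x * y * (t * t^-1) + y ^+ 2 * t^-1.
  by ring.
move: p1 p2; rewrite E1 E2 t1 !mulr1 ler_norml; clear.
by move=> *; apply/andP; split; lra.
Qed.

(** The undifferentiated conormal in the second argument combines with a
to give N_i, so that the products of derivatives pair up as null forms. *)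
Lemma quad_transport_rotation a n N D : (forall i j, a i j = a j i) ->
  (forall i, N i = \sum_(k < 3) a i k * n k) ->
  quad a (fun i => \sum_(l < 3) N l * D l i)
    (fun i => n i * (\sum_(j < 3) \sum_(k < 3) a j k * D j k)
              - \sum_(k < 3) N k * D i k) =
  \sum_(l < 3) \sum_(i < 3) \sum_(j < 3) \sum_(k < 3)
    N l * N i * a j k * (D l i * D j k - D j i * D l k).
Proof.
move=> sa NE; set X := \sum_(j < 3) _.
transitivity ((\sum_(i < 3) N i * \sum_(l < 3) N l * D l i) * X
   - quad a (fun i => \sum_(l < 3) N l * D l i) (fun i => \sum_(k < 3) N k * D i k)).
  rewrite /quad mulr_suml -sumrB; apply: eq_bigr => i _.
  rewrite {1}NE !mulr_suml -sumrB; apply: eq_bigr => j _.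
  rewrite (sa i j); move: (\sum_(l < 3) _) (\sum_(k < 3) _) => p q; ring.
rewrite /X /quad !sum3E (sa 1 0) (sa 2 0) (sa 2 1); ring.
Qed.

(** Expansion of a(P - G, P - G) >= 0. *)
Lemma quad_young a P G : (forall i j, a i j = a j i) ->
  (forall x, 0 <= quad a x x) ->
  4 * quad a P G <= quad a (fun i => P i + G i) (fun i => P i + G i).
Proof.
move=> sa pa; rewrite -subr_ge0.
rewrite (_ : _ - _ = quad a (fun i => P i - G i) (fun i => P i - G i))//.
rewrite /quad !sum3E (sa 1 0) (sa 2 0) (sa 2 1); ring.
Qed.

(** The conormal contracted with a divergence h and an antisymmetric curl f. It
is chosen so that the terms in v_i that come from the conjugation add up to a
multiple of v, as [contractionE] shows. *)
Definition contraction n N f (h : R) i : R := n i * h - \sum_(k < 3) N k * f i k.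

(** Conjugation by an exponential whose exponent has gradient -s n replaces
each derivative d_i by d_i + s n_i. *)
Definition conj_curl n v D (s : R) i k : R :=
  D i k - D k i + s * (n i * v k - n k * v i).

Definition conj_div a n v D (s : R) : R :=
  \sum_(j < 3) \sum_(k < 3) a j k * (D j k + s * (n j * v k)).

(** The derivative along N and a rotational part appear next to s (n.N) v. All
other zeroth-order terms cancel. *)
Lemma contractionE a n N v D (s : R) i : (forall i j, a i j = a j i) ->
  (forall i, N i = \sum_(k < 3) a i k * n k) ->
  contraction n N (conj_curl n v D s) (conj_div a n v D s) i =
  \sum_(l < 3) N l * D l i +
  ((n i * (\sum_(j < 3) \sum_(k < 3) a j k * D j k) - \sum_(k < 3) N k * D i k) +
   s * (\sum_(k < 3) n k * N k) * v i).
Proof.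
move=> sa NE; rewrite /contraction /conj_curl /conj_div !sum3E.
rewrite !NE !sum3E (sa 1 0) (sa 2 0) (sa 2 1); ring.
Qed.

Lemma quad_le a x (A : R) : (forall i j, `|a i j| <= A) ->
  quad a x x <= 3 * A * sumsq x.
Proof.
move=> aA; have A0 : 0 <= A by exact: le_trans (aA 0 0).
apply: (@le_trans _ _ (\sum_(i < 3) \sum_(j < 3) A * ((x i ^+ 2 + x j ^+ 2) / 2))).
  apply: ler_sum3 => i; apply: ler_sum3 => j.
  apply: le_trans (ler_norm _) _; rewrite -mulrA normrM ler_pM//.
  by apply: le_trans (young _ _ ltr01) _; rewrite mul1r divr1.
by rewrite le_eqVlt; apply/orP; left; apply/eqP; rewrite /sumsq !sum3E; field.
Qed.

Lemma sqr_sum4 (x y z w : R) :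
  (x - (y + z + w)) ^+ 2 <= 4 * (x ^+ 2 + y ^+ 2 + z ^+ 2 + w ^+ 2).
Proof.
rewrite -subr_ge0.
have -> : 4 * (x ^+ 2 + y ^+ 2 + z ^+ 2 + w ^+ 2) - (x - (y + z + w)) ^+ 2 =
  (x + y) ^+ 2 + (x + z) ^+ 2 + (x + w) ^+ 2 + (y - z) ^+ 2 + (y - w) ^+ 2 + (z - w) ^+ 2.
  by ring.
by rewrite !addr_ge0// sqr_ge0.
Qed.

Lemma sqr_le_norm (x A : R) : `|x| <= A -> x ^+ 2 <= A ^+ 2.
Proof.
by move=> xA; rewrite -[x ^+ 2]real_normK ?num_real// ler_pXn2r ?nnegrE//; exact: le_trans xA.
Qed.

Lemma contraction_le n N f (h A : R) :
  (forall i, `|n i| <= A) -> (forall i, `|N i| <= A) ->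
  sumsq (contraction n N f h) <= 12 * A ^+ 2 * (sumsq2 f + h ^+ 2).
Proof.
move=> nA NA.
apply: (@le_trans _ _ (\sum_(i < 3) 4 * (A ^+ 2 * h ^+ 2 + A ^+ 2 * sumsq (f i)))).
  apply: ler_sum3 => i; rewrite /contraction sum3E.
  apply: le_trans (sqr_sum4 _ _ _ _) _; rewrite ler_pM2l// /sumsq sum3E !exprMn !mulrDr.
  rewrite -!addrA !lerD// ler_wpM2r ?sqr_ge0//; exact: sqr_le_norm.
have f0 := sumsq2_ge0 f; have A0 := sqr_ge0 A.
have p0 : 0 <= A ^+ 2 * sumsq2 f by rewrite mulr_ge0.
rewrite -mulr_sumr big_split /= sum3_const_ord -mulr_sumr.
rewrite (_ : \sum_(i < 3) sumsq (f i) = sumsq2 f)//.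
by move: p0; clear; move: (sumsq2 f) (h ^+ 2) (A ^+ 2) => *; lra.
Qed.

Lemma quad_contraction_le a n N f (h A : R) :
  (forall i j, `|a i j| <= A) ->
  (forall i, `|n i| <= A) -> (forall i, `|N i| <= A) ->
  quad a (contraction n N f h) (contraction n N f h) <=
  36 * A ^+ 3 * (sumsq2 f + h ^+ 2).
Proof.
move=> aA nA NA; apply: le_trans (quad_le _ aA) _.
have A0 : 0 <= 3 * A by rewrite mulr_ge0//; exact: le_trans (aA 0 0).
apply: le_trans (ler_wpM2l A0 (contraction_le f h nA NA)) _.
by rewrite le_eqVlt; apply/orP; left; apply/eqP; ring.
Qed.

(** The second summand is a null form, whose integral is of lower order; the
first is controlled by the curl and the third by the divergence. So the
elliptic form controls the whole gradient. *)
Lemma gradient_identity a D : (forall i j, a i j = a j i) ->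
  \sum_(k < 3) quad a (D ^~ k) (D ^~ k) =
  \sum_(k < 3) \sum_(j < 3) \sum_(i < 3) a j i * D j k * (D i k - D k i) +
  \sum_(k < 3) \sum_(j < 3) \sum_(i < 3) a j i * (D j k * D k i - D k k * D j i) +
  (\sum_(k < 3) D k k) * (\sum_(j < 3) \sum_(i < 3) a j i * D j i).
Proof.
by move=> sa; rewrite /quad !sum3E (sa 1 0) (sa 2 0) (sa 2 1); ring.
Qed.

(** The curl and divergence in [gradient_identity] differ from the conjugated
ones by terms s n v, with s of the order of tau. The parameter d is chosen later to
absorb the gradient on the right-hand side. *)
Lemma gradient_bound a n N v D (s tau d A : R) : (forall i j, a i j = a j i) ->
  (forall i, N i = \sum_(k < 3) a i k * n k) ->
  0 < d -> 0 <= s <= 2 * tau ->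
  (forall i j, `|a i j| <= A) ->
  (forall i, `|n i| <= A) -> (forall i, `|N i| <= A) ->
  \sum_(k < 3) quad a (D ^~ k) (D ^~ k) -
  \sum_(k < 3) \sum_(j < 3) \sum_(i < 3) a j i * (D j k * D k i - D k k * D j i)
  <= (27 * A + 3) * (d * sumsq2 D) +
    (27 * A * (4 + 32 * A ^+ 2) + 3 * (4 + 48 * A ^+ 2)) / d *
    (sumsq2 (conj_curl n v D s) + conj_div a n v D s ^+ 2 + tau ^+ 2 * sumsq v).
Proof.
move=> sa NE d0 /andP[s0 s2] aA nA NA; rewrite gradient_identity// addrAC addrK.
have A0 : 0 <= A by exact: le_trans (aA 0 0).
set q := sumsq2 _ + _ + _.
have f0 := sumsq2_ge0 (conj_curl n v D s).
have h0 := sqr_ge0 (conj_div a n v D s).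
have t0 : 0 <= tau by lra.
have v0 : 0 <= tau ^+ 2 * sumsq v by rewrite mulr_ge0 ?sqr_ge0// sumsq_ge0.
have s2t : s ^+ 2 <= 4 * tau ^+ 2.
  by rewrite (_ : 4 * tau ^+ 2 = (2 * tau) ^+ 2); [rewrite ler_pXn2r// nnegrE mulr_ge0|ring].
have A2 := sqr_ge0 A.
have prod3 (x y z X Y Z : R) : x ^+ 2 <= X -> y ^+ 2 <= Y -> z ^+ 2 <= Z ->
    x ^+ 2 * (y ^+ 2 * z ^+ 2) <= X * (Y * Z).
  move=> xX yY zZ; exact: (ler_pM (sqr_ge0 x) (mulr_ge0 (sqr_ge0 y) (sqr_ge0 z)) xX
    (ler_pM (sqr_ge0 y) (sqr_ge0 z) yY zZ)).
have snv i k : (s * (n i * v k)) ^+ 2 <= 4 * A ^+ 2 * (tau ^+ 2 * sumsq v).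
  rewrite !exprMn (_ : 4 * A ^+ 2 * _ = (4 * tau ^+ 2) * (A ^+ 2 * sumsq v)); last by ring.
  by apply: prod3 => //; [apply: sqr_le_norm|exact: sumsq_ge].
have q0 : 0 <= q by rewrite !addr_ge0.
have fq i k : (D i k - D k i) ^+ 2 <= (4 + 32 * A ^+ 2) * q.
  have -> : D i k - D k i = conj_curl n v D s i k -
     (s * (n i * v k) + - (s * (n k * v i)) + 0) by rewrite /conj_curl; ring.
  apply: le_trans (sqr_sum4 _ _ _ _) _; rewrite sqrrN expr0n addr0.
  have fik := sumsq2_ge (conj_curl n v D s) i k.
  rewrite mulrDl !mulrDr.
  have p1 : 0 <= A ^+ 2 * sumsq2 (conj_curl n v D s) by rewrite mulr_ge0.
  have p2 : 0 <= A ^+ 2 * conj_div a n v D s ^+ 2 by rewrite mulr_ge0.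
  have := snv i k; have := snv k i; move: fik f0 h0 v0.
  move: p1 p2; rewrite /q; clear.
  move: (conj_curl _ _ _ _ _ _ ^+ 2) (sumsq2 _) (conj_div _ _ _ _ _ ^+ 2)
    (tau ^+ 2 * _) ((s * (n i * _)) ^+ 2) ((s * (n k * _)) ^+ 2) (A ^+ 2) => *; lra.
have hq : (\sum_(j < 3) \sum_(i < 3) a j i * D j i) ^+ 2 <= (4 + 48 * A ^+ 2) * q.
  have -> : \sum_(j < 3) \sum_(i < 3) a j i * D j i = conj_div a n v D s -
     (s * (N 0 * v 0) + s * (N 1 * v 1) + s * (N 2 * v 2)).
    by rewrite /conj_div !NE !sum3E (sa 1 0) (sa 2 0) (sa 2 1); ring.
  apply: le_trans (sqr_sum4 _ _ _ _) _.
  have sNv i : (s * (N i * v i)) ^+ 2 <= 4 * A ^+ 2 * (tau ^+ 2 * sumsq v).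
    rewrite !exprMn (_ : 4 * A ^+ 2 * _ = (4 * tau ^+ 2) * (A ^+ 2 * sumsq v)); last by ring.
    by apply: prod3 => //; [apply: sqr_le_norm|exact: sumsq_ge].
  have p1 : 0 <= A ^+ 2 * sumsq2 (conj_curl n v D s) by rewrite mulr_ge0.
  have p2 : 0 <= A ^+ 2 * conj_div a n v D s ^+ 2 by rewrite mulr_ge0.
  have := sNv 0; have := sNv 1; have := sNv 2; move: f0 h0 v0.
  move: p1 p2; rewrite /q; clear.
  move: (sumsq2 _) (conj_div _ _ _ _ _ ^+ 2)
    (tau ^+ 2 * _) ((s * (N 0 * _)) ^+ 2) ((s * (N 1 * _)) ^+ 2)
     ((s * (N 2 * _)) ^+ 2) (A ^+ 2) => *; lra.
have half (x y t C : R) : x ^+ 2 <= t -> y ^+ 2 <= C -> x * y <= d * t + C / d.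
  move=> xt yC; apply: le_trans (ler_norm _) _; apply: le_trans (young _ _ d0) _.
  have e1 : d * x ^+ 2 <= d * t by rewrite ler_pM2l.
  have e2 : y ^+ 2 / d <= C / d by rewrite ler_pM2r ?invr_gt0.
  have e3 : 0 <= d * x ^+ 2 by rewrite mulr_ge0 ?sqr_ge0// ltW.
  have e4 : 0 <= y ^+ 2 / d by rewrite divr_ge0 ?sqr_ge0// ltW.
  move: e1 e2 e3 e4; clear; move: (d * _) (d * _) (_ / d) (_ / d) => *; lra.
set F1 := 4 + 32 * _ in fq *; set H1 := 4 + 48 * _ in hq *.
have T1 : \sum_(k < 3) \sum_(j < 3) \sum_(i < 3) a j i * D j k * (D i k - D k i)
   <= 27 * (A * (d * sumsq2 D + F1 * q / d)).
  apply: (@le_trans _ _ (\sum_(k < 3) \sum_(j < 3) \sum_(i < 3)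
     (A * (d * sumsq2 D + F1 * q / d)))); last first.
    by rewrite !sum3_const_ord le_eqVlt; apply/orP; left; apply/eqP; ring.
  apply: ler_sum3 => k; apply: ler_sum3 => j; apply: ler_sum3 => i.
  apply: le_trans (ler_norm _) _; rewrite -mulrA normrM; apply: ler_pM => //.
  have [dj|dj] := ger0P (D j k * (D i k - D k i)).
    by apply: half; [exact: sumsq2_ge|exact: fq].
  rewrite -mulNr; apply: half; last exact: fq.
  by rewrite sqrrN; exact: sumsq2_ge.
have T2 : (\sum_(k < 3) D k k) * (\sum_(j < 3) \sum_(i < 3) a j i * D j i)
   <= 3 * (d * sumsq2 D + H1 * q / d).
  rewrite mulr_suml -sum3_const_ord; apply: ler_sum3 => k.
  by apply: half => //; exact: sumsq2_ge.
apply: le_trans (lerD T1 T2) _.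
by rewrite le_eqVlt; apply/orP; left; apply/eqP; field; rewrite gt_eqF.
Qed.

(** The left-hand side is the part of the divergence of t q N_l a_ij v_i v_j in
which the derivative falls on v or on t, whose gradient is -4 g n. The derivative
of t is responsible for the term with a(v, v), whose sign is definite. *)
Lemma flux_algebra a n N v D (t q g : R) : (forall i j, a i j = a j i) ->
  q = \sum_(l < 3) n l * N l ->
  \sum_(l < 3) \sum_(i < 3) \sum_(j < 3)
    (t * (q * N l * a i j) * (D l i * v j + v i * D l j)
     + q * N l * a i j * - (4 * g * n l) * (v i * v j)) =
  2 * (t * q) * quad a (fun i => \sum_(l < 3) N l * D l i) v
  - 4 * g * q ^+ 2 * quad a v v.
Proof.
move=> sa qE.
have E1 : \sum_(l < 3) \sum_(i < 3) \sum_(j < 3) N l * a i j * (D l i * v j + v i * D l j)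
    = 2 * quad a (fun i => \sum_(l < 3) N l * D l i) v.
  by rewrite /quad !sum3E (sa 1 0) (sa 2 0) (sa 2 1); ring.
have E2 : \sum_(l < 3) \sum_(i < 3) \sum_(j < 3) n l * N l * (a i j * v i * v j)
    = q * quad a v v.
  rewrite qE mulr_suml; apply: eq_bigr => l _; rewrite /quad mulr_sumr.
  by apply: eq_bigr => i _; rewrite mulr_sumr.
transitivity (t * q * (2 * quad a (fun i => \sum_(l < 3) N l * D l i) v) +
  (- (4 * g * q)) * (q * quad a v v)); last by ring.
rewrite -E1 -E2 !mulr_sumr -big_split; apply: eq_bigr => l _ /=.
rewrite !mulr_sumr -big_split; apply: eq_bigr => i _ /=.
rewrite !mulr_sumr -big_split; apply: eq_bigr => j _ /=.
by ring.
Qed.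

End pointwise.

#[local] Opaque Ck partial.

(** * Integration by parts up to the zero set *)

Section truncation.
Context {R : realType} (L : nat).
Local Notation E := 'rV[R]_3.
Implicit Types (f g : E -> R) (x y : E).

Lemma near_line x (v : E) (P : set E) : nbhs x P ->
  \forall h \near (0 : R)^', P (h *: v + x).
Proof.
move=> xP; have c : {for (0 : R), continuous (fun h : R => h *: v + x)}.
  by apply: continuousD; [exact: scalel_continuous|exact: cst_continuous].
have : \forall h \near (0 : R), P (h *: v + x).
  by apply: c; rewrite scale0r add0r.
by move=> /nbhs_dnbhs.
Qed.

Lemma continuous_eps f x : (forall e, 0 < e -> \forall y \near x, `|f x - f y| <= e) ->
  {for x, continuous f}.
Proof. by move=> H; apply/(@cvgrPdist_le _ _ _ (nbhs x)). Qed.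

Lemma is_derive_mul f g x (v : E) (a b : R) :
  is_derive x v f a -> is_derive x v g b ->
  is_derive x v (fun y => f y * g y) (f x * b + g x * a).
Proof. by move=> df dg; exact: is_deriveM. Qed.

Lemma is_derive_cvg f x (v : E) (d : R) :
  h^-1 *: ((f \o shift x) (h *: v) - f x) @[h --> 0^'] --> d ->
  is_derive x v f d.
Proof. by move=> fd; apply: DeriveDef; [apply/cvg_ex; exists d|exact/cvg_lim]. Qed.

Variables (B Omega : set E) (v : 'I_3 -> E -> R) (kappa : R).

Definition sqnorm x : R := \sum_(k < 3) v k x ^+ 2.
(** This is |v|^(2 kappa) where v is nonzero. On a set without zeros of v it
tends to 0 at the zeros on the boundary, which makes the zero extensions below
differentiable. *)
Definition weight x : R := expR (kappa * ln (sqnorm x)).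

(** Omega is a set on whose boundary v vanishes, contained in the open cube of
half-side L. The third case of [trunc_edge] is the only information about the
boundary points of Omega; Omega itself is an arbitrary open set. *)
Record truncation : Prop := Truncation {
  trunc_openB : open B;
  trunc_open : open Omega;
  trunc_sub : Omega `<=` B;
  trunc_C2 : forall k, Ck 2 B (v k);
  trunc_pos : forall x, Omega x -> 0 < sqnorm x;
  trunc_edge : forall x,
    [\/ Omega x, nbhs x (~` Omega) | B x /\ forall k, v k x = 0];
  trunc_bounded : forall x, Omega x -> forall q, `|x 0 q| < L%:R }.

Hypothesis vP : truncation.
Hypothesis kappa0 : 0 < kappa.

Let oB : open B := trunc_openB vP.
Let oOmega : open Omega := trunc_open vP.
Let OmegaB : Omega `<=` B := trunc_sub vP.
Let Cv k : Ck 2 B (v k) := trunc_C2 vP k.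
Let Omega_pos x : Omega x -> 0 < sqnorm x := @trunc_pos vP x.
Let Omega_edge := trunc_edge vP.
Let Omega_bounded := trunc_bounded vP.

Lemma sqnorm_coord x q : v q x ^+ 2 <= sqnorm x.
Proof.
rewrite /sqnorm (bigD1 q)//= lerDl sumr_ge0// => k _; exact: sqr_ge0.
Qed.

Lemma Ck_sqnorm : Ck 2 B sqnorm.
Proof.
apply: (@Ck_sum _ 2 B _ _ _ (fun k x => v k x ^+ 2) oB) => k.
by apply: (Ck_ext oB _ (CkM oB (Cv k) (Cv k))) => x _; rewrite expr2.
Qed.

Lemma is_derive_sqnorm x l : B x ->
  is_derive x (basis l) sqnorm (2 * \sum_(q < 3) v q x * partial l (v q) x).
Proof.
move=> Bx; rewrite /sqnorm mulr_sumr.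
rewrite (_ : (fun _ => _) = \sum_(k < 3) (fun x => v k x ^+ 2)); last first.
  by apply/funext => y; rewrite fct_sumE.
apply: is_derive_sum => k.
apply: is_derive_eq (is_deriveX 2 (Ck_is_derive (Cv k) Bx l)) _.
by rewrite expr1 mulrA.
Qed.

Lemma is_derive_weight x l : Omega x ->
  is_derive x (basis l) weight (weight x *
   (2 * kappa * (\sum_(q < 3) v q x * partial l (v q) x) / sqnorm x)).
Proof.
move=> Ox; have s0 := Omega_pos Ox.
have d1 := is_derive_comp (is_derive1_ln s0) (is_derive_sqnorm l (OmegaB Ox)).
have d2 : is_derive x (basis l) (fun y => kappa * ln (sqnorm y))
    (kappa * ((sqnorm x)^-1 * (2 * \sum_(q < 3) v q x * partial l (v q) x))).
  exact: is_deriveZ.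
have d3 := @is_derive_comp R expR (fun y => kappa * ln (sqnorm y)) x (basis l)
  _ _ (is_derive_expR _) d2.
apply: is_derive_eq d3 _; rewrite /weight /=; congr (_ * _); ring.
Qed.

Lemma weight_gt0 x : 0 < weight x. Proof. exact: expR_gt0. Qed.

(** The weight is a positive power of |v|^2, so it does not matter how Omega
approaches the zero x of v. *)
Lemma weight_small x (e : R) : B x -> (forall k, v k x = 0) -> 0 < e ->
  \forall y \near x, Omega y -> weight y <= e.
Proof.
move=> Bx vx e0; have d0 : 0 < expR (ln e / kappa) by exact: expR_gt0.
have := continuous_near (Ck_continuous Ck_sqnorm Bx) d0.
apply: filterS => y yd Oy; have s0 := Omega_pos Oy.
have sx : sqnorm x = 0.
  by rewrite /sqnorm big1// => k _; rewrite vx expr0n.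
move: yd; rewrite sx sub0r normrN gtr0_norm// => yd.
rewrite /weight -(@lnK R e) ?posrE// ler_expR mulrC -ler_pdivlMr//.
by rewrite -(@expRK R (ln e / kappa)) ler_ln ?posrE// ltW.
Qed.

Section divergence.
Variables (b : E -> R) (l i : 'I_3).
Hypothesis Cb : Ck 1 B b.

Let G x := weight x * (v i x * b x).
Let dG x := weight x *
  (2 * kappa * (\sum_(q < 3) v q x * partial l (v q) x) / sqnorm x
    * (v i x * b x)
   + partial l (v i) x * b x + v i x * partial l b x).

Let not_Omega x : (forall k, v k x = 0) -> ~ Omega x.
Proof.
by move=> vx /Omega_pos; rewrite /sqnorm big1 ?ltxx// => k _; rewrite vx expr0n.
Qed.

Let is_derive_G x : Omega x -> is_derive x (basis l) G (dG x).
Proof.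
move=> Ox; have Bx := OmegaB Ox.
have d := is_derive_mul (is_derive_weight l Ox)
  (is_derive_mul (Ck_is_derive (Cv i) Bx l) (Ck_is_derive Cb Bx l)).
apply: is_derive_eq d _; rewrite /dG.
move: (partial l (v i) x) (partial l b x) (_ / sqnorm x) (weight x) => p q S w.
ring.
Qed.

Let near_bound f x (K : R) : {for x, continuous f} -> `|f x| < K ->
  \forall y \near x, `|f y| <= K.
Proof.
move=> cf fK; have d0 : 0 < K - `|f x| by rewrite subr_gt0.
have := continuous_near cf d0; apply: filterS => y yd.
have := ler_normB (f x) (f x - f y); rewrite subKr => /le_trans; apply.
by rewrite -lerBrDl ltW.
Qed.

Let near_bound1 f x : {for x, continuous f} -> \forall y \near x, `|f y| <= `|f x| + 1.
Proof. by move=> cf; apply: near_bound => //; rewrite ltrDl. Qed.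

Let is_derive_cut x : is_derive x (basis l) (G \_ Omega) ((dG \_ Omega) x).
Proof.
have [Ox|xO|[Bx vx]] := Omega_edge x.
- rewrite (_ : (dG \_ Omega) x = dG x); last by rewrite patchT ?inE.
  apply: near_eq_is_derive (is_derive_G Ox).
  have : nbhs x Omega by exact: open_nbhs_nbhs.
  by apply: filterS => y Oy; rewrite patchT ?inE.
- rewrite (_ : (dG \_ Omega) x = 0); last first.
    by rewrite patchC// inE; exact: nbhs_singleton.
  apply: near_eq_is_derive (is_derive_cst 0 x (basis l)).
  by move: xO; apply: filterS => y Oy; rewrite patchC// inE.
have xO : x \in ~` Omega by rewrite inE; exact: not_Omega.
rewrite (_ : (dG \_ Omega) x = 0); last by rewrite patchC.
apply: is_derive_cvg; apply/cvgr0Pnorm_le => e e0.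
pose p := partial l (v i) x.
have [dv dvE] := Ck_is_derive (Cv i) Bx l.
have n1 : \forall h \near 0^', `|p - h^-1 *: ((v i \o shift x) (h *: basis l) - v i x)| < 1.
  have cdv : h^-1 *: ((v i \o shift x) (h *: basis l) - v i x) @[h --> 0^'] --> p.
    by rewrite /p -dvE; exact: dv.
  by move/cvgrPdist_lt : cdv; apply.
have n2 := near_line (basis l) (near_bound1 (Ck_continuous Cb Bx)).
pose e' := e / ((`|p| + 1) * (`|b x| + 1)).
have P0 : 0 < `|p| + 1 by rewrite ltr_wpDl.
have b0 : 0 < `|b x| + 1 by rewrite ltr_wpDl.
have e'0 : 0 < e' by rewrite divr_gt0// mulr_gt0.
have n3 := near_line (basis l) (weight_small Bx vx e'0).
have n0 : \forall h \near (0 : R)^', h != 0 by exact: nbhs_dnbhs_neq.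
apply: filterS3 (filterI n0 n1) n2 n3 => h [h0 h1] h2 h3.
rewrite [(G \_ Omega) x]patchC// subr0 /=.
have [Oy|Oy] := pselect (Omega (h *: basis l + x)); last first.
  by rewrite patchC ?inE// scaler0 normr0 ltW.
rewrite patchT ?inE// /G; move: (h3 Oy) h2 h1; rewrite /= vx subr0.
move: (v i _) (b (_ + _)) (weight _) (weight_gt0 (h *: basis l + x)) => vy by_ w w0.
move=> we bb pv.
have hv : `|h^-1 * vy| <= `|p| + 1.
  have := ler_normB p (p - h^-1 *: vy); rewrite subKr => /le_trans; apply.
  by rewrite lerD2l ltW.
rewrite (_ : h^-1 *: _ = w * (h^-1 * vy * by_)); last first.
  by rewrite [LHS]mulrCA !mulrA.
rewrite !normrM -!normrM normrM (gtr0_norm w0) normrM.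
apply: (@le_trans _ _ (e' * ((`|p| + 1) * (`|b x| + 1)))); last first.
  by rewrite /e' divfK// gt_eqF// mulr_gt0.
by rewrite !ler_pM// ?mulr_ge0// ltW.
Qed.

Let dG_bound x (K : R) : Omega x -> 0 <= K -> (forall q, `|partial l (v q) x| <= K) ->
  `|b x| <= K -> `|partial l b x| <= K -> `|v i x| <= 1 ->
  `|dG x| <= weight x * ((6 * kappa + 1) * K * K + K).
Proof.
move=> Ox K0 vK bK dbK v1.
rewrite /dG normrM (gtr0_norm (weight_gt0 x)) ler_pM2l ?weight_gt0//.
have s0 := Omega_pos Ox.
have vv q : `|v q x * v i x / sqnorm x| <= 1.
  rewrite normrM normfV (gtr0_norm s0) ler_pdivrMr// mul1r ler_norml.
  have := sqnorm_coord x q; have := sqnorm_coord x i.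
  move: (v q x) (v i x) (sqnorm x) => a c s h1 h2.
  have := sqr_ge0 (a + c); have := sqr_ge0 (a - c).
  by rewrite sqrrB sqrrD => *; apply/andP; split; lra.
have -> : 2 * kappa * (\sum_(q < 3) v q x * partial l (v q) x) / sqnorm x
    * (v i x * b x) =
  2 * kappa * ((\sum_(q < 3) (v q x * v i x / sqnorm x) * partial l (v q) x) * b x).
  rewrite !mulr_sumr !mulr_suml !mulr_sumr; apply: eq_bigr => q _; ring.
have S : `|\sum_(q < 3) (v q x * v i x / sqnorm x) * partial l (v q) x| <= 3 * K.
  apply: le_trans (ler_norm_sum _ _ _) _.
  apply: (@le_trans _ _ (\sum_(q < 3) K)); last first.
    by rewrite sumr_const card_ord mulr_natl.
  apply: ler_sum => q _; rewrite normrM -[K]mul1r.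
  by apply: ler_pM => //; exact: vK.
have SS : `|(\sum_(q < 3) (v q x * v i x / sqnorm x) * partial l (v q) x) * b x|
   <= 3 * K * K.
  by rewrite normrM; apply: ler_pM.
apply: le_trans (ler_normD _ _) _.
have -> : (6 * kappa + 1) * K * K + K = 2 * kappa * (3 * K * K) + K * K + 1 * K by ring.
apply: lerD; last by rewrite normrM; apply: ler_pM.
apply: le_trans (ler_normD _ _) _; apply: lerD.
  have k0 : 0 < 2 * kappa by rewrite mulr_gt0.
  by rewrite normrM (gtr0_norm k0) ler_pM2l.
by rewrite normrM; apply: ler_pM => //; exact: vK.
Qed.

Let cont_dG x : Omega x -> {for x, continuous dG}.
Proof.
move=> Ox; have Bx := OmegaB Ox.
have cv q : {for x, continuous (v q)} := Ck_continuous (Cv q) Bx.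
have cdv q : {for x, continuous (partial l (v q))}.
  exact: Ck_continuous (Ck_partial (Cv q) l) Bx.
have cb := Ck_continuous Cb Bx.
have cdb := Ck_continuous (Ck_partial Cb l) Bx.
have cs := Ck_continuous Ck_sqnorm Bx.
have cw : {for x, continuous weight}.
  apply: (@continuous_comp _ _ _ (fun y => kappa * ln (sqnorm y)) expR);
    last exact: continuous_expR.
  apply: continuousM; first exact: cst_continuous.
  apply: (@continuous_comp _ _ _ sqnorm (@ln R)) => //.
  exact/continuous_ln/Omega_pos.
have cS : {for x, continuous (fun y => \sum_(q < 3) v q y * partial l (v q) y)}.
  have CS : Ck 0 B (fun y => \sum_(q < 3) v q y * partial l (v q) y).
    apply: (@Ck_sum _ 0 B _ _ _ (fun q y => v q y * partial l (v q) y) oB) => q.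
    by apply: (CkM oB); [exact: CkW (CkW (Cv q))|exact: CkW (Ck_partial (Cv q) l)].
  exact: Ck_continuous CS Bx.
apply: continuousM => //; apply: continuousD; last exact: continuousM.
apply: continuousD; last exact: continuousM.
apply: continuousM; last exact: continuousM.
apply: continuousM; last by apply: continuousV => //; rewrite gt_eqF// Omega_pos.
by apply: continuousM => //; exact: cst_continuous.
Qed.

Let continuous_cut : continuous (dG \_ Omega).
Proof.
move=> x; have [Ox|xO|[Bx vx]] := Omega_edge x.
- rewrite /continuous_at patchT ?inE//.
  have nE : {near x, dG =1 dG \_ Omega}.
    have : nbhs x Omega by exact: open_nbhs_nbhs.
    by apply: filterS => y Oy; rewrite patchT ?inE.
  exact: cvg_trans (near_eq_cvg nE) (cont_dG Ox).
- apply: continuous_eps => e e0; have := nbhs_singleton xO => Ox.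
  move: xO; apply: filterS => y Oy.
  by rewrite !patchC ?inE// subr0 normr0 ltW.
apply: continuous_eps => e e0.
rewrite (_ : (dG \_ Omega) x = 0); last by rewrite patchC// inE; exact: not_Omega.
pose K := \sum_(q < 3) (`|partial l (v q) x| + 1) + (`|b x| + 1) + (`|partial l b x| + 1).
have K0 : 0 <= \sum_(q < 3) (`|partial l (v q) x| + 1).
  by apply: sumr_ge0 => q _; rewrite addr_ge0.
have k1 q : `|partial l (v q) x| + 1 <= K.
  rewrite /K -addrA ler_wpDr ?addr_ge0//.
  by rewrite (bigD1 q)//= lerDl sumr_ge0// => ? _; rewrite addr_ge0.
have k2 : `|b x| + 1 <= K by rewrite /K addrAC lerDr addr_ge0// addr_ge0.
have k3 : `|partial l b x| + 1 <= K by rewrite /K lerDr addr_ge0// addr_ge0.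
have KK : 0 < K by apply: lt_le_trans k2; rewrite ltr_wpDl.
pose M := (6 * kappa + 1) * K * K + K.
have M0 : 0 < M.
  by rewrite /M addr_gt0// !mulr_gt0// addr_gt0// mulr_gt0.
have eM : 0 < e / M by rewrite divr_gt0.
have n1 := weight_small Bx vx eM.
have n2 : \forall y \near x, forall q, `|partial l (v q) y| <= K.
  apply: (@filter_forall _ _ _ (nbhs x)) => q.
  have := near_bound1 (Ck_continuous (Ck_partial (Cv q) l) Bx).
  by apply: filterS => y /le_trans; apply; exact: k1.
have n3 := near_bound1 (Ck_continuous Cb Bx).
have n4 := near_bound1 (Ck_continuous (Ck_partial Cb l) Bx).
have n5 := near_bound1 (Ck_continuous (Cv i) Bx).
apply: filterS3 (filterI n1 n2) (filterI n3 n4) n5 => y [y1 y2] [y3 y4] y5.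
have [Oy|Oy] := pselect (Omega y); last by rewrite patchC ?inE// subr0 normr0 ltW.
rewrite sub0r normrN patchT ?inE//; apply: le_trans (dG_bound Oy (ltW KK) y2 _ _ _) _.
- exact: le_trans y3 k2.
- exact: le_trans y4 k3.
- by move: y5; rewrite vx normr0 add0r.
by rewrite -/M -ler_pdivlMr// y1.
Qed.

(** Write G = |v|^(2 kappa) v_i b on Omega. At a zero of v the factor
v_i is at most linear and the weight tends to 0, so the extension of G by zero has
derivative 0 there. The derivative of G on Omega is the weight times a bounded
function, so it extends continuously by zero as well. *)
Lemma asneg_cut_divergence : asneg L (dG \_ Omega).
Proof.
have E : partial l (G \_ Omega) = dG \_ Omega.
  by apply/funext => x; have [_] := is_derive_cut x.
rewrite -E; apply: asneg_divergence.
- by move=> x; have [] := is_derive_cut x.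
- by rewrite E; exact: continuous_cut.
- move=> x q Lx; rewrite patchC// inE => /Omega_bounded/(_ q).
  by rewrite ltNge Lx.
Qed.

End divergence.
End truncation.

(** * Weighted integral inequalities *)

Section weighted.
Context {R : realType}.
Local Notation E := 'rV[R]_3.
Variables (L : nat) (B Omega : set E) (v : 'I_3 -> E -> R) (kappa : R).
Implicit Types (T : E -> R).

(** The analogue of [asneg] for integrals over Omega against the weight
|v|^(2 kappa). *)
Definition wneg T : Prop := asneg L ((fun x => weight v kappa x * T x) \_ Omega).

Lemma wneg_le T T' : (forall x, Omega x -> T x <= T' x) -> wneg T' -> wneg T.
Proof.
move=> TT; apply: asneg_le => x.
have [Ox|Ox] := pselect (Omega x); last by rewrite !patchC ?inE.
by rewrite !patchT ?inE// ler_pM2l ?weight_gt0// TT.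
Qed.

Lemma wnegD T T' : wneg T -> wneg T' -> wneg (fun x => T x + T' x).
Proof.
move=> nT nT'; apply: asneg_le (asnegD nT nT') => x.
have [Ox|Ox] := pselect (Omega x); last by rewrite !patchC ?inE// addr0.
by rewrite !patchT ?inE// mulrDr.
Qed.

Lemma wnegZ (c : R) T : 0 <= c -> wneg T -> wneg (fun x => c * T x).
Proof.
move=> c0 nT; apply: asneg_le (asnegZ c0 nT) => x.
have [Ox|Ox] := pselect (Omega x); last by rewrite !patchC ?inE// mulr0.
by rewrite !patchT ?inE// mulrCA.
Qed.

Lemma wneg_sum3 (F : 'I_3 -> E -> R) : (forall i, wneg (F i)) ->
  wneg (fun x => \sum_(i < 3) F i x).
Proof.
move=> nF; apply: wneg_le (wnegD (wnegD (nF 0) (nF 1)) (nF 2)) => x _.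
by rewrite sum3E.
Qed.

Definition vals x : 'I_3 -> R := fun i => v i x.
Definition grad x : 'I_3 -> 'I_3 -> R := fun l i => partial l (v i) x.
(** The size of the error terms that the Carleman estimate absorbs; t is a
large parameter. *)
Definition energy (t : R) x : R := t * sumsq (vals x) + sumsq2 (grad x) / t.

Lemma energy_ge (t : R) x i j k : 0 < t -> `|vals x i * grad x j k| <= energy t x / 2.
Proof.
move=> t0; apply: le_trans (young _ _ t0) _; rewrite ler_pM2r ?invr_gt0// lerD//.
  by rewrite ler_pM2l//; exact: sumsq_ge.
by rewrite ler_pM2r ?invr_gt0//; exact: sumsq2_ge.
Qed.

Hypothesis vP : truncation L B Omega v.
Hypothesis kappa0 : 0 < kappa.

Let oB : open B := trunc_openB vP.
Let OmegaB : Omega `<=` B := trunc_sub vP.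
Let Cv k : Ck 2 B (v k) := trunc_C2 vP k.

Lemma partialM x (f g : E -> R) l : Ck 1 B f -> Ck 1 B g -> B x ->
  partial l (fun y => f y * g y) x = f x * partial l g x + g x * partial l f x.
Proof.
by move=> Cf Cg Bx; have [_] := is_derive_mul (Ck_is_derive Cf Bx l) (Ck_is_derive Cg Bx l).
Qed.

Lemma partialN x (f : E -> R) l : Ck 1 B f -> B x ->
  partial l (fun y => - f y) x = - partial l f x.
Proof. by move=> Cf Bx; have [_] := is_deriveN (Ck_is_derive Cf Bx l). Qed.

(** The logarithmic derivative of the weight is 2 kappa (v . dv) / |v|^2, and
multiplication by v_i compensates its singularity. *)
Lemma weight_term x (d : 'I_3 -> R) i (y : R) : Omega x ->
  - (2 * kappa * \sum_(q < 3) `|d q * y|) <=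
  2 * kappa * (\sum_(q < 3) v q x * d q) / sqnorm v x * (v i x * y).
Proof.
move=> Ox; have s0 := trunc_pos vP Ox.
have vv q : `|v q x * v i x / sqnorm v x| <= 1.
  rewrite normrM normfV (gtr0_norm s0) ler_pdivrMr// mul1r.
  have := sqnorm_coord v x q; have := sqnorm_coord v x i.
  have := young (v q x) (v i x) ltr01; rewrite mul1r divr1.
  clear; move: (_ ^+ 2) (_ ^+ 2) (sqnorm v x) `|_| => *; lra.
have -> : 2 * kappa * (\sum_(q < 3) v q x * d q) / sqnorm v x * (v i x * y) =
  2 * kappa * (\sum_(q < 3) (v q x * v i x / sqnorm v x) * (d q * y)).
  by rewrite !sum3E; ring.
rewrite -mulrN ler_pM2l ?mulr_gt0// -sumrN; apply: ler_sum3 => q.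
apply: lerNnormlW; rewrite normrM -[leRHS]mul1r; exact: ler_pM.
Qed.

(** Integration by parts of v_i b, with the derivative of the weight replaced by
the bound of [weight_term]. *)
Lemma wneg_div b l i : Ck 1 B b ->
  wneg (fun x => - (2 * kappa * \sum_(q < 3) `|grad x l q * b x|)
    + grad x l i * b x + vals x i * partial l b x).
Proof.
move=> Cb; have := asneg_cut_divergence vP kappa0 l i Cb.
apply: wneg_le => x Ox; rewrite /grad /vals !lerD2r; exact: weight_term.
Qed.

(** The null form is the difference of the derivatives along l and k of v_i
times a derivative of v_p, because the mixed second derivatives cancel. What
remains has a derivative of c and is of lower order. *)
Lemma wneg_null (c : E -> R) (A t : R) l i k p : 0 < t -> Ck 1 B c ->
  (forall x, Omega x -> `|c x| <= A) ->
  (forall x j, Omega x -> `|partial j c x| <= A) ->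
  wneg (fun x => c x * (grad x l i * grad x k p - grad x k i * grad x l p)
    - A * (energy t x + 8 * kappa * sumsq2 (grad x))).
Proof.
move=> t0 Cc cA dcA.
have Cp q r : Ck 1 B (partial q (v r)) := Ck_partial (Cv r) q.
(* The vector field b1 e_l + b2 e_k has a divergence without second derivatives. *)
pose b1 x := c x * partial k (v p) x; pose b2 x := - c x * partial l (v p) x.
have CNc : Ck 1 B (fun x => - c x) := CkN oB Cc.
have Cb1 : Ck 1 B b1 := CkM oB Cc (Cp k p).
have Cb2 : Ck 1 B b2 := CkM oB CNc (Cp l p).
apply: wneg_le (wnegD (wneg_div l i Cb1) (wneg_div k i Cb2)) => x Ox.
have Bx := OmegaB Ox.
have A0 : 0 <= A by exact: le_trans (cA x Ox).
have db1 : partial l b1 x = c x * partial l (partial k (v p)) x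
    + partial k (v p) x * partial l c x := partialM l Cc (Cp k p) Bx.
have db2 : partial k b2 x = - c x * partial k (partial l (v p)) x
    + partial l (v p) x * partial k (fun x => - c x) x := partialM k CNc (Cp l p) Bx.
rewrite db1 db2 (partialN k Cc Bx) (Ck_schwarz l k oB (Cv p) Bx).
have k1 (c' : R) q r : `|c'| <= A ->
    \sum_(s < 3) `|grad x q s * (c' * grad x r p)| <= 2 * A * sumsq2 (grad x).
  move=> c'A; apply: (@le_trans _ _ (\sum_(s < 3) A *
      ((grad x q s ^+ 2 + grad x r p ^+ 2) / 2))).
    apply: ler_sum3 => s; rewrite mulrCA normrM; apply: ler_pM => //.
    by apply: le_trans (young _ _ ltr01) _; rewrite mul1r divr1.
  have h1 : A * sumsq (grad x q) <= A * sumsq2 (grad x).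
    by apply: ler_wpM2l => //; exact: sumsq2_row.
  have h2 : A * grad x r p ^+ 2 <= A * sumsq2 (grad x).
    by apply: ler_wpM2l => //; exact: sumsq2_ge.
  rewrite -mulr_sumr -mulr_suml big_split /= sum3_const_ord.
  move: h1 h2; rewrite /sumsq; clear.
  by move: (\sum_(i < 3) _) (sumsq2 _) (_ ^+ 2) => *; lra.
have S1 := k1 (c x) l k (cA x Ox).
have S2 : \sum_(s < 3) `|grad x k s * (- c x * grad x l p)| <= 2 * A * sumsq2 (grad x).
  by apply: k1; rewrite normrN cA.
have e1 j r : `|vals x i * grad x j p * partial r c x| <= A * (energy t x / 2).
  rewrite mulrC normrM; apply: ler_pM => //; first exact: dcA.
  exact: energy_ge.
have := lerNnormlW (e1 k l); have := ler_normlW (e1 l k); move: S1 S2.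
rewrite /b1 /b2 -!/(grad x _ _) -!/(vals x _).
have kp := ltW kappa0; clear -kp => S1 S2 E1 E2.
have := ler_wpM2l kp S1; have := ler_wpM2l kp S2; move: E1 E2; clear.
move: (\sum_(s < 3) `|grad x k s * (- c x * grad x l p)|) => S1.
move: (\sum_(s < 3) `|grad x l s * (c x * grad x k p)|) => S2.
move: (sumsq2 _) (energy t x) => Q e.
move: (partial k (partial l _) x) (partial k c x) (partial l c x) (c x) => X c1 c2 c3.
move: (vals x i) (grad x l i) (grad x k i) (grad x l p) (grad x k p) => u d1 d2 d3 d4.
by move=> *; lra.
Qed.

(** Integration by parts for c v_i v_j, with the error from the weight. *)
Lemma wneg_first (c : E -> R) (A t : R) l i j : 0 < t -> Ck 1 B c ->
  (forall x, Omega x -> `|c x| <= A) ->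
  wneg (fun x =>
    - (c x * (grad x l i * vals x j + vals x i * grad x l j)
       + partial l c x * (vals x i * vals x j))
    - 3 * kappa * A * energy t x).
Proof.
move=> t0 Cc cA; have CNc : Ck 1 B (fun x => - c x) := CkN oB Cc.
have Cj : Ck 1 B (v j) := CkW (Cv j).
have Cb : Ck 1 B (fun x => - c x * v j x) := CkM oB CNc Cj.
apply: wneg_le (wneg_div l i Cb) => x Ox.
have Bx := OmegaB Ox.
have A0 : 0 <= A by exact: le_trans (cA x Ox).
have db : partial l (fun x => - c x * v j x) x = - c x * grad x l j
    + v j x * partial l (fun x => - c x) x := partialM l CNc Cj Bx.
rewrite db (partialN l Cc Bx).
have S : \sum_(q < 3) `|grad x l q * (- c x * v j x)| <= 3 * (A * (energy t x / 2)).
  rewrite -sum3_const_ord; apply: ler_sum3 => q.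
  rewrite mulrCA mulrC normrM normrN [leRHS]mulrC; apply: ler_pM => //; last exact: cA.
  by rewrite mulrC; exact: energy_ge.
have := ler_wpM2l (ltW kappa0) S; rewrite -/(vals x _); clear.
move: (\sum_(q < 3) `|grad x l q * (- c x * v j x)|) => S.
move: (partial l c x) (vals x i) (vals x j) (grad x l i) (grad x l j) (energy t x).
by move=> dc vi vj di dj e; lra.
Qed.

End weighted.

(** * The Carleman estimate *)

Section carleman.
Context {R : realType}.
Local Notation E := 'rV[R]_3.
Variables (L : nat) (B Omega : set E) (v : 'I_3 -> E -> R) (tau A c0 rho gam : R).
Variables (a : 'I_3 -> 'I_3 -> E -> R) (n : 'I_3 -> E -> R) (th : E -> R).

Definition at_ (x : E) : 'I_3 -> 'I_3 -> R := fun i j => a i j x.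
Definition conormal (x : E) : 'I_3 -> R := fun i => n i x.
(** The conormal n raised by a. *)
Definition normal_vec (x : E) i : R := \sum_(k < 3) a i k x * n k x.
Definition normal_sq (x : E) : R := \sum_(k < 3) n k x * normal_vec x k.
Definition null_coef l i j k (x : E) : R := normal_vec x l * normal_vec x i * a j k x.
Definition flux_coef l i j (x : E) : R := normal_sq x * normal_vec x l * a i j x.

Hypothesis vP : truncation L B Omega v.
Hypothesis tau1 : 1 <= tau.
Hypothesis A0 : 0 < A.
Hypothesis c00 : 0 < c0.
Hypothesis rho0 : 0 < rho.
Hypothesis gam0 : 0 < gam.
Hypothesis Ca : forall i j, Ck 1 B (a i j).
Hypothesis Cn : forall i, Ck 1 B (n i).
Hypothesis Cth : Ck 1 B th.
Hypothesis dth : forall x l, Omega x -> partial l th x = - (4 * gam * n l x).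
Hypothesis th12 : forall x, Omega x -> 1 <= th x <= 2.
Hypothesis sa : forall x, Omega x -> forall i j, a i j x = a j i x.
Hypothesis ell : forall x, Omega x -> forall y, c0 * sumsq y <= quad (at_ x) y y.
Hypothesis nrho : forall x, Omega x -> rho <= normal_sq x.
Hypothesis aA : forall x i j, Omega x -> `|a i j x| <= A.
Hypothesis daA : forall x i j l, Omega x -> `|partial l (a i j) x| <= A.
Hypothesis nA : forall x i, Omega x -> `|n i x| <= A.
Hypothesis NA : forall x i, Omega x -> `|normal_vec x i| <= A.
Hypothesis c1A : forall x l i j k, Omega x -> `|null_coef l i j k x| <= A.
Hypothesis dc1A : forall x l i j k q, Omega x -> `|partial q (null_coef l i j k) x| <= A.
Hypothesis wA : forall x l i j, Omega x -> `|flux_coef l i j x| <= A.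
Hypothesis dwA : forall x l i j q, Omega x -> `|partial q (flux_coef l i j) x| <= A.

Let oB : open B := trunc_openB vP.
Let OmegaB : Omega `<=` B := trunc_sub vP.
Let tau0 : 0 < tau := lt_le_trans ltr01 tau1.
Let kappa0 : 0 < tau^-1. Proof. by rewrite invr_gt0. Qed.
Local Notation wneg := (wneg L Omega v tau^-1).
Local Notation vals := (vals v).
Local Notation grad := (grad v).

Let Cnormal i : Ck 1 B (normal_vec ^~ i).
Proof. by apply: (@Ck_sum _ 1 B _ _ _ (fun k x => a i k x * n k x) oB) => k; exact: CkM oB (Ca i k) (Cn k). Qed.

Let Cnormal_sq : Ck 1 B normal_sq.
Proof.
by apply: (@Ck_sum _ 1 B _ _ _ (fun k x => n k x * normal_vec x k) oB) => k;
  exact: CkM oB (Cn k) (Cnormal k).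
Qed.

Let Cnull l i j k : Ck 1 B (null_coef l i j k).
Proof. exact: (CkM oB (CkM oB (Cnormal l) (Cnormal i)) (Ca j k)). Qed.

Let Cflux l i j : Ck 1 B (flux_coef l i j).
Proof. exact: (CkM oB (CkM oB Cnormal_sq (Cnormal l)) (Ca i j)). Qed.

Definition curl_res x := conj_curl (conormal x) (vals x) (grad x) (tau * th x).
Definition div_res x := conj_div (at_ x) (conormal x) (vals x) (grad x) (tau * th x).
Definition residual x : R := sumsq2 (curl_res x) + div_res x ^+ 2.

(** Together with [rotation] this is the derivative part of the contraction in
[contractionE]. *)
Definition transport x i : R := \sum_(l < 3) normal_vec x l * grad x l i.
Definition rotation x i : R :=
  n i x * (\sum_(j < 3) \sum_(k < 3) a j k x * grad x j k)
  - \sum_(k < 3) normal_vec x k * grad x i k.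

Lemma sumsq_le_err x : tau * sumsq (vals x) <= energy v tau x.
Proof. by rewrite lerDl divr_ge0 ?sumsq2_ge0// ltW. Qed.

(** The form is a sum of 81 null forms by [quad_transport_rotation], each
with an error of at most 9 A times the energy: 4 * 81 * 9 = 2916. *)
Lemma transport_rotation_neg :
  wneg (fun x => - (4 * quad (at_ x) (transport x) (rotation x))
                 - 2916 * A * energy v tau x).
Proof.
have W l i j k : wneg (fun x =>
    - (null_coef l i j k x * (grad x l i * grad x j k - grad x j i * grad x l k))
    - A * (energy v tau x + 8 * tau^-1 * sumsq2 (grad x))).
  have Cc := Cnull l i j k.
  apply: wneg_le (wneg_null vP kappa0 l i j k tau0 (CkN oB Cc) (A := A) _ _).
  - by move=> x _; rewrite mulNr.
  - by move=> x Ox; rewrite normrN c1A.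
  - by move=> x q Ox; rewrite (partialN q Cc (OmegaB Ox)) normrN dc1A.
have W4 : 0 <= 4 :> R by [].
apply: wneg_le (wnegZ W4 (wneg_sum3 (fun l => wneg_sum3 (fun i =>
  wneg_sum3 (fun j => wneg_sum3 (W l i j)))))) => x Ox.
rewrite /transport /rotation (quad_transport_rotation _ (sa Ox) (fun=> erefl)).
(* 8 |grad v|^2 / tau is at most 8 times the energy. *)
set C := A * (energy v tau x + 8 * _ * _).
have CE : C <= 9 * (A * energy v tau x).
  have h : tau^-1 * sumsq2 (grad x) <= energy v tau x.
    by rewrite mulrC lerDr mulr_ge0 ?sumsq_ge0// ltW.
  have := ler_wpM2l (ltW A0) h; rewrite /C.
  by move: (energy v tau x) (sumsq2 _) (tau^-1) => *; lra.
rewrite (sum3_4NB (fun l i j k => null_coef l i j k x *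
  (grad x l i * grad x j k - grad x j i * grad x l k))) /null_coef /normal_vec.
move: CE; move: (\sum_(l < 3) _) C (energy v tau x) => *; lra.
Qed.

Lemma quad_ge0 x y : Omega x -> 0 <= quad (at_ x) y y.
Proof.
by move=> Ox; apply: le_trans (ell Ox y); rewrite mulr_ge0 ?sumsq_ge0// ltW.
Qed.

(** Integration by parts of the coefficients theta (n.N) N_l a_ij against v_i v_j.
Of the derivative of the coefficient, the part that falls on theta is
-4 gam n_l and gives the positive term. The rest and the derivative of the weight
are errors of at most 108 A and 324 A times the energy. *)
Lemma flux_neg : wneg (fun x =>
  - (4 * (tau * th x * normal_sq x) * quad (at_ x) (transport x) (vals x))
  + 8 * gam * tau * normal_sq x ^+ 2 * quad (at_ x) (vals x) (vals x)
  - 432 * A * energy v tau x).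
Proof.
pose c l i j x := th x * flux_coef l i j x.
have W l i j : wneg (fun x =>
    - (c l i j x * (grad x l i * vals x j + vals x i * grad x l j)
       + partial l (c l i j) x * (vals x i * vals x j))
    - 3 * tau^-1 * (2 * A) * energy v tau x).
  apply: (wneg_first vP kappa0 l i j tau0 (CkM oB Cth (Cflux l i j))) => x Ox.
  rewrite normrM; apply: ler_pM => //; last exact: wA.
  by have /andP[t1 t2] := th12 Ox; rewrite ger0_norm// (le_trans _ t1).
have W2 : 0 <= 2 * tau by rewrite mulr_ge0// ltW.
apply: wneg_le (wnegZ W2 (wneg_sum3 (fun l => wneg_sum3 (fun i =>
  wneg_sum3 (W l i))))) => x Ox.
rewrite (sum3_3NB (fun l i j =>
  c l i j x * (grad x l i * vals x j + vals x i * grad x l j)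
  + partial l (c l i j) x * (vals x i * vals x j))).
have dc l i j : partial l (c l i j) x = th x * partial l (flux_coef l i j) x
    + flux_coef l i j x * - (4 * gam * n l x).
  by rewrite -(dth l Ox); exact: partialM Cth (Cflux l i j) (OmegaB Ox).
pose rest := \sum_(l < 3) \sum_(i < 3) \sum_(j < 3)
  th x * partial l (flux_coef l i j) x * (vals x i * vals x j).
have restE : rest <= 54 * (A * sumsq (vals x)).
  apply: (@le_trans _ _ (\sum_(l < 3) \sum_(i < 3) \sum_(j < 3)
    (2 * A * sumsq (vals x)))); last first.
    by rewrite !sum3_const_ord le_eqVlt; apply/orP; left; apply/eqP; ring.
  apply: ler_sum3 => l; apply: ler_sum3 => i; apply: ler_sum3 => j.
  apply: le_trans (ler_norm _) _; rewrite normrM; apply: ler_pM => //.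
    rewrite normrM; apply: ler_pM => //; last exact: dwA.
    by have /andP[t1 t2] := th12 Ox; rewrite ger0_norm// (le_trans _ t1).
  apply: le_trans (young _ _ ltr01) _; rewrite mul1r divr1.
  have := sumsq_ge (vals x) i; have := sumsq_ge (vals x) j.
  by move: (_ ^+ 2) (_ ^+ 2) (sumsq _) => *; lra.
have -> : \sum_(l < 3) \sum_(i < 3) \sum_(j < 3)
   (c l i j x * (grad x l i * vals x j + vals x i * grad x l j)
     + partial l (c l i j) x * (vals x i * vals x j)) =
   2 * (th x * normal_sq x) * quad (at_ x) (transport x) (vals x) + rest
   - 4 * gam * normal_sq x ^+ 2 * quad (at_ x) (vals x) (vals x).
  transitivity (\sum_(l < 3) \sum_(i < 3) \sum_(j < 3)
   (c l i j x * (grad x l i * vals x j + vals x i * grad x l j)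
     + flux_coef l i j x * - (4 * gam * n l x) * (vals x i * vals x j)) + rest).
    rewrite /rest -big_split; apply: eq_bigr => l _ /=.
    rewrite -big_split; apply: eq_bigr => i _ /=.
    rewrite -big_split; apply: eq_bigr => j _ /=.
    by rewrite dc; move: (partial _ _ _) => dw; ring.
  rewrite [in RHS]addrAC; congr (_ + _).
  rewrite /c /flux_coef; exact: (flux_algebra (vals x) (grad x) (th x) gam (sa Ox)).
have e1 := sumsq_le_err x.
have e2 : 2 * tau * rest <= 108 * (A * energy v tau x).
  apply: le_trans (ler_wpM2l W2 restE) _.
  rewrite (_ : 2 * tau * _ = 108 * (A * (tau * sumsq (vals x)))); last by ring.
  by rewrite ler_pM2l// ler_pM2l.
have e3 : 2 * tau * (27 * (3 * tau^-1 * (2 * A) * energy v tau x)) = 324 * (A * energy v tau x).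
  by field; rewrite gt_eqF.
rewrite mulrBr e3; move: e2.
clear restE; move: rest (energy v tau x) => r e.
move: (quad _ (vals x) (vals x)) (quad _ (transport x) (vals x)) => q1 q2 h.
lra.
Qed.

Lemma quadDr b (x y z : 'I_3 -> R) :
  quad b x (fun i => y i + z i) = quad b x y + quad b x z.
Proof.
rewrite /quad -big_split; apply: eq_bigr => i _; rewrite -big_split.
by apply: eq_bigr => j _; rewrite mulrDr.
Qed.

Lemma quadZr b (x y : 'I_3 -> R) (s : R) :
  quad b x (fun i => s * y i) = s * quad b x y.
Proof.
rewrite /quad mulr_sumr; apply: eq_bigr => i _; rewrite mulr_sumr.
by apply: eq_bigr => j _; ring.
Qed.

(** The two previous inequalities bound 4 a(P, F - P) from below, where F is the
contraction, and [quad_young] bounds it from above by a(F, F). The errors add up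
to 2916 + 432 = 3348. *)
Lemma zeroth_order_neg : wneg (fun x =>
  8 * gam * tau * normal_sq x ^+ 2 * quad (at_ x) (vals x) (vals x)
  - 3348 * A * energy v tau x - 36 * A ^+ 3 * residual x).
Proof.
apply: wneg_le (wnegD transport_rotation_neg flux_neg) => x Ox.
pose F := contraction (conormal x) (normal_vec x) (curl_res x) (div_res x).
have FE : F = (fun i => transport x i + (rotation x i +
    (tau * th x * normal_sq x) * vals x i)).
  apply/funext => i; rewrite /F /curl_res /div_res.
  exact: contractionE (sa Ox) (fun=> erefl).
have Y := quad_young (transport x) (fun i => rotation x i +
    (tau * th x * normal_sq x) * vals x i) (sa Ox) (fun y => quad_ge0 y Ox).
rewrite quadDr quadZr -FE in Y.
have C : quad (at_ x) F F <= 36 * A ^+ 3 * residual x.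
  apply: quad_contraction_le; [by move=> *; exact: aA|by move=> *; exact: nA|by move=> *; exact: NA].
have YC := le_trans Y C; move: YC.
move: (quad _ (transport x) (rotation x)) => q1.
move: (quad _ (transport x) (vals x)) => q2.
move: (quad _ (vals x) (vals x)) (residual x) (energy v tau x) => q3 r e h.
lra.
Qed.

(** This is the value of d in [gradient_bound] for which the gradient term on
the right-hand side becomes (c0 / 8) |grad v|^2; [gradient_time] is chosen with
the same purpose for the error of the null forms. *)
Definition gradient_slope : R := c0 / (8 * (27 * A + 3)).
Definition gradient_time : R := 216 * A / c0.
Definition gradient_const : R := 2 *
  ((27 * A * (4 + 32 * A ^+ 2) + 3 * (4 + 48 * A ^+ 2)) / gradient_slope
    + 27 * A * gradient_time) / c0.

(** The gradient has the weight 1 / tau only, so that the error tau^2 |v|^2 of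
[gradient_bound] is of the order of the term to be estimated in [carleman]. *)
Lemma gradient_neg : 1728 * A / c0 <= tau -> wneg (fun x =>
  sumsq2 (grad x) / tau - gradient_const * residual x
  - gradient_const * (tau * sumsq (vals x))).
Proof.
move=> tauA; set d := gradient_slope; set t := gradient_time.
have m0 : 0 < 8 * (27 * A + 3) by rewrite mulr_gt0// addr_gt0// mulr_gt0.
have d0 : 0 < d by rewrite divr_gt0.
have t0 : 0 < t := divr_gt0 (mulr_gt0 (ltr0Sn _ _) A0) c00.
set C2 := (27 * A * (4 + 32 * A ^+ 2) + 3 * (4 + 48 * A ^+ 2)) / d.
have W k j i := wneg_null vP kappa0 j k k i t0 (Ca j i)
  (fun x Ox => aA j i Ox) (fun x l Ox => daA j i l Ox).
have s0 : 0 <= 2 / (c0 * tau) by rewrite divr_ge0// mulr_ge0// ltW.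
apply: wneg_le (wnegZ s0 (wneg_sum3 (fun k => wneg_sum3 (fun j =>
  wneg_sum3 (W k j))))) => x Ox.
rewrite (sum3_3B (fun k j i =>
  a j i x * (grad x j k * grad x k i - grad x k k * grad x j i))).
have th_s : 0 <= tau * th x <= 2 * tau.
  have /andP[t1 t2] := th12 Ox; apply/andP; split.
    by apply: mulr_ge0; [exact: ltW|exact: le_trans ler01 t1].
  by rewrite [leRHS]mulrC; apply: ler_wpM2l => //; exact: ltW.
have := gradient_bound (n := conormal x) (vals x) (grad x) (sa Ox) (fun=> erefl) d0 th_s
   (fun i j => aA i j Ox) (fun i => nA i Ox) (fun i => NA i Ox).
rewrite -/(curl_res x) -/(div_res x) -/C2.
have S : c0 * sumsq2 (grad x) <= \sum_(k < 3) quad (at_ x) (grad x ^~ k) (grad x ^~ k).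
  rewrite /sumsq2 exchange_big mulr_sumr; apply: ler_sum3 => k; exact: ell.
have dE : (27 * A + 3) * (d * sumsq2 (grad x)) = c0 / 8 * sumsq2 (grad x).
  by rewrite /d /gradient_slope; field; rewrite gt_eqF// addr_gt0// mulr_gt0.
have tE : A * energy v t x = A * t * sumsq (vals x) + c0 / 216 * sumsq2 (grad x).
  by rewrite /energy /t /gradient_time; field; rewrite !gt_eqF.
have kE : A * tau^-1 * sumsq2 (grad x) <= c0 / 1728 * sumsq2 (grad x).
  apply: ler_wpM2r; first exact: sumsq2_ge0.
  by rewrite ler_pdivrMr//; move: tauA; rewrite ler_pdivrMr// => tA; lra.
have V0 := sumsq_ge0 (vals x).
have Q0 := sumsq2_ge0 (grad x).
have r0 : 0 <= residual x by rewrite addr_ge0 ?sqr_ge0// sumsq2_ge0.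
have VV : sumsq (vals x) <= tau ^+ 2 * sumsq (vals x).
  by rewrite -[leLHS]mul1r ler_wpM2r// expr_ge1// ltW.
rewrite -/(residual x) dE => GB.
set NS := \sum_(k < 3) _ in GB *.
have C20 : 0 <= C2.
  by rewrite divr_ge0 ?(ltW d0)// !(addr_ge0, mulr_ge0)// ?sqr_ge0// ltW.
have At0 : 0 <= 27 * A * t := mulr_ge0 (mulr_ge0 (ler0n _ _) (ltW A0)) (ltW t0).
have GB2 : c0 / 2 * sumsq2 (grad x)
   - (C2 + 27 * A * t) * (residual x + tau ^+ 2 * sumsq (vals x)) <=
   NS - 27 * (A * (energy v t x + 8 * tau^-1 * sumsq2 (grad x))).
  have p1 := ler_wpM2l At0 VV.
  have p2 := mulr_ge0 At0 r0.
  have p3 := mulr_ge0 (ltW c00) Q0.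
  rewrite [A * (_ + _)]mulrDr tE; move: kE S GB p1 p2 p3.
  move: (\sum_(k < 3) _) NS (residual x) (sumsq2 (grad x)) (sumsq _) => SS N r Q V.
  move=> *; lra.
have := ler_wpM2l s0 GB2; apply: le_trans.
have -> : 2 / (c0 * tau) * (c0 / 2 * sumsq2 (grad x)
   - (C2 + 27 * A * t) * (residual x + tau ^+ 2 * sumsq (vals x))) =
  sumsq2 (grad x) / tau - gradient_const * (residual x / tau)
  - gradient_const * (tau * sumsq (vals x)).
  by rewrite /gradient_const -/d -/t -/C2; field; rewrite !gt_eqF.
rewrite lerD2r lerD2l lerN2 ler_wpM2l//.
  rewrite /gradient_const -/d -/t -/C2 divr_ge0 ?(ltW c00)// mulr_ge0// addr_ge0//.
by rewrite ler_pdivrMr// ler_peMr.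
Qed.

Definition carleman_const : R := 3348 * A * gradient_const + 36 * A ^+ 3.
(** For gam above this number the convexity term of [zeroth_order_neg] exceeds
the energy error, with the gradient part replaced by means of [gradient_neg]. *)
Definition convexity_threshold : R :=
  (1 + 3348 * A * (1 + gradient_const)) / (8 * rho ^+ 2 * c0).

Lemma carleman : 1728 * A / c0 <= tau -> convexity_threshold <= gam ->
  wneg (fun x => tau * sumsq (vals x) - carleman_const * residual x).
Proof.
move=> tauA gamA.
have A3 : 0 <= 3348 * A := mulr_ge0 (ler0n _ _) (ltW A0).
apply: wneg_le (wnegD zeroth_order_neg (wnegZ A3 (gradient_neg tauA))) => x Ox.
have V0 : 0 <= tau * sumsq (vals x) by rewrite mulr_ge0 ?sumsq_ge0// ltW.
have e1 : rho ^+ 2 * (c0 * sumsq (vals x)) <=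
    normal_sq x ^+ 2 * quad (at_ x) (vals x) (vals x).
  apply: ler_pM; rewrite ?sqr_ge0 ?mulr_ge0 ?sumsq_ge0 ?(ltW c00)//; last exact: ell.
  by rewrite ler_pXn2r ?nnegrE ?(ltW rho0) ?nrho// (le_trans (ltW rho0) (nrho Ox)).
have e2 : (1 + 3348 * A * (1 + gradient_const)) * (tau * sumsq (vals x)) <=
    8 * gam * tau * (rho ^+ 2 * (c0 * sumsq (vals x))).
  rewrite (_ : 8 * gam * tau * _ = (gam * (8 * rho ^+ 2 * c0)) * (tau * sumsq (vals x)));
    last by ring.
  rewrite ler_wpM2r// -ler_pdivrMr// !mulr_gt0// exprn_gt0//.
have gt0 : 0 <= 8 * gam * tau by rewrite !mulr_ge0// ltW.
have e3 := ler_wpM2l gt0 e1.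
have e4 := le_trans e2 e3; move: e4.
rewrite /carleman_const /energy.
move: (normal_sq x ^+ 2) (quad _ _ _) (sumsq (vals x)) (residual x) => p q V r.
by move: (sumsq2 _ / tau) gradient_const => Q c e4; lra.
Qed.

End carleman.

(** * Conjugation by a radial exponential weight *)

Section local_step.
Context {R : realType}.
Local Notation E := 'rV[R]_3.
Variables (x0 : E) (gam sig eps tau : R).

Definition disp (q : 'I_3) (x : E) : R := x 0 q - x0 0 q.
Definition sqdist (x : E) : R := \sum_(q < 3) disp q x * disp q x.

Lemma is_derive_disp q l x : is_derive x (basis l) (disp q) ((q == l)%:R : R).
Proof.
have := is_deriveB (is_derive_coord q l x) (is_derive_cst (x0 0 q) x (basis l)).
by rewrite subr0.
Qed.

Lemma Ck_disp k B q : open B -> Ck k B (disp q).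
Proof. by move=> oB; exact: CkB oB (Ck_coord k q oB) (Ck_cst k B (x0 0 q)). Qed.

Lemma Ck_sqdist k B : open B -> Ck k B sqdist.
Proof.
move=> oB; apply: (@Ck_sum _ k B _ _ _ (fun q x => disp q x * disp q x) oB) => q.
exact: CkM oB (Ck_disp k q oB) (Ck_disp k q oB).
Qed.

Lemma is_derive_sqdist l x : is_derive x (basis l) sqdist (2 * disp l x).
Proof.
have d q := is_derive_mul (is_derive_disp q l x) (is_derive_disp q l x).
have := is_derive_sum d.
rewrite (_ : \sum_(i < 3) _ = sqdist); last by apply/funext => y; rewrite fct_sumE.
move=> dS; apply: (is_derive_eq dS); rewrite (bigD1 l)//= eqxx big1 => [|q /negbTE->].
  by rewrite addr0 /= !mulr1; ring.
by rewrite !mulr0 addr0.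
Qed.

(** The Carleman weight is exp (tau phase). The square makes it convex in
|x - x0|^2, and it decreases outwards for gam (|x - x0|^2 - sig) < 1. *)
Definition phase x : R := - (sqdist x - sig) + gam / 2 * (sqdist x - sig) ^+ 2.
(** The gradient of the phase is -slope times [disp]. *)
Definition slope x : R := 2 * (1 - gam * (sqdist x - sig)).
Definition cutoff x : R := sig + eps - sqdist x.

Lemma is_derive_shift_sq l x :
  is_derive x (basis l) (fun y => sqdist y - sig) (2 * disp l x).
Proof.
have := is_deriveB (is_derive_sqdist l x) (is_derive_cst sig x (basis l)).
by rewrite subr0.
Qed.

Lemma is_derive_slope l x : is_derive x (basis l) slope (- (4 * gam * disp l x)).
Proof.
have c1 := is_derive_cst (1 : R) x (basis l).
have cg := is_derive_cst gam x (basis l).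
have c2 := is_derive_cst (2 : R) x (basis l).
have d := is_derive_mul c2 (is_deriveB c1 (is_derive_mul cg (is_derive_shift_sq l x))).
by apply: is_derive_eq d _; rewrite [_ * 0]mulr0 mulr0 /cst; ring.
Qed.

Lemma is_derive_phase l x : is_derive x (basis l) phase (- (slope x * disp l x)).
Proof.
have cg := is_derive_cst (gam / 2) x (basis l).
have ds := is_derive_shift_sq l x.
have d := is_deriveD (is_deriveN ds) (is_derive_mul cg (is_derive_mul ds ds)).
have -> : phase = (fun y => - (sqdist y - sig)) +
    (fun y => gam / 2 * ((sqdist y - sig) * (sqdist y - sig))).
  by apply/funext => y; rewrite /phase expr2.
by apply: is_derive_eq d _; rewrite /slope /cst; field.
Qed.

Lemma is_derive_cutoff l x : is_derive x (basis l) cutoff (- (2 * disp l x)).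
Proof.
have := is_deriveB (is_derive_cst (sig + eps) x (basis l)) (is_derive_sqdist l x).
by rewrite sub0r.
Qed.

Lemma Ck_shift_sq k B : open B -> Ck k B (fun y => sqdist y - sig).
Proof. by move=> oB; exact: CkB oB (Ck_sqdist k oB) (Ck_cst k B sig). Qed.

Lemma Ck_slope k B : open B -> Ck k B slope.
Proof.
move=> oB.
exact: (CkZ 2 oB (CkB oB (Ck_cst k B 1) (CkZ gam oB (Ck_shift_sq k oB)))).
Qed.

Lemma Ck_cutoff k B : open B -> Ck k B cutoff.
Proof. by move=> oB; exact: CkB oB (Ck_cst k B _) (Ck_sqdist k oB). Qed.

Lemma Ck_phase k B : open B -> Ck k B phase.
Proof.
move=> oB; have Cs := Ck_shift_sq k oB.
apply: (Ck_ext oB _ (CkD oB (CkN oB Cs) (CkZ (gam / 2) oB (CkM oB Cs Cs)))) => x _.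
by rewrite /phase expr2.
Qed.

Variables (B : set E) (omega : 'I_3 -> E -> R).
Hypothesis oB : open B.
Hypothesis Comega : forall k, Ck 2 B (omega k).

Definition carleman_factor (x : E) : R := expR (tau * phase x).
Definition weighted_field (k : 'I_3) (x : E) : R := carleman_factor x * (cutoff x * omega k x).

Lemma Ck_weighted_field k : Ck 2 B (weighted_field k).
Proof.
exact: (CkM oB (Ck_expR oB (CkZ tau oB (Ck_phase 2 oB)))
  (CkM oB (Ck_cutoff 2 oB) (Comega k))).
Qed.

Lemma partial_weighted_field l k x : B x -> partial l (weighted_field k) x =
  carleman_factor x * (cutoff x * partial l (omega k) x - 2 * disp l x * omega k x)
  - tau * slope x * disp l x * weighted_field k x.
Proof.
move=> Bx.
have ct := is_derive_cst tau x (basis l).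
have dp := is_derive_mul ct (is_derive_phase l x).
have de := @is_derive_comp R expR (fun y => tau * phase y) x (basis l) _ _
  (is_derive_expR _) dp.
have d := is_derive_mul de (is_derive_mul (is_derive_cutoff l x)
  (Ck_is_derive (Comega k) Bx l)).
have [_] := d; rewrite -[LHS]/(partial l (weighted_field k) x) => ->.
rewrite /weighted_field /carleman_factor /=.
rewrite /cst; move: (expR _) (partial _ _ _) => e p; ring.
Qed.

Definition omega_at x : 'I_3 -> R := fun k => omega k x.
Definition curl_at x : 'I_3 -> 'I_3 -> R :=
  fun i k => partial i (omega k) x - partial k (omega i) x.
Definition div_at (a : 'I_3 -> 'I_3 -> E -> R) x : R :=
  \sum_(j < 3) \sum_(k < 3) a j k x * partial j (omega k) x.

Lemma curl_res_weighted_field x i k : B x ->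
  curl_res weighted_field tau disp slope x i k =
  carleman_factor x * (cutoff x * curl_at x i k
            - 2 * (disp i x * omega k x - disp k x * omega i x)).
Proof.
move=> Bx; rewrite /curl_res /conj_curl /grad /vals /conormal /curl_at.
rewrite !partial_weighted_field// /weighted_field.
move: (carleman_factor x) (partial i _ _) (partial k _ _) => e p q; ring.
Qed.

Lemma div_res_weighted_field a x : B x ->
  div_res weighted_field tau a disp slope x =
  carleman_factor x * (cutoff x * div_at a x - 2 *
    (\sum_(j < 3) \sum_(k < 3) a j k x * (disp j x * omega k x))).
Proof.
move=> Bx; rewrite /div_res /conj_div /div_at /grad /vals /conormal /at_.
rewrite !mulr_sumr -sumrB mulr_sumr; apply: eq_bigr => j _.
rewrite !mulr_sumr -sumrB mulr_sumr; apply: eq_bigr => k _.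
rewrite partial_weighted_field// /weighted_field.
move: (carleman_factor x) (partial _ _ _) => e p; ring.
Qed.

Lemma sqnorm_weighted_field x : sqnorm weighted_field x = carleman_factor x ^+ 2 * (cutoff x ^+ 2 * sumsq (omega_at x)).
Proof. by rewrite /sqnorm /sumsq /weighted_field !sum3E /omega_at; ring. Qed.

Lemma sqr_sub_le (x y : R) : (x - y) ^+ 2 <= 2 * x ^+ 2 + 2 * y ^+ 2.
Proof.
rewrite -subr_ge0 (_ : _ - _ = (x + y) ^+ 2) ?sqr_ge0//; ring.
Qed.

Lemma sum3_2_affine (F : 'I_3 -> 'I_3 -> R) (e t c : R) :
  \sum_(i < 3) \sum_(k < 3) e * (t * F i k + c) =
  e * (t * (\sum_(i < 3) \sum_(k < 3) F i k) + 9 * c).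
Proof. by rewrite !sum3E; ring. Qed.

(** Conjugation absorbs the exponential, so only the derivative of the
cutoff contributes besides the Beltrami inequality for omega. *)
Lemma residual_weighted_field a (A K : R) x : B x ->
  (forall q, `|disp q x| <= A) ->
  (forall j, `|normal_vec a disp x j| <= A) ->
  (forall i j, a i j x = a j i x) ->
  sumsq2 (curl_at x) + div_at a x ^+ 2 <= K * sumsq (omega_at x) ->
  residual weighted_field tau a disp slope x <=
  carleman_factor x ^+ 2 * ((2 * K * cutoff x ^+ 2 + 384 * A ^+ 2) * sumsq (omega_at x)).
Proof.
move=> Bx dA nA sa KW; set W := sumsq (omega_at x).
have W0 : 0 <= W := sumsq_ge0 _.
have A2 := sqr_ge0 A.
have oW k : omega k x ^+ 2 <= W := sumsq_ge (omega_at x) k.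
have bnd (y z : R) : y ^+ 2 <= A ^+ 2 -> z ^+ 2 <= W -> (y * z) ^+ 2 <= A ^+ 2 * W.
  by move=> yA zW; rewrite exprMn; exact: (ler_pM (sqr_ge0 _) (sqr_ge0 _) yA zW).
have dw i k : (disp i x * omega k x - disp k x * omega i x) ^+ 2 <= 4 * (A ^+ 2 * W).
  apply: le_trans (sqr_sub_le _ _) _.
  have := bnd _ _ (sqr_le_norm (dA i)) (oW k); have := bnd _ _ (sqr_le_norm (dA k)) (oW i).
  by move: (_ ^+ 2) (_ ^+ 2) (A ^+ 2 * _) => *; lra.
have nw : (\sum_(j < 3) \sum_(k < 3) a j k x * (disp j x * omega k x)) ^+ 2 <= 12 * (A ^+ 2 * W).
  have -> : \sum_(j < 3) \sum_(k < 3) a j k x * (disp j x * omega k x) = 0 -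
     (- (normal_vec a disp x 0 * omega 0 x) + - (normal_vec a disp x 1 * omega 1 x)
      + - (normal_vec a disp x 2 * omega 2 x)).
    by rewrite /normal_vec !sum3E (sa 1 0) (sa 2 0) (sa 2 1); ring.
  apply: le_trans (sqr_sum4 _ _ _ _) _; rewrite expr0n !sqrrN /= add0r.
  have := bnd _ _ (sqr_le_norm (nA 0)) (oW 0); have := bnd _ _ (sqr_le_norm (nA 1)) (oW 1).
  have := bnd _ _ (sqr_le_norm (nA 2)) (oW 2).
  by move: (_ ^+ 2) (_ ^+ 2) (_ ^+ 2) (A ^+ 2 * _) => *; lra.
have c1 i k : curl_res weighted_field tau disp slope x i k ^+ 2 <=
    carleman_factor x ^+ 2 * (2 * cutoff x ^+ 2 * curl_at x i k ^+ 2 + 32 * (A ^+ 2 * W)).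
  rewrite curl_res_weighted_field// exprMn ler_wpM2l ?sqr_ge0//.
  apply: le_trans (sqr_sub_le _ _) _; rewrite !exprMn.
  have := dw i k; move: ((_ - _) ^+ 2) (A ^+ 2 * _) => p q.
  by move=> *; lra.
have c2 : div_res weighted_field tau a disp slope x ^+ 2 <=
    carleman_factor x ^+ 2 * (2 * cutoff x ^+ 2 * div_at a x ^+ 2 + 96 * (A ^+ 2 * W)).
  rewrite div_res_weighted_field// exprMn ler_wpM2l ?sqr_ge0//.
  apply: le_trans (sqr_sub_le _ _) _; rewrite !exprMn.
  move: nw; move: ((\sum_(j < 3) _) ^+ 2) (A ^+ 2 * _) => p q *; lra.
rewrite /residual.
have -> : curl_res weighted_field tau disp slope x = fun i k => curl_res weighted_field tau disp slope x i k.
  by [].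
apply: (@le_trans _ _ (\sum_(i < 3) \sum_(k < 3)
    carleman_factor x ^+ 2 * (2 * cutoff x ^+ 2 * curl_at x i k ^+ 2 + 32 * (A ^+ 2 * W))
   + carleman_factor x ^+ 2 * (2 * cutoff x ^+ 2 * div_at a x ^+ 2 + 96 * (A ^+ 2 * W)))).
  by apply: lerD => //; apply: ler_sum3 => i; apply: ler_sum3 => k; exact: c1.
have -> : \sum_(i < 3) \sum_(k < 3)
    carleman_factor x ^+ 2 * (2 * cutoff x ^+ 2 * curl_at x i k ^+ 2 + 32 * (A ^+ 2 * W)) =
  carleman_factor x ^+ 2 * (2 * cutoff x ^+ 2 * sumsq2 (curl_at x) + 288 * (A ^+ 2 * W)).
  rewrite sum3_2_affine; congr (_ * (_ + _)); ring.
rewrite -mulrDr ler_wpM2l ?sqr_ge0//.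
have := ler_wpM2l (sqr_ge0 (cutoff x)) KW; rewrite -/W.
move: (sumsq2 _) (div_at _ _ ^+ 2) (cutoff x ^+ 2) (A ^+ 2) => p q r s *; lra.
Qed.

End local_step.

(** * Continuation across a thin shell *)

Lemma sum3_bounds (R : realType) (X Y Z : R) : 0 <= X -> 0 <= Y -> 0 <= Z ->
  [/\ 1 <= 1 + (X + (Y + Z)), X <= 1 + (X + (Y + Z)), Y <= 1 + (X + (Y + Z)) &
    Z < 1 + (X + (Y + Z))].
Proof. by move=> *; split; lra. Qed.

(** The weight |v|^(2 / tau) undoes the power tau of the exponential factor of
v: it stays between positive bounds independent of tau. *)
Lemma expR_ln_sqr (R : realType) (tau p y : R) : tau != 0 -> 0 < y ->
  tau^-1 * ln (expR (tau * p) ^+ 2 * y) = 2 * p + tau^-1 * ln y.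
Proof.
move=> t0 y0; have e0 := expR_gt0 (tau * p).
rewrite lnM ?posrE ?exprn_gt0// lnXn// expRK mulrDr; congr (_ + _).
by rewrite -mulrnAr mulKf// mulr_natl.
Qed.

Section continuation_step.
Context {R : realType}.
Local Notation E := 'rV[R]_3.
Variables (L : nat) (B O : set E) (omega : 'I_3 -> E -> R)
  (a : 'I_3 -> 'I_3 -> E -> R) (x0 : E) (c0 A K M sig0 sig2 : R).
Local Notation s := (sqdist x0).
Local Notation n := (disp x0).
Local Notation W x := (sumsq (omega_at omega x)).
Local Notation normal := (normal_vec a n).

Hypothesis oB : open B.
Hypothesis oO : open O.
Hypothesis OB : O `<=` B.
Hypothesis Comega : forall k, Ck 2 B (omega k).
Hypothesis Ca : forall i j, Ck 1 B (a i j).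
Hypothesis O_pos : forall x, O x -> 0 < W x.
Hypothesis O_edge : forall x, B x ->
  [\/ O x, nbhs x (~` O) | forall k, omega k x = 0].
Hypothesis ballB : forall x, s x <= sig2 -> B x.
Hypothesis sa : forall x, B x -> forall i j, a i j x = a j i x.
Hypothesis c00 : 0 < c0.
Hypothesis ell : forall x, B x -> forall y, c0 * sumsq y <= quad (at_ a x) y y.
Hypothesis sig00 : 0 < sig0.
Hypothesis A0 : 0 < A.
Hypothesis aA : forall x i j, s x <= sig2 -> `|a i j x| <= A.
Hypothesis daA : forall x i j l, s x <= sig2 -> `|partial l (a i j) x| <= A.
Hypothesis nA : forall x i, s x <= sig2 -> `|n i x| <= A.
Hypothesis NA : forall x i, s x <= sig2 -> `|normal x i| <= A.
Hypothesis c1A : forall x l i j k, s x <= sig2 -> `|null_coef a n l i j k x| <= A.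
Hypothesis dc1A : forall x l i j k q, s x <= sig2 ->
  `|partial q (null_coef a n l i j k) x| <= A.
Hypothesis wA : forall x l i j, s x <= sig2 -> `|flux_coef a n l i j x| <= A.
Hypothesis dwA : forall x l i j q, s x <= sig2 ->
  `|partial q (flux_coef a n l i j) x| <= A.
Hypothesis K0 : 0 <= K.
Hypothesis beltrami : forall x, O x -> s x <= sig2 ->
  sumsq2 (curl_at omega x) + div_at omega a x ^+ 2 <= K * W x.
Hypothesis M1 : 1 <= M.
Hypothesis WM : forall x, s x <= sig2 -> W x <= M.
Hypothesis inbox : forall x, s x <= sig2 -> forall q, `|x 0 q| < L%:R - 1.

Definition convexity : R := Num.max 1 (convexity_threshold A c0 (c0 * sig0)).
Local Notation gam := convexity.

Let gam1 : 1 <= gam. Proof. by rewrite le_max lexx. Qed.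
Let gam0 : 0 < gam := lt_le_trans ltr01 gam1.

Variables (sig eps : R).
Hypothesis sig0_le : sig0 <= sig.
Hypothesis eps0 : 0 < eps.
Hypothesis eps_small : 2 * gam * eps <= 1.
Hypothesis sig_eps : sig + eps <= sig2.
Hypothesis vanish : forall x, O x -> sig <= s x.

(** The part of O between the spheres |x - x0|^2 = sig, inside which O has no
points, and |x - x0|^2 = sig + eps, where the cutoff vanishes. *)
Definition shell : set E := O `&` [set x | s x < sig + eps].
Local Notation Om := shell.
Local Notation v tau := (weighted_field x0 gam sig eps tau omega).
Local Notation chi := (cutoff x0 sig eps).
Local Notation ph := (phase x0 gam sig).

Let eps1 : eps <= 1.
Proof.
have : 1 * eps <= gam * eps by rewrite ler_pM2r.
by move: eps_small eps0; rewrite -mulrA; move: (gam * eps) => g; lra.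
Qed.

Let cs : continuous s.
Proof. by move=> x; apply: Ck_continuous (Ck_sqdist x0 0 openT) _. Qed.

Let Om2 x : Om x -> s x <= sig2.
Proof. by move=> [_ sx]; apply: le_trans sig_eps; exact: ltW. Qed.

Let OmB x : Om x -> B x. Proof. by move=> [/OB]. Qed.

Lemma Om_range x : Om x -> [/\ 0 <= s x - sig, s x - sig < eps,
  0 < chi x & chi x <= 1].
Proof.
move=> [Ox /= sx]; have := vanish Ox; rewrite /cutoff; move: sx eps1 => *.
by split; lra.
Qed.

(** A boundary point of the shell is a zero of omega or lies on the outer
sphere, where the cutoff vanishes. *)
Lemma truncation_weighted_field tau : truncation L B Om (v tau).
Proof.
split.
- exact: oB.
- apply: openI => //; rewrite -[X in open X]/(s @^-1` [set y | y < sig + eps]).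
  by apply: open_comp; [move=> x _; exact: cs|exact: open_lt].
- by move=> x /OmB.
- by move=> k; exact: Ck_weighted_field.
- move=> x Ox; have [_ _ chi0 _] := Om_range Ox; have [Ox' _] := Ox.
  by rewrite sqnorm_weighted_field; do 2 rewrite mulr_gt0 ?exprn_gt0 ?expR_gt0 ?O_pos//.
- move=> x; have [sx|sx|sx] := ltgtP (s x) (sig + eps).
  + have Bx : B x by apply: ballB; apply: le_trans sig_eps; exact: ltW.
    have [Ox|xO|ox] := O_edge Bx.
    * by apply: Or31; split.
    * by apply: Or32; apply: filterS xO => y Oy [].
    * by apply: Or33; split=> // k; rewrite /weighted_field ox !mulr0.
  + apply: Or32; have : nbhs x (s @^-1` [set y | sig + eps < y]).
      by apply: cs; apply: open_nbhs_nbhs; split => //; exact: open_gt.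
    by apply: filterS => y /= sy [_ /= sy']; move: (lt_trans sy sy'); rewrite ltxx.
  + apply: Or33; split; first by apply: ballB; rewrite sx.
    by move=> k; rewrite /weighted_field /cutoff sx subrr mul0r mulr0.
- move=> x /Om2 /inbox xL q; apply: lt_trans (xL q) _.
  by rewrite ltrBlDr ltrDl.
Qed.

Local Notation C := (carleman_const A c0).

Lemma carleman_shell tau : 1 <= tau -> 1728 * A / c0 <= tau ->
  wneg L Om (v tau) tau^-1 (fun x => tau * sumsq (vals (v tau) x)
    - C * residual (v tau) tau a n (slope x0 gam sig) x).
Proof.
move=> tau1 tauA; have rho0 : 0 < c0 * sig0 by rewrite mulr_gt0.
apply: (carleman (truncation_weighted_field tau) tau1 A0 c00 rho0 gam0) => //.
- by move=> i; exact: Ck_disp.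
- exact: Ck_slope.
- by move=> x l _; have [_] := is_derive_slope x0 gam sig l x.
- move=> x Ox; have [d0 de _ _] := Om_range Ox.
  have g1 : gam * (s x - sig) <= gam * eps by rewrite ler_pM2l// ltW.
  have g0 : 0 <= gam * (s x - sig) by rewrite mulr_ge0// ltW.
  move: g1 g0 eps_small; rewrite /slope -mulrA; move: (gam * (s x - sig)) (gam * eps) => p q *.
  by apply/andP; split; lra.
- by move=> x /OmB; exact: sa.
- by move=> x /OmB; exact: ell.
- move=> x Ox; have -> : normal_sq a n x = quad (at_ a x) (n ^~ x) (n ^~ x).
    rewrite /normal_sq /quad /at_ /normal_vec; apply: eq_bigr => i _; rewrite mulr_sumr.
    by apply: eq_bigr => j _; ring.
  apply: le_trans (ell (OmB Ox) _); rewrite ler_pM2l//.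
  have -> : sumsq (n ^~ x) = s x by apply: eq_bigr => q _; rewrite expr2.
  by apply: le_trans sig0_le _; apply: vanish; case: Ox.
- by move=> x i j /Om2; exact: aA.
- by move=> x i j l /Om2; exact: daA.
- by move=> x i /Om2; exact: nA.
- by move=> x i /Om2; exact: NA.
- by move=> x l i j k /Om2; exact: c1A.
- by move=> x l i j k q /Om2; exact: dc1A.
- by move=> x l i j /Om2; exact: wA.
- by move=> x l i j q /Om2; exact: dwA.
- by rewrite /convexity le_max lexx orbT.
Qed.

(** The value of the phase halfway through the shell. *)
Definition mid_phase : R := - (eps / 2) + gam / 2 * (eps / 2) ^+ 2.

Lemma phase_decr (d d' : R) : 0 <= d -> d <= d' -> d' <= eps ->
  - d' + gam / 2 * d' ^+ 2 <= - d + gam / 2 * d ^+ 2.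
Proof.
move=> d0 dd de; rewrite -subr_ge0.
have -> : - d + gam / 2 * d ^+ 2 - (- d' + gam / 2 * d' ^+ 2) =
   (d' - d) * (1 - gam * ((d' + d) / 2)) by field.
rewrite mulr_ge0// subr_ge0//.
have : gam * ((d' + d) / 2) <= gam * eps by rewrite ler_pM2l//; lra.
by move: eps_small; rewrite -mulrA; move: (gam * ((d' + d) / 2)) (gam * eps) => p q *; lra.
Qed.

Lemma phase_range x : Om x -> - 1 <= ph x <= 0.
Proof.
move=> Ox; have [d0 de _ _] := Om_range Ox; rewrite /phase.
have p0 : 0 <= gam / 2 * (s x - sig) ^+ 2 by rewrite mulr_ge0 ?sqr_ge0// divr_ge0// ltW.
have := phase_decr (lexx 0) d0 (ltW de); rewrite expr0n mulr0 addr0 oppr0 => ->.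
by rewrite andbT; move: eps1 p0 d0 de; move: (s x - sig) (gam / 2 * (s x - sig) ^+ 2) => *; lra.
Qed.

Lemma carl_mid x tau : Om x -> 0 <= tau ->
  if s x < sig + eps / 2 then expR (tau * mid_phase) <= carleman_factor x0 gam sig tau x
  else carleman_factor x0 gam sig tau x <= expR (tau * mid_phase).
Proof.
move=> Ox t0; have [d0 de _ _] := Om_range Ox.
have e2 : 0 <= eps / 2 by rewrite divr_ge0// ltW.
rewrite /carleman_factor; case: ltP => sx; rewrite ler_expR; apply: ler_wpM2l => //.
  by apply: phase_decr => //; move: sx eps0; lra.
by apply: phase_decr => //; [move: sx; lra|exact: ltW].
Qed.

Let C_ge0 : 0 <= C.
Proof.
have d0 : 0 <= gradient_slope A c0.
  by apply: divr_ge0; [exact: ltW|apply: mulr_ge0 => //; apply: addr_ge0 => //;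
    apply: mulr_ge0 => //; exact: ltW].
have t0 : 0 <= gradient_time A c0 := divr_ge0 (mulr_ge0 (ler0n _ _) (ltW A0)) (ltW c00).
have A27 : 0 <= 27 * A := mulr_ge0 (ler0n _ _) (ltW A0).
have g0 : 0 <= gradient_const A c0.
  apply: divr_ge0; last exact: ltW.
  apply: mulr_ge0 => //; apply: addr_ge0; last exact: mulr_ge0.
  apply: divr_ge0 => //; apply: addr_ge0; apply: mulr_ge0 => //;
    by apply: addr_ge0 => //; apply: mulr_ge0 => //; exact: sqr_ge0.
apply: addr_ge0; first exact: mulr_ge0 (mulr_ge0 (ler0n _ _) (ltW A0)) g0.
exact: mulr_ge0 (ler0n _ _) (exprn_ge0 _ (ltW A0)).
Qed.

Definition inner_const : R := 2 * K + 1536 * A ^+ 2 / eps ^+ 2.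
Definition outer_const : R := (2 * K + 384 * A ^+ 2) * M.

Let bracket_ge0 x : 0 <= 2 * K * chi x ^+ 2 + 384 * A ^+ 2.
Proof.
exact: addr_ge0 (mulr_ge0 (mulr_ge0 (ler0n R 2) K0) (sqr_ge0 _))
  (mulr_ge0 (ler0n R 384) (sqr_ge0 A)).
Qed.

Let residual_le tau x : Om x -> residual (v tau) tau a n (slope x0 gam sig) x <=
  carleman_factor x0 gam sig tau x ^+ 2 * ((2 * K * chi x ^+ 2 + 384 * A ^+ 2) * W x).
Proof.
move=> Ox; have sx := Om2 Ox.
apply: (residual_weighted_field gam sig eps tau Comega (OmB Ox)) => //.
- by move=> q; exact: nA.
- by move=> j; exact: NA.
- exact: sa (OmB Ox).
- by apply: beltrami => //; case: Ox.
Qed.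

(** The cutoff is at least eps / 2 here, so its derivative is bounded by a
multiple of the cutoff and the residual is absorbed for large tau. *)
Lemma residual_inner tau x : Om x -> s x < sig + eps / 2 ->
  residual (v tau) tau a n (slope x0 gam sig) x <=
  inner_const * sumsq (vals (v tau) x).
Proof.
move=> Ox sx; apply: le_trans (residual_le tau Ox) _.
have -> : sumsq (vals (v tau) x) = sqnorm (v tau) x by [].
rewrite sqnorm_weighted_field [leRHS]mulrCA ler_wpM2l ?sqr_ge0// [leRHS]mulrA ler_wpM2r ?sumsq_ge0//.
rewrite /inner_const [leRHS]mulrDl lerD2l.
have chie : eps / 2 <= chi x by rewrite /cutoff; move: sx; lra.
have e24 : (eps / 2) ^+ 2 <= chi x ^+ 2.
  rewrite ler_pXn2r ?nnegrE//; first by rewrite divr_ge0// ltW.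
  by apply: le_trans chie; rewrite divr_ge0// ltW.
have -> : 384 * A ^+ 2 = 1536 * A ^+ 2 / eps ^+ 2 * (eps / 2) ^+ 2.
  by field; rewrite gt_eqF.
apply: ler_wpM2l e24.
exact: divr_ge0 (mulr_ge0 (ler0n R 1536) (sqr_ge0 A)) (sqr_ge0 eps).
Qed.

(** Here the residual is not absorbed, but it is small compared to the inner half
because the phase is smaller. *)
Lemma residual_outer tau x : Om x -> 0 <= tau -> sig + eps / 2 <= s x ->
  residual (v tau) tau a n (slope x0 gam sig) x <=
  expR (tau * mid_phase) ^+ 2 * outer_const.
Proof.
move=> Ox t0 sx; apply: le_trans (residual_le tau Ox) _.
have := carl_mid Ox t0; rewrite ltNge sx /= => ce.
have [_ _ chi0 chi1] := Om_range Ox.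
apply: (ler_pM (sqr_ge0 _) (mulr_ge0 (bracket_ge0 x) (sumsq_ge0 _))).
- by rewrite ler_pXn2r ?nnegrE ?expR_ge0.
- apply: (ler_pM (bracket_ge0 x) (sumsq_ge0 _)); last exact/WM/Om2.
  rewrite lerD2r -[leRHS]mulr1 ler_wpM2l ?mulr_ge0// expr_le1// ltW//.
Qed.

Variables (x1 : E) (d w1 : R).
Hypothesis w10 : 0 < w1.
Hypothesis cube : forall x : E, [forall q, `|x 0 q - x1 0 q| < d] ->
  [/\ O x, s x < sig + eps / 2 & w1 <= W x].

Local Notation cubeI x := ([forall q, `|x 0 q - x1 0 q| < d]%:R : R).

(** Division of [carleman_shell] by exp (2 tau mid_phase): the left-hand side
keeps a contribution of order tau from a cube in the inner half, while the
right-hand side is bounded independently of tau. *)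
Lemma shell_neg tau : 1 <= tau -> 1728 * A / c0 <= tau ->
  2 * C * inner_const <= tau ->
  wneg L Om (v tau) tau^-1 (fun x =>
    tau * (eps ^+ 2 * w1 / 8) * cubeI x - C * outer_const).
Proof.
move=> tau1 tauA tauC; have t0 : 0 <= tau := le_trans ler01 tau1.
set em := expR (tau * mid_phase).
have em0 : 0 < em ^+ 2 by rewrite exprn_gt0// expR_gt0.
have ei0 : 0 <= (em ^+ 2)^-1 by rewrite invr_ge0 ltW.
have o0 : 0 <= C * outer_const.
  apply: (mulr_ge0 C_ge0); apply: mulr_ge0; last exact: le_trans ler01 M1.
  exact: addr_ge0 (mulr_ge0 (ler0n R 2) K0) (mulr_ge0 (ler0n R 384) (sqr_ge0 A)).
apply: wneg_le (wnegZ ei0 (carleman_shell tau1 tauA)) => x Ox.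
rewrite [leRHS]mulrC ler_pdivlMr// [leLHS]mulrC.
have V0 := sumsq_ge0 (vals (v tau) x).
have [sx|sx] := ltP (s x) (sig + eps / 2).
  have r1 := residual_inner tau Ox sx.
  have r2 := ler_wpM2l C_ge0 r1.
  have r3 := ler_wpM2r V0 tauC.
  have -> : em ^+ 2 * (tau * (eps ^+ 2 * w1 / 8) * cubeI x - C * outer_const)
     = tau / 2 * (em ^+ 2 * (eps ^+ 2 / 4 * w1) * cubeI x) - em ^+ 2 * (C * outer_const).
    by field.
  have o1 : 0 <= em ^+ 2 * (C * outer_const) by rewrite mulr_ge0// ltW.
  suff : em ^+ 2 * (eps ^+ 2 / 4 * w1) * cubeI x <= sumsq (vals (v tau) x).
    move=> /(ler_wpM2l (divr_ge0 t0 (ler0n R 2))).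
    move: r2 r3 o1; move: (em ^+ 2 * (C * _)) (tau / 2 * (_ * _)) => p q.
    move: (residual _ _ _ _ _ _) (sumsq _) C inner_const => r V c i *; lra.
  have [cx|_] := boolP [forall q, `|x 0 q - x1 0 q| < d]; last by rewrite mulr0.
  have [_ _ w1W] := cube cx; rewrite mulr1.
  have -> : sumsq (vals (v tau) x) = sqnorm (v tau) x by [].
  have := carl_mid Ox t0; rewrite sx => ce.
  rewrite sqnorm_weighted_field; apply: ler_pM; first exact: ltW.
  - by rewrite mulr_ge0 ?divr_ge0 ?sqr_ge0// ltW.
  - by rewrite ler_pXn2r ?nnegrE ?expR_ge0.
  - apply: ler_pM; rewrite ?divr_ge0 ?sqr_ge0 ?(ltW w10)//.
    have -> : eps ^+ 2 / 4 = (eps / 2) ^+ 2 by field.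
    have chie : eps / 2 <= chi x by rewrite /cutoff; move: sx; lra.
    have e2 : 0 <= eps / 2 by rewrite divr_ge0// ltW.
    by rewrite ler_pXn2r ?nnegrE// (le_trans e2 chie).
have -> : cubeI x = 0.
  have [cx|//] := boolP [forall q, `|x 0 q - x1 0 q| < d].
  by have [_ + _] := cube cx; rewrite ltNge sx.
have r1 := ler_wpM2l C_ge0 (residual_outer Ox t0 sx).
have r2 : 0 <= tau * sumsq (vals (v tau) x) by rewrite mulr_ge0.
rewrite mulr0 sub0r mulrN mulrCA; move: r1 r2; rewrite -/em.
by move: (C * _) (C * _) (tau * _) => p q r *; lra.
Qed.

Let weightE tau x : Om x -> 1 <= tau ->
  weight (v tau) tau^-1 x = expR (2 * ph x + tau^-1 * ln (chi x ^+ 2 * W x)).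
Proof.
move=> Ox tau1; have t0 : tau != 0 by rewrite gt_eqF// (lt_le_trans ltr01).
have [_ _ chi0 _] := Om_range Ox; have [Ox' _] := Ox.
have y0 : 0 < chi x ^+ 2 * W x by apply: mulr_gt0; [exact: exprn_gt0|exact: O_pos].
by rewrite /weight sqnorm_weighted_field /carleman_factor expR_ln_sqr.
Qed.

Let weight_le tau x : Om x -> 1 <= tau -> weight (v tau) tau^-1 x <= M.
Proof.
move=> Ox tau1; have t0 : 0 < tau := lt_le_trans ltr01 tau1.
have [_ _ chi0 chi1] := Om_range Ox; have [Ox' _] := Ox.
have M0 : 0 < M := lt_le_trans ltr01 M1.
rewrite weightE// -[leRHS](@lnK R) ?posrE// ler_expR -[leRHS]add0r; apply: lerD.
  by have /andP[_] := phase_range Ox; lra.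
have lM : ln (chi x ^+ 2 * W x) <= ln M.
  rewrite ler_ln ?posrE//; last by apply: mulr_gt0; [exact: exprn_gt0|exact: O_pos].
  rewrite -[leRHS]mul1r; apply: ler_pM; rewrite ?sqr_ge0 ?sumsq_ge0//; last exact/WM/Om2.
  by rewrite expr_le1// ltW.
rewrite ler_pdivrMl//; apply: le_trans lM _.
by rewrite ler_peMl// ln_ge0.
Qed.

(** The minimum with 1 makes the logarithm nonpositive, so that it only grows when
divided by tau. *)
Definition cube_floor : R := Num.min 1 (eps ^+ 2 / 4 * w1).

Let floor0 : 0 < cube_floor.
Proof. by rewrite lt_min ltr01 /= !mulr_gt0 ?exprn_gt0. Qed.

Let weight_ge tau (x : E) : [forall q, `|x 0 q - x1 0 q| < d] -> Om x -> 1 <= tau ->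
  expR (- 2 + ln cube_floor) <= weight (v tau) tau^-1 x.
Proof.
move=> cx Ox tau1; have t0 : 0 < tau := lt_le_trans ltr01 tau1.
have [Ox' sx w1W] := cube cx; have [_ _ chi0 chi1] := Om_range Ox.
rewrite weightE// ler_expR; apply: lerD.
  by have /andP[+ _] := phase_range Ox; lra.
have lM : ln cube_floor <= ln (chi x ^+ 2 * W x).
  rewrite ler_ln ?posrE//; last by apply: mulr_gt0; [exact: exprn_gt0|exact: O_pos].
  apply: (@le_trans _ _ (eps ^+ 2 / 4 * w1)); first by rewrite ge_min lexx orbT.
  apply: ler_pM; rewrite ?divr_ge0 ?sqr_ge0 ?(ltW w10)//.
  have -> : eps ^+ 2 / 4 = (eps / 2) ^+ 2 by field.
  have chie : eps / 2 <= chi x by rewrite /cutoff; move: sx; lra.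
  have e2 : 0 <= eps / 2 by rewrite divr_ge0// ltW.
  by rewrite ler_pXn2r ?nnegrE// (le_trans e2 chie).
rewrite ler_pdivlMl//; apply: le_trans lM.
have l0 : ln cube_floor <= 0 by apply: ln_le0; rewrite ge_min lexx.
by have := ler_wnM2r l0 tau1; rewrite mul1r.
Qed.

Hypothesis d0 : 0 < d.
Hypothesis d1 : d <= 1.

(** In [shell_neg] the coefficient of the cube grows like tau and everything
else is bounded, including the weights. *)
Lemma shell_contradiction : False.
Proof.
have cx1 : [forall q, `|x1 0 q - x1 0 q| < d].
  by apply/forallP => q; rewrite subrr normr0.
have [Ox1 sx1 _] := cube cx1.
have e2 : eps / 2 < eps by rewrite ltr_pdivrMr// ltr_pMr// ltr1n.
have cubeOm (x : E) : [forall q, `|x 0 q - x1 0 q| < d] -> Om x.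
  by move=> /cube[Ox sx _]; split => //=; apply: lt_trans sx _; rewrite ltrD2l.
pose wl := expR (- 2 + ln cube_floor); have wl0 : 0 < wl by exact: expR_gt0.
pose a1 := eps ^+ 2 * w1 / 8.
have a10 : 0 < a1 by rewrite divr_gt0// mulr_gt0// exprn_gt0.
pose Co := C * outer_const.
have M0 : 0 <= M := le_trans ler01 M1.
have Co0 : 0 <= Co.
  apply: (mulr_ge0 C_ge0); apply: mulr_ge0 _ M0.
  exact: addr_ge0 (mulr_ge0 (ler0n R 2) K0) (mulr_ge0 (ler0n R 384) (sqr_ge0 A)).
pose D := wl * a1 * (d / 4) ^+ 3.
have D0 : 0 < D by rewrite !mulr_gt0// exprn_gt0// divr_gt0.
pose b := M * Co; have b0 : 0 <= b by exact: mulr_ge0.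
have V0 : 0 <= (2 * L%:R : R) ^+ 3 by rewrite exprn_ge0// mulr_ge0.
have t1 : 0 <= 1728 * A / c0 := divr_ge0 (mulr_ge0 (ler0n _ _) (ltW A0)) (ltW c00).
have t2 : 0 <= 2 * C * inner_const.
  apply: (mulr_ge0 (mulr_ge0 (ler0n R 2) C_ge0)).
  exact: addr_ge0 (mulr_ge0 (ler0n R 2) K0)
    (divr_ge0 (mulr_ge0 (ler0n R 1536) (sqr_ge0 A)) (sqr_ge0 eps)).
pose t3 := b * (2 * L%:R) ^+ 3 / D.
have t30 : 0 <= t3 by apply: divr_ge0; [exact: mulr_ge0|exact: ltW].
(* The last summand makes the cube, of volume at least (d / 4)^3, win. *)
pose tau := 1 + (1728 * A / c0 + (2 * C * inner_const + t3)).
have [tau1 tauA tauC tau3] := sum3_bounds t1 t2 t30.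
rewrite -/tau in tau1 tauA tauC tau3.
have tau0 : 0 < tau := lt_le_trans ltr01 tau1.
have nf := shell_neg tau1 tauA tauC.
apply: (@bump_not_asneg R L x1 d (wl * (tau * a1)) b d0 _ _ _ _).
- by rewrite !mulr_gt0.
- move=> q; have /inbox/(_ q) : s x1 <= sig2.
    by apply: Om2; exact: cubeOm.
  rewrite ltr_norml => /andP[h1 h2]; split; last by move: d1 h2; lra.
  by move: h1; rewrite opprB; lra.
- have -> : wl * (tau * a1) * (d / 4) ^+ 3 = tau * D by rewrite /D; ring.
  by rewrite -ltr_pdivrMr.
- apply: asneg_le nf => x.
  have [Ox|Ox] := pselect (Om x); last first.
    rewrite patchC ?inE//; have [/cubeOm//|_] := boolP [forall q, `|x 0 q - x1 0 q| < d].
    by rewrite mulr0 sub0r oppr_le0.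
  rewrite patchT ?inE// mulrBr; apply: lerB; last first.
    by apply: ler_wpM2r => //; exact: weight_le.
  have [cx|_] := boolP [forall q, `|x 0 q - x1 0 q| < d]; last by rewrite !mulr0.
  rewrite !mulr1; apply: ler_wpM2r; last exact: weight_ge.
  by apply: mulr_ge0; exact: ltW.
Qed.

End continuation_step.

(** * Continuation across balls *)

Section bounds.
Context {R : realType}.
Local Notation E := 'rV[R]_3.
Implicit Types (B P : set E) (f : E -> R).

Definition bounded_on P f : Prop := exists A : R, forall x, P x -> `|f x| <= A.

(** Finite families of bounds are merged here so that the Carleman estimate can be
stated with a single constant. *)
Lemma bounded_on_family (I : finType) P (F : I -> E -> R) : (forall i, bounded_on P (F i)) ->
  exists A : R, forall i x, P x -> `|F i x| <= A.
Proof.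
move=> bF; have [A AP] := choice bF.
exists (\sum_i `|A i|) => i x Px; apply: le_trans (AP i x Px) _.
by rewrite (bigD1 i)//= ler_wpDr ?ler_norm// sumr_ge0.
Qed.

Lemma Ck_bounded_on k B P f : compact P -> P `<=` B -> Ck k B f -> bounded_on P f.
Proof.
move=> cP PB Cf; have cf : {within P, continuous f}.
  apply: continuous_in_subspaceT => x /set_mem Px.
  exact: Ck_continuous Cf (PB _ Px).
have [M [_ bM]] := compact_bounded (continuous_compact cf cP).
by exists (M + 1) => x Px; apply: (bM (M + 1)); [rewrite ltrDl|exists x].
Qed.

Lemma compact_sqdist (x0 : E) (r : R) : compact [set x | sqdist x0 x <= r].
Proof.
have cs : continuous (sqdist x0).
  by move=> x; apply: Ck_continuous (Ck_sqdist x0 0 openT) _.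
apply: bounded_closed_compact.
  exists (`|x0| + (r + 1)); split; first exact: num_real.
  move=> M rM x /= sx; apply: le_trans (ltW rM).
  rewrite -[x](subrK x0) addrC; apply: le_trans (ler_normD _ _) _.
  rewrite lerD2l.
  have r0 : 0 <= r by apply: le_trans sx; apply: sumr_ge0 => q _; rewrite -expr2; exact: sqr_ge0.
  apply: norm_le_coord => [|q]; first by rewrite addr_ge0.
  have : disp x0 q x * disp x0 q x <= r.
    apply: le_trans sx; rewrite /sqdist (bigD1 q)//= lerDl sumr_ge0// => k _.
    by rewrite -expr2 sqr_ge0.
  by rewrite /disp !mxE; move: (x 0 q - x0 0 q) => y; rewrite ler_norml; move=> *; apply/andP; split; nra.
apply: (@closed_comp _ _ (sqdist x0) [set y | y <= r]); last exact: closed_le.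
by move=> x _; exact: cs.
Qed.

End bounds.

Section local_continuation.
Context {R : realType}.
Local Notation E := 'rV[R]_3.
Variables (B O : set E) (omega : 'I_3 -> E -> R)
  (a : 'I_3 -> 'I_3 -> E -> R) (x0 : E) (c0 K sig0 sig1 sig2 : R).
Local Notation s := (sqdist x0).
Local Notation n := (disp x0).

Hypothesis oB : open B.
Hypothesis oO : open O.
Hypothesis OB : O `<=` B.
Hypothesis Comega : forall k, Ck 2 B (omega k).
Hypothesis Ca : forall i j, Ck 1 B (a i j).
Hypothesis O_pos : forall x, O x -> 0 < sumsq (omega_at omega x).
Hypothesis O_edge : forall x, B x ->
  [\/ O x, nbhs x (~` O) | forall k, omega k x = 0].
Hypothesis ballB : forall x, s x <= sig2 -> B x.
Hypothesis sa : forall x, B x -> forall i j, a i j x = a j i x.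
Hypothesis c00 : 0 < c0.
Hypothesis ell : forall x, B x -> forall y, c0 * sumsq y <= quad (at_ a x) y y.
Hypothesis sig00 : 0 < sig0.
Hypothesis sig12 : sig1 < sig2.
Hypothesis K0 : 0 <= K.
Hypothesis beltrami : forall x, O x -> s x <= sig2 ->
  sumsq2 (curl_at omega x) + div_at omega a x ^+ 2 <= K * sumsq (omega_at omega x).
Hypothesis vanish : forall x, O x -> sig0 <= s x.

Let P : set E := [set x | s x <= sig2].
Let cP : compact P. Proof. exact: compact_sqdist. Qed.
Let PB : P `<=` B. Proof. by move=> x; exact: ballB. Qed.

Let Cn i : Ck 1 B (n i). Proof. exact: Ck_disp. Qed.
Let Cnormal i : Ck 1 B (fun x => normal_vec a n x i).
Proof.
by apply: (@Ck_sum _ 1 B _ _ _ (fun k x => a i k x * n k x) oB) => k;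
  exact: CkM oB (Ca i k) (Cn k).
Qed.
Let Cnormal_sq : Ck 1 B (normal_sq a n).
Proof.
by apply: (@Ck_sum _ 1 B _ _ _ (fun k x => n k x * normal_vec a n x k) oB) => k;
  exact: CkM oB (Cn k) (Cnormal k).
Qed.
Let Cnull l i j k : Ck 1 B (null_coef a n l i j k).
Proof. exact: CkM oB (CkM oB (Cnormal l) (Cnormal i)) (Ca j k). Qed.
Let Cflux l i j : Ck 1 B (flux_coef a n l i j).
Proof. exact: CkM oB (CkM oB Cnormal_sq (Cnormal l)) (Ca i j). Qed.
Let CW : Ck 2 B (fun x => sumsq (omega_at omega x)).
Proof.
apply: (@Ck_sum _ 2 B _ _ _ (fun k x => omega k x ^+ 2) oB) => k.
by apply: (Ck_ext oB _ (CkM oB (Comega k) (Comega k))) => x _; rewrite expr2.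
Qed.

Lemma local_bounds : exists A M : R, exists L : nat,
  [/\ 0 < A, 1 <= M,
     (forall x, s x <= sig2 -> sumsq (omega_at omega x) <= M),
     (forall x, s x <= sig2 -> forall q, `|x 0 q| < L%:R - 1) &
   [/\ (forall x i j, s x <= sig2 -> `|a i j x| <= A),
   (forall x i j l, s x <= sig2 -> `|partial l (a i j) x| <= A),
   (forall x i, s x <= sig2 -> `|n i x| <= A) &
   [/\ (forall x i, s x <= sig2 -> `|normal_vec a n x i| <= A),
   (forall x l i j k, s x <= sig2 -> `|null_coef a n l i j k x| <= A),
   (forall x l i j k q, s x <= sig2 -> `|partial q (null_coef a n l i j k) x| <= A),
   (forall x l i j, s x <= sig2 -> `|flux_coef a n l i j x| <= A) &
   (forall x l i j q, s x <= sig2 -> `|partial q (flux_coef a n l i j) x| <= A)]]].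
Proof.
have bd k f : Ck k B f -> bounded_on P f := @Ck_bounded_on _ k B P f cP PB.
have [A1 b1] := bounded_on_family (fun p : 'I_3 * 'I_3 => bd 1%N _ (Ca p.1 p.2)).
have [A2 b2] := bounded_on_family (fun p : 'I_3 * 'I_3 * 'I_3 =>
  bd 0%N _ (Ck_partial (Ca p.1.1 p.1.2) p.2)).
have [A3 b3] := bounded_on_family (fun i => bd 1%N _ (Cn i)).
have [A4 b4] := bounded_on_family (fun i => bd 1%N _ (Cnormal i)).
have [A5 b5] := bounded_on_family (fun p : 'I_3 * 'I_3 * 'I_3 * 'I_3 =>
  bd 1%N _ (Cnull p.1.1.1 p.1.1.2 p.1.2 p.2)).
have [A6 b6] := bounded_on_family (fun p : 'I_3 * 'I_3 * 'I_3 * 'I_3 * 'I_3 =>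
  bd 0%N _ (Ck_partial (Cnull p.1.1.1.1 p.1.1.1.2 p.1.1.2 p.1.2) p.2)).
have [A7 b7] := bounded_on_family (fun p : 'I_3 * 'I_3 * 'I_3 =>
  bd 1%N _ (Cflux p.1.1 p.1.2 p.2)).
have [A8 b8] := bounded_on_family (fun p : 'I_3 * 'I_3 * 'I_3 * 'I_3 =>
  bd 0%N _ (Ck_partial (Cflux p.1.1.1 p.1.1.2 p.1.2) p.2)).
have [M0 bM] := bd _ _ CW.
have [M1 bx] := bounded_on_family (fun q => bd 1%N _ (Ck_coord 1 q oB)).
pose A := 1 + (`|A1| + `|A2| + `|A3| + `|A4| + `|A5| + `|A6| + `|A7| + `|A8|).
have AP : [/\ 0 < A, A1 <= A, A2 <= A, A3 <= A & [/\ A4 <= A, A5 <= A, A6 <= A, A7 <= A & A8 <= A]].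
  have := (ler_norm A1, ler_norm A2, ler_norm A3, ler_norm A4).
  have := (ler_norm A5, ler_norm A6, ler_norm A7, ler_norm A8).
  have := (normr_ge0 A1, normr_ge0 A2, normr_ge0 A3, normr_ge0 A4).
  have := (normr_ge0 A5, normr_ge0 A6, normr_ge0 A7, normr_ge0 A8).
  rewrite /A; move: `|A1| `|A2| `|A3| `|A4| `|A5| `|A6| `|A7| `|A8| => ????????.
  by move=> [[[? ?] ?] ?] [[[? ?] ?] ?] [[[? ?] ?] ?] [[[? ?] ?] ?]; split; [..|split]; lra.
have [A0 h1 h2 h3 [h4 h5 h6 h7 h8]] := AP.
exists A, (1 + `|M0|), (Num.truncn (`|M1| + 1)).+1.
split=> //.
- by rewrite lerDl.
- move=> x sx; apply: le_trans (ler_norm _) _; apply: le_trans (bM x sx) _.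
  by apply: le_trans (ler_norm _) _; rewrite lerDr.
- move=> x sx q; apply: le_lt_trans (bx q x sx) _; apply: le_lt_trans (ler_norm _) _.
  rewrite ltrBrDr.
  by have /andP[] := truncn_itv (addr_ge0 (normr_ge0 M1) (@ler01 R)).
split.
- by move=> x i j sx; apply: le_trans (b1 (i, j) x sx) h1.
- by move=> x i j l sx; apply: le_trans (b2 (i, j, l) x sx) h2.
- by move=> x i sx; apply: le_trans (b3 i x sx) h3.
split.
- by move=> x i sx; apply: le_trans (b4 i x sx) h4.
- by move=> x l i j k sx; apply: le_trans (b5 (l, i, j, k) x sx) h5.
- by move=> x l i j k q sx; apply: le_trans (b6 (l, i, j, k, q) x sx) h6.
- by move=> x l i j sx; apply: le_trans (b7 (l, i, j) x sx) h7.
- by move=> x l i j q sx; apply: le_trans (b8 (l, i, j, q) x sx) h8.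
Qed.

(** The width eps of a shell depends on the bounds over the whole ball
and not on sig, so finitely many steps lead from sig0 to sig1. *)
Lemma local_continuation x : O x -> sig1 <= s x.
Proof.
have [A [M [L [A0 M1 WM inbox [aA daA nA [NA c1A dc1A wA dwA]]]]]] := local_bounds.
pose gam := convexity c0 A sig0.
have gam1 : 1 <= gam by rewrite /gam /convexity le_max lexx.
have gam0 : 0 < 2 * gam by rewrite mulr_gt0// (lt_le_trans ltr01).
pose eps := Num.min (2 * gam)^-1 (sig2 - sig1).
have eps0 : 0 < eps by rewrite lt_min invr_gt0 gam0 subr_gt0.
have eps_small : 2 * gam * eps <= 1.
  by rewrite mulrC -ler_pdivlMr// div1r ge_min lexx.
have eps2 : eps <= sig2 - sig1 by rewrite ge_min lexx orbT.
have cs : continuous s.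
  by move=> y; apply: Ck_continuous (Ck_sqdist x0 0 openT) _.
have step sig : sig0 <= sig -> sig <= sig1 -> (forall y, O y -> sig <= s y) ->
    forall y, O y -> sig + eps / 2 <= s y.
  move=> sig_ge sig_le van x1 Ox1; rewrite leNgt; apply/negP => sx1.
  have W0 := O_pos Ox1; have Bx1 := OB Ox1.
  pose w1 := sumsq (omega_at omega x1) / 2.
  have w10 : 0 < w1 by rewrite divr_gt0.
  have n1 := continuous_near (Ck_continuous CW Bx1) w10.
  have n2 : nbhs x1 (s @^-1` [set y | y < sig + eps / 2]).
    by apply: cs; apply: open_nbhs_nbhs; split => //; exact: open_lt.
  have n3 : nbhs x1 O by exact: open_nbhs_nbhs.
  have [r /= r0 br] := (nbhs_ballP x1 _).1 (filterI n3 (filterI n1 n2)).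
  pose d := Num.min 1 (r / 2).
  have d0 : 0 < d by rewrite lt_min ltr01 divr_gt0.
  have d1 : d <= 1 by rewrite ge_min lexx.
  have cube (y : E) : [forall q, `|y 0 q - x1 0 q| < d] ->
      [/\ O y, s y < sig + eps / 2 & w1 <= sumsq (omega_at omega y)].
    move=> /forallP yd; have by_ : ball x1 r y.
      rewrite -ball_normE /= -normrN opprB; apply: (@le_lt_trans _ _ (r / 2)).
        apply: norm_le_coord => [|q]; first by rewrite divr_ge0// ltW.
        rewrite !mxE; apply: le_trans (ltW (yd q)) _.
        by rewrite ge_min lexx orbT.
      by rewrite ltr_pdivrMr// ltr_pMr// ltr1n.
    have [Oy [wy sy]] := br _ by_; split => //.
    have := ler_norm (sumsq (omega_at omega x1) - sumsq (omega_at omega y)).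
    move: wy; rewrite /w1 /=; move: (sumsq _) (sumsq _) `|_| => p q u; lra.
  have sig_eps : sig + eps <= sig2 by move: eps2 sig_le; lra.
  exact: (shell_contradiction oB oO OB Comega Ca O_pos O_edge ballB sa c00 ell
    sig00 A0 aA daA nA NA c1A dc1A wA dwA K0 beltrami M1 WM inbox sig_ge eps0
    eps_small sig_eps van w10 cube d0 d1).
have [sig10|sig01] := leP sig1 sig0.
  by move=> Ox; apply: le_trans sig10 (vanish Ox).
(* A step by eps / 2 from each sphere; the minimum stops the iteration at sig1. *)
have iter k : forall y, O y -> Num.min (sig0 + k%:R * (eps / 2)) sig1 <= s y.
  elim: k => [|k IH] y Oy.
    by rewrite mul0r addr0 ge_min vanish.
  have e2 : 0 < eps / 2 by rewrite divr_gt0.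
  have [kl|kg] := leP (sig0 + k%:R * (eps / 2)) sig1; last first.
    have := IH y Oy; rewrite (min_idPr (ltW kg)) => sy.
    by rewrite ge_min sy orbT.
  have kl0 : sig0 <= sig0 + k%:R * (eps / 2) by rewrite lerDl mulr_ge0// ltW.
  have IH' z : O z -> sig0 + k%:R * (eps / 2) <= s z.
    by move=> /IH; rewrite (min_idPl kl).
  have := step _ kl0 kl IH' y Oy.
  have -> : sig0 + k%:R * (eps / 2) + eps / 2 = sig0 + k.+1%:R * (eps / 2).
    by rewrite -(natr1 k); ring.
  by rewrite ge_min => ->.
move=> Ox.
have e2 : 0 < eps / 2 by rewrite divr_gt0.
have d0 : 0 <= (sig1 - sig0) / (eps / 2) by rewrite divr_ge0 ?subr_ge0 ?ltW.
have /andP[_ big] := truncn_itv d0.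
have := iter (Num.truncn ((sig1 - sig0) / (eps / 2))).+1 x Ox.
rewrite (min_idPr _)//; rewrite -lerBlDl -ler_pdivrMr//; exact: ltW.
Qed.

End local_continuation.

(** * Positive definite matrices in dimension three *)

Section linear_algebra.
Context {R : realType}.
Implicit Types (g F : 'M[R]_3) (u x : 'rV[R]_3).

Lemma det2 (M : 'M[R]_2) : \det M = M 0 0 * M 1 1 - M 0 1 * M 1 0.
Proof.
rewrite (expand_det_row _ 0) !big_ord_recl big_ord0 /cofactor !det_mx11 !mxE /=.
rewrite (_ : lift 0 0 = 1 :> 'I_2); last exact: val_inj.
rewrite (_ : lift 1 0 = 0 :> 'I_2); last exact: val_inj.
by rewrite /bump /=; ring.
Qed.

Lemma det3 g : \det g =
  g 0 0 * (g 1 1 * g 2 2 - g 1 2 * g 2 1)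
  - g 0 1 * (g 1 0 * g 2 2 - g 1 2 * g 2 0)
  + g 0 2 * (g 1 0 * g 2 1 - g 1 1 * g 2 0).
Proof.
rewrite (expand_det_row _ 0) sum3E /cofactor.
have L (i : 'I_3) (j : 'I_2) (k : 'I_3) : lift i j = k :> nat -> lift i j = k by move=> /val_inj.
rewrite !(det2 (row' _ (col' _ g))) !mxE.
rewrite (L 0 0 1 erefl) (L 0 1 2 erefl) (L 1 0 0 erefl) (L 1 1 2 erefl)
  (L 2 0 0 erefl) (L 2 1 1 erefl).
by rewrite /=; ring.
Qed.

Lemma quadmx3 u g x : (u *m g *m x^T) 0 0 =
  \sum_(i < 3) \sum_(j < 3) g i j * u 0 i * x 0 j.
Proof.
rewrite mxE exchange_big; apply: eq_bigr => j _; rewrite !mxE mulr_suml.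
by apply: eq_bigr => i _; ring.
Qed.

Section positive_definite.
Variable g : 'M[R]_3.
Hypothesis gT : g^T = g.
Hypothesis gpos : forall u : 'rV[R]_3, u != 0 -> 0 < (u *m g *m u^T) 0 0.

Let gs i j : g i j = g j i. Proof. by rewrite -{1}gT mxE. Qed.

Let row3 (a b c : R) : 'rV[R]_3 := \row_(q < 3) nth 0 [:: a; b; c] q.

Let row3_neq0 (a b c : R) q : row3 a b c 0 q != 0 -> row3 a b c != 0.
Proof. by apply: contra => /eqP ->; rewrite mxE. Qed.

Lemma posdef_diag i : 0 < g i i.
Proof.
have := @gpos (delta_mx 0 i).
have -> : (delta_mx 0 i : 'rV[R]_3) *m g *m (delta_mx 0 i)^T = (g i i)%:M.
  apply/matrixP => p q; rewrite !ord1 -rowE mxE (bigD1 i)//= big1 => [|k ki].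
    by rewrite !mxE !eqxx /= mulr1 addr0 mulr1n.
  by rewrite !mxE !eqxx (negbTE ki) /= mulr0.
rewrite mxE eqxx mulr1n; apply.
by apply/eqP => /matrixP/(_ 0 i)/eqP; rewrite !mxE !eqxx oner_eq0.
Qed.

(** Sylvester's criterion in dimension 3, read off from two test vectors. *)
Lemma posdef_det : 0 < \det g.
Proof.
pose m := g 0 0 * g 1 1 - g 0 1 * g 0 1.
have g00 := posdef_diag 0.
have m0 : 0 < m.
  have u0 : row3 (- g 0 1) (g 0 0) 0 != 0.
    by apply: (@row3_neq0 _ _ _ 1); rewrite mxE /= gt_eqF.
  have := gpos u0; rewrite quadmx3 !sum3E !mxE /= (gs 1 0).
  have -> : g 0 0 * - g 0 1 * - g 0 1 + g 0 1 * - g 0 1 * g 0 0 + g 0 2 * - g 0 1 * 0 +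
    (g 0 1 * g 0 0 * - g 0 1 + g 1 1 * g 0 0 * g 0 0 + g 1 2 * g 0 0 * 0) +
    (g 2 0 * 0 * - g 0 1 + g 2 1 * 0 * g 0 0 + g 2 2 * 0 * 0) = g 0 0 * m.
    by rewrite /m; ring.
  by rewrite pmulr_rgt0.
pose w := row3 (g 0 1 * g 1 2 - g 0 2 * g 1 1) (g 0 1 * g 0 2 - g 0 0 * g 1 2) m.
have w0 : w != 0 by apply: (@row3_neq0 _ _ _ 2); rewrite mxE /= gt_eqF.
have := gpos w0.
have -> : (w *m g *m w^T) 0 0 = m * \det g.
  by rewrite quadmx3 det3 !sum3E !mxE /= (gs 1 0) (gs 2 0) (gs 2 1) /m; ring.
by rewrite pmulr_rgt0.
Qed.

Let gu : g \in unitmx. Proof. by rewrite unitmxE unitfE gt_eqF// posdef_det. Qed.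

Lemma posdef_inv_sym i j : invmx g i j = invmx g j i.
Proof. by rewrite -{1}gT -trmx_inv mxE. Qed.

(** The Cauchy-Schwarz inequality for the inverse form, obtained by testing g on
x g^-1 - t e_i with t = x_i / g_ii. *)
Lemma posdef_inv_coord x i :
  x 0 i ^+ 2 <= g i i * (x *m invmx g *m x^T) 0 0.
Proof.
have gi := posdef_diag i; set q := (x *m _ *m _) 0 0; pose t := x 0 i / g i i.
have pos u : 0 <= (u *m g *m u^T) 0 0.
  by have [->|/gpos/ltW//] := eqVneq u 0; rewrite !mul0mx mxE.
have hT : (invmx g)^T = invmx g by rewrite trmx_inv gT.
have := pos (x *m invmx g - t *: delta_mx 0 i).
have bil (u w : 'rV[R]_3) : ((u - t *: w) *m g *m (u - t *: w)^T) 0 0 =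
   (u *m g *m u^T) 0 0 - t * ((u *m g *m w^T) 0 0 + (w *m g *m u^T) 0 0)
   + t * t * (w *m g *m w^T) 0 0.
  by rewrite !quadmx3 !sum3E !mxE; ring.
have e0 (M : 'M[R]_(1, 3)) : (M *m (delta_mx 0 i : 'rV[R]_3)^T) 0 0 = M 0 i.
  rewrite mxE (bigD1 i)//= big1 => [|k ki]; first by rewrite !mxE !eqxx mulr1 addr0.
  by rewrite !mxE (negbTE ki) andbF mulr0.
have e3 : ((delta_mx 0 i : 'rV[R]_3) *m g *m (invmx g *m x^T)) 0 0 = x 0 i.
  by rewrite mulmxA mulmxK// -rowE !mxE.
have e4 : ((delta_mx 0 i : 'rV[R]_3) *m g) 0 i = g i i by rewrite -rowE mxE.
rewrite bil e0 e0 mulmxKV// trmx_mul hT e3 e4 mulmxA -/q.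
rewrite (_ : q - _ + _ = q - x 0 i ^+ 2 / g i i); last first.
  by rewrite /t; field; rewrite gt_eqF.
by rewrite subr_ge0 ler_pdivrMr// mulrC.
Qed.

End positive_definite.

Lemma levi_civitaE :
  [/\ @levi_civita R 1 2 0 = 1, @levi_civita R 2 1 0 = -1,
      @levi_civita R 2 0 1 = 1, @levi_civita R 0 2 1 = -1 &
      @levi_civita R 0 1 2 = 1 /\ @levi_civita R 1 0 2 = -1].
Proof. by do ![split]; rewrite /levi_civita det3 !mxE /=; ring. Qed.

Lemma levi_civita0 i j k : [|| i == j, i == k | j == k] -> @levi_civita R i j k = 0.
Proof.
by move=> h; rewrite /levi_civita det3 !mxE /=; move: i j k h;
  do 3 (apply: ord3_cases); rewrite //= => _; ring.
Qed.

End linear_algebra.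

(** * Beltrami fields in a chart *)

Section beltrami_in_chart.
Context {R : realType} (M : manifold3 R) (g : riemannian_metric M)
  (X : vector_field M) (lambda : M -> R) (i : idx M).
Local Notation E := 'rV[R]_3.
Local Notation c := (atlas i).
Local Notation V := (img c).

Hypothesis curlX : curl_eq g X lambda.
Hypothesis divX : div_free g X.

Definition covector (k : 'I_3) : E -> R := fun y => flat (g i) (X i) y 0 k.
(** In terms of the metric dual omega of X, div X = 0 says that the sum over j and
k of d_k (density_jk omega_j) vanishes. *)
Definition density (j k : 'I_3) : E -> R := fun y => vol (g i) y * invmx (g i y) j k.

Lemma open_img : open V. Proof. exact: img_open. Qed.
Let oV := open_img.

Lemma chart_invK y : V y -> dom c (chart_inv c y) /\ chart_map c (chart_inv c y) = y.
Proof.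
by move=> [p dp <-]; rewrite chart_mapK ?inE.
Qed.

Let gT y : V y -> (g i y)^T = g i y. Proof. by move=> Vy; exact: Defs.metric_sym. Qed.
Let gpos y : V y -> forall u : E, u != 0 -> 0 < (u *m g i y *m u^T) 0 0.
Proof. by move=> Vy; exact: Defs.metric_pos. Qed.

Lemma metric_det y : V y -> 0 < \det (g i y).
Proof. by move=> Vy; apply: posdef_det; [exact: gT|exact: gpos]. Qed.

Lemma metric_unit y : V y -> g i y \in unitmx.
Proof. by move=> Vy; rewrite unitmxE unitfE gt_eqF// metric_det. Qed.

Lemma vol_gt0 y : V y -> 0 < vol (g i) y.
Proof. by move=> Vy; rewrite sqrtr_gt0 metric_det. Qed.

Let Cg k j l : Ck k V (fun y => g i y j l).
Proof. by apply: smooth_on_Ck oV _; exact: metric_smooth. Qed.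

Let CX k j : Ck k V (fun y => X i y 0 j).
Proof. by apply: smooth_on_Ck oV _; exact: components_smooth. Qed.

Lemma Ck_covector k j : Ck k V (covector j).
Proof.
have := @Ck_sum _ k V _ (index_enum 'I_3) predT (fun l y => X i y 0 l * g i y l j) oV
  (fun l => CkM oV (CX k l) (Cg k l j)).
by apply: (Ck_ext oV) => y _; rewrite /covector /flat mxE.
Qed.

Lemma Ck_vol k : Ck k V (vol (g i)).
Proof. exact: Ck_sqrt oV metric_det (Ck_det oV (Cg k)). Qed.

Lemma Ck_density k j l : Ck k V (density j l).
Proof.
apply: (CkM oV (Ck_vol k)); apply: (Ck_invmx _ _ oV (Cg k)) => y Vy.
by rewrite gt_eqF// metric_det.
Qed.

Lemma density_sym y j l : V y -> density j l y = density l j y.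
Proof. by move=> Vy; rewrite /density (posdef_inv_sym (gT Vy)). Qed.

(** Since the trace of g bounds its largest eigenvalue, the inverse of this
number is an ellipticity constant of [density]. Unlike eigenvalues, it is
visibly continuous. *)
Definition ellipticity y : R := (\sum_(j < 3) g i y j j) / vol (g i) y.

Lemma Ck_ellipticity k : Ck k V ellipticity.
Proof.
apply: (CkM oV); first exact: (@Ck_sum _ k V _ _ _ (fun j y => g i y j j) oV).
by apply: (CkV oV _ (Ck_vol k)) => y Vy; rewrite gt_eqF// vol_gt0.
Qed.

Lemma density_ell y (t : R) : V y -> 0 < t -> ellipticity y <= t ->
  forall u, t^-1 * sumsq u <= quad (at_ density y) u u.
Proof.
move=> Vy t0 et u; rewrite ler_pdivrMl//.
have v0 := vol_gt0 Vy.
pose x : E := \row_k u k.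
have qE : quad (at_ density y) u u = vol (g i) y * (x *m invmx (g i y) *m x^T) 0 0.
  rewrite quadmx3 mulr_sumr; apply: eq_bigr => p _; rewrite mulr_sumr.
  by apply: eq_bigr => q _; rewrite /at_ /density !mxE !mulrA.
have q0 : 0 <= quad (at_ density y) u u.
  rewrite qE mulr_ge0 ?(ltW v0)//.
  have := posdef_inv_coord (gT Vy) (gpos Vy) x 0.
  by move/(le_trans (sqr_ge0 _)); rewrite pmulr_rge0// (posdef_diag (gT Vy) (gpos Vy)).
apply: le_trans (ler_wpM2r q0 et); rewrite qE /ellipticity.
have cancel (p v q : R) : 0 < v -> p / v * (v * q) = p * q.
  by move=> v1; field; rewrite gt_eqF.
rewrite cancel// mulr_suml; apply: ler_sum3 => k.
have := posdef_inv_coord (gT Vy) (gpos Vy) x k; by rewrite !mxE.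
Qed.

Lemma covector_neq0 y : V y -> X i y != 0 -> 0 < sumsq (omega_at covector y).
Proof.
move=> Vy; rewrite lt_neqAle sumsq_ge0 andbT; apply: contra => /eqP W0.
have f0 : flat (g i) (X i) y = 0.
  apply/rowP => k; rewrite [RHS]mxE; apply/eqP; rewrite -sqrf_eq0; apply/eqP/le_anti.
  by rewrite sqr_ge0 andbT W0; exact: sumsq_ge (omega_at covector y) k.
have : X i y *m g i y = 0 by [].
by move=> /(congr1 (mulmx^~ (invmx (g i y)))); rewrite mulmxK ?metric_unit// mul0mx => ->.
Qed.

Lemma covector_eq0 y k : X i y = 0 -> covector k y = 0.
Proof. by move=> X0; rewrite /covector /flat X0 mul0mx mxE. Qed.

Let hodge_sum (P : 'M[R]_3) :
  [/\ \sum_j \sum_k P j k * levi_civita j k 0 = P 1 2 - P 2 1,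
      \sum_j \sum_k P j k * levi_civita j k 1 = P 2 0 - P 0 2 &
      \sum_j \sum_k P j k * levi_civita j k 2 = P 0 1 - P 1 0].
Proof.
have [l1 l2 l3 l4 [l5 l6]] := @levi_civitaE R.
have l0 := @levi_civita0 R.
split; rewrite !sum3E ?l1 ?l2 ?l3 ?l4 ?l5 ?l6 !l0//; ring.
Qed.

(** By the curl equation the Hodge dual of d omega is lambda omega. The Hodge
star is inverted by hand: raising indices gives an antisymmetric matrix P whose
three entries are those of the dual up to the volume density, and lowering them gives back d omega. *)
Lemma curl_covector_bound y (G Vb Lb : R) : V y ->
  (forall j k, `|g i y j k| <= G) -> (vol (g i) y)^-1 <= Vb ->
  `|lambda (chart_inv c y)| <= Lb ->
  sumsq2 (curl_at covector y) <=
    9 * (9 * (G ^+ 2 * (Vb * Lb))) ^+ 2 * sumsq (omega_at covector y).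
Proof.
move=> Vy gG vV lL.
have [dq qy] := chart_invK Vy.
have G0 : 0 <= G by exact: le_trans (gG 0 0).
have v0 := vol_gt0 Vy.
have Vb0 : 0 <= Vb by apply: le_trans vV; rewrite invr_ge0 ltW.
have Lb0 : 0 <= Lb by exact: le_trans lL.
set W := sumsq (omega_at covector y); have W0 : 0 <= W := sumsq_ge0 _.
pose F := ext_deriv (flat (g i) (X i)) y.
pose h := invmx (g i y); pose P := h *m F *m h.
have FE j k : F j k = curl_at covector y j k by rewrite mxE.
have FT : F^T = - F by apply/matrixP => j k; rewrite !mxE opprB.
have hT : h^T = h by rewrite /h trmx_inv gT.
have PT j k : P k j = - P j k.
  have : P^T = - P by rewrite /P !trmx_mul hT FT mulNmx mulmxN mulmxA.
  by move=> /matrixP/(_ j k); rewrite !mxE.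
have hodgeE : hodge2 (g i) (ext_deriv (flat (g i) (X i))) y =
    lambda (chart_inv c y) *: flat (g i) (X i) y.
  have := curlX dq; rewrite qy /local_curl /sharp.
  move=> /(congr1 (mulmx^~ (g i y))); rewrite mulmxKV ?metric_unit// => ->.
  by rewrite scalemxAl.
have comp l : 2^-1 * vol (g i) y * (\sum_j \sum_k P j k * levi_civita j k l)
    = lambda (chart_inv c y) * covector l y.
  by move/rowP/(_ l): hodgeE; rewrite [LHS]mxE [RHS]mxE.
have [s0 s1 s2] := hodge_sum P.
have P12 := comp 0; have P20 := comp 1; have P01 := comp 2.
rewrite s0 (PT 1 2) in P12; rewrite s1 (PT 2 0) in P20; rewrite s2 (PT 0 1) in P01.
have Pb j k : `|P j k| <= Vb * Lb * Num.sqrt W.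
  have base l p : 2^-1 * vol (g i) y * (p - - p) = lambda (chart_inv c y) * covector l y ->
      `|p| <= Vb * Lb * Num.sqrt W.
    move=> pE; have -> : p = (vol (g i) y)^-1 * (lambda (chart_inv c y) * covector l y).
      by rewrite -pE; field; rewrite gt_eqF.
    rewrite !normrM -[leRHS]mulrA normfV (gtr0_norm v0).
    have i0 : 0 <= (vol (g i) y)^-1 by rewrite invr_ge0 ltW.
    apply: (ler_pM i0 (mulr_ge0 (normr_ge0 _) (normr_ge0 _)) vV).
    apply: (ler_pM (normr_ge0 _) (normr_ge0 _) lL).
    rewrite -sqrtr_sqr; apply: ler_wsqrtr.
    exact: sumsq_ge (omega_at covector y) l.
  have diag l : P l l = 0 by have := PT l l; lra.
  have r0 : 0 <= Vb * Lb * Num.sqrt W by rewrite !mulr_ge0 ?sqrtr_ge0.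
  move: j k; apply: ord3_cases; apply: ord3_cases; rewrite ?diag ?normr0//.
  - exact: base P01.
  - by rewrite PT normrN; exact: base P20.
  - by rewrite PT normrN; exact: base P01.
  - exact: base P12.
  - exact: base P20.
  - by rewrite PT normrN; exact: base P12.
have FP : F = g i y *m P *m g i y.
  by rewrite /P !mulmxA mulmxV ?metric_unit// mul1mx mulmxKV ?metric_unit.
have Fb j k : `|curl_at covector y j k| <= 9 * (G ^+ 2 * (Vb * Lb)) * Num.sqrt W.
  rewrite -FE FP mxE; apply: le_trans (ler_norm_sum _ _ _) _.
  apply: (@le_trans _ _ (\sum_(q < 3) \sum_(p < 3) G * (Vb * Lb * Num.sqrt W) * G)).
    apply: ler_sum3 => q; rewrite mxE mulr_suml; apply: le_trans (ler_norm_sum _ _ _) _.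
    apply: ler_sum3 => p; rewrite !normrM.
    apply: (ler_pM (mulr_ge0 (normr_ge0 _) (normr_ge0 _)) (normr_ge0 _)); last exact: gG.
    exact: (ler_pM (normr_ge0 _) (normr_ge0 _) (gG _ _) (Pb _ _)).
  by rewrite !sum3_const_ord le_eqVlt; apply/orP; left; apply/eqP; ring.
apply: (@le_trans _ _ (\sum_(j < 3) \sum_(k < 3)
    (9 * (G ^+ 2 * (Vb * Lb)) * Num.sqrt W) ^+ 2)).
  by apply: ler_sum3 => j; apply: ler_sum3 => k; exact: sqr_le_norm.
rewrite !sum3_const_ord exprMn sqr_sqrtr// le_eqVlt; apply/orP; left; apply/eqP; ring.
Qed.

Lemma vol_componentE z k : V z ->
  vol (g i) z * X i z 0 k = \sum_(j < 3) density j k z * covector j z.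
Proof.
move=> Vz; have -> : X i z 0 k = (flat (g i) (X i) z *m invmx (g i z)) 0 k.
  by rewrite /flat mulmxK// metric_unit.
by rewrite mxE mulr_sumr; apply: eq_bigr => j _; rewrite /density /covector; ring.
Qed.

(** The divergence of X is the divergence of density times omega, so the
product rule leaves only derivatives of the coefficients. *)
Lemma div_covector y : V y -> div_at covector density y =
  - (\sum_(k < 3) \sum_(j < 3) covector j y * partial k (density j k) y).
Proof.
move=> Vy; have [dq qy] := chart_invK Vy.
have part k : partial k (fun z => vol (g i) z * X i z 0 k) y =
   \sum_(j < 3) (density j k y * partial k (covector j) y
                 + covector j y * partial k (density j k) y).
  have nE : {near y, (fun z => vol (g i) z * X i z 0 k) =1
      (fun z => \sum_(j < 3) density j k z * covector j z)}.
    have : nbhs y V by exact: open_nbhs_nbhs.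
    by apply: filterS => z; exact: vol_componentE.
  rewrite partialE (@near_eq_derive R _ _ _ _ y (basis k) nE).
  have d j := is_derive_mul (Ck_is_derive (Ck_density 1 j k) Vy k)
    (Ck_is_derive (Ck_covector 1 j) Vy k).
  have [_ <-] := is_derive_sum d.
  by congr ('D_ _ _ y); apply/funext => z; rewrite fct_sumE.
have := divX dq; rewrite qy /local_div => /eqP.
rewrite mulf_eq0 invr_eq0 gt_eqF ?vol_gt0//= => /eqP.
under eq_bigr do rewrite part big_split.
rewrite big_split /= => /eqP; rewrite addr_eq0 => /eqP <-.
rewrite /div_at; apply: eq_bigr => k _; apply: eq_bigr => j _.
by rewrite (density_sym k j Vy).
Qed.

Lemma div_covector_bound y (A : R) : V y ->
  (forall j k, `|partial k (density j k) y| <= A) ->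
  div_at covector density y ^+ 2 <= (9 * A) ^+ 2 * sumsq (omega_at covector y).
Proof.
move=> Vy dA; rewrite div_covector// sqrrN.
have A0 : 0 <= A by exact: le_trans (dA 0 0).
set W := sumsq _; have W0 : 0 <= W := sumsq_ge0 _.
have S : `|\sum_(k < 3) \sum_(j < 3) covector j y * partial k (density j k) y|
    <= 9 * A * Num.sqrt W.
  apply: le_trans (ler_norm_sum _ _ _) _.
  apply: (@le_trans _ _ (\sum_(k < 3) \sum_(j < 3) Num.sqrt W * A)); last first.
    by rewrite !sum3_const_ord le_eqVlt; apply/orP; left; apply/eqP; ring.
  apply: ler_sum3 => k; apply: le_trans (ler_norm_sum _ _ _) _; apply: ler_sum3 => j.
  rewrite normrM; apply: (ler_pM (normr_ge0 _) (normr_ge0 _)); last exact: dA.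
  by rewrite -sqrtr_sqr; apply: ler_wsqrtr; exact: sumsq_ge (omega_at covector y) j.
by apply: le_trans (sqr_le_norm S) _; rewrite exprMn sqr_sqrtr.
Qed.

Lemma chart_beltrami (P : set E) (Lb : R) : compact P -> P `<=` V ->
  (forall y, P y -> `|lambda (chart_inv c y)| <= Lb) ->
  exists2 K : R, 0 <= K & forall y, P y ->
    sumsq2 (curl_at covector y) + div_at covector density y ^+ 2
    <= K * sumsq (omega_at covector y).
Proof.
move=> cP PV lL.
have bd k f : Ck k V f -> bounded_on P f := @Ck_bounded_on _ k V P f cP PV.
have [G bG] := bounded_on_family (fun p : 'I_3 * 'I_3 => bd 0%N _ (Cg 0%N p.1 p.2)).
have CV : Ck 0 V (fun y => (vol (g i) y)^-1).
  by apply: (CkV oV _ (Ck_vol 0)) => y Vy; rewrite gt_eqF// vol_gt0.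
have [Vb bV] := bd _ _ CV.
have [A bA] := bounded_on_family (fun p : 'I_3 * 'I_3 =>
  bd 0%N _ (Ck_partial (Ck_density 1 p.1 p.2) p.2)).
exists (9 * (9 * (G ^+ 2 * (Vb * Lb))) ^+ 2 + (9 * A) ^+ 2).
  exact: addr_ge0 (mulr_ge0 (ler0n R 9) (sqr_ge0 _)) (sqr_ge0 _).
move=> y Py; have Vy := PV _ Py; rewrite mulrDl; apply: lerD.
  apply: curl_covector_bound => //; last exact: lL.
    by move=> j k; exact: (bG (j, k) y Py).
  exact: le_trans (ler_norm _) (bV y Py).
by apply: div_covector_bound => // j k; exact: (bA (j, k) y Py).
Qed.

End beltrami_in_chart.

(** * Connectedness of the set of nonzero points *)

Section charts.
Context {R : realType} (M : topologicalType) (c : chart R M).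

Lemma chart_map_nbhs p (W : set 'rV[R]_3) : dom c p -> nbhs (chart_map c p) W ->
  nbhs p (chart_map c @^-1` W).
Proof.
move=> dp; have := @chart_map_continuous _ _ c.
rewrite continuous_open_subspace; last exact: dom_open.
by move=> /(_ p (mem_set dp)); exact.
Qed.

Lemma chart_inv_nbhs y (U : set M) : img c y -> nbhs (chart_inv c y) U ->
  nbhs y (chart_inv c @^-1` U).
Proof.
move=> Vy; have := @chart_inv_continuous _ _ c.
rewrite continuous_open_subspace; last exact: img_open.
by move=> /(_ y (mem_set Vy)); exact.
Qed.

End charts.

Section nonzero_set.
Context {R : realType} (M : manifold3 R) (X : vector_field M).

(** The transformation law transports a zero from one chart to all others. *)
Lemma zero_set_chart i p : dom (atlas i) p ->
  zero_set X p <-> X i (chart_map (atlas i) p) = 0.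
Proof.
move=> di; split=> [|Xi0 j dj]; first exact.
have ov : overlap (atlas i) (atlas j) (chart_map (atlas i) p) by exists p.
have := components_transform X ov.
by rewrite /transition /= chart_mapK ?inE// Xi0 mul0mx.
Qed.

Lemma open_nonzero_set : open (~` zero_set X).
Proof.
rewrite openE => p Xp; have [i di] := atlas_cover p.
have Xi : X i (chart_map (atlas i) p) != 0.
  by apply/eqP => /(zero_set_chart di).
have Vp : img (atlas i) (chart_map (atlas i) p) by exists p.
have [cX _] := @components_smooth _ _ X i [::] _ Vp.
have near0 : nbhs (chart_map (atlas i) p) [set y | X i y != 0] 
    by exact: (@cvgr_neq0 _ _ _ _ _ (X i) _ cX Xi).
have nd : nbhs p (dom (atlas i)) by apply: open_nbhs_nbhs; split=> //; exact: dom_open.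
apply: filterS2 (chart_map_nbhs di near0) nd => q /= Xq dq.
by move=> /(zero_set_chart dq) Xq0; rewrite Xq0 eqxx in Xq.
Qed.

End nonzero_set.

Section sqdist_norm.
Context {R : realType}.
Local Notation E := 'rV[R]_3.
Implicit Types x y : E.

Lemma sqdist_norm x y (r : R) : 0 <= r -> sqdist x y <= r ^+ 2 -> `|y - x| <= r.
Proof.
move=> r0 s; apply: norm_le_coord => // q.
rewrite -(@ler_pXn2r _ 2)// ?nnegrE//; apply: le_trans s.
rewrite real_normK ?num_real// /sqdist (bigD1 q)//= /disp !mxE -expr2 lerDl.
by apply: sumr_ge0 => k _; rewrite -expr2 sqr_ge0.
Qed.

Lemma norm_sqdist x y (r : R) : `|x - y| <= r -> sqdist y x <= 3 * r ^+ 2.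
Proof.
move=> h; rewrite -(sum3_const_ord (r ^+ 2)); apply: ler_sum3 => q.
have := le_trans (coord_le_norm (x - y) q) h; rewrite /disp !mxE.
by rewrite -expr2 => /sqr_le_norm.
Qed.

End sqdist_norm.

Section unique_continuation.
Context {R : realType} (M : manifold3 R) (g : riemannian_metric M)
  (X : vector_field M) (lambda : M -> R).
Local Notation E := 'rV[R]_3.
Local Notation A := (~` zero_set X).
Hypothesis bX : weak_beltrami g X lambda.

(** Near a point p of the closure choose x0 in the interior of the complement of N,
at distance below r / 8 from p. The set N misses a small ball around x0, so by
[local_continuation] it misses the ball of radius r / 4 around x0, which
contains p. The radii r / 4 and r / 3 leave room for a ball around x0 on which all
bounds hold. *)
Lemma vanishing_closed (N : set M) : N `<=` A -> open N -> open (A `\` N) ->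
  closed (interior (~` N)).
Proof.
move=> NA oN oAN p clp; have [bl curlX divX] := bX.
have [i di] := atlas_cover p.
set mu := chart_map (atlas i); set nu := chart_inv (atlas i).
set V := img (atlas i); set yp := mu p.
have Vp : V yp by exists p.
have nup : nu yp = p by apply: chart_mapK; rewrite inE.
have oV : open V := @img_open _ _ (atlas i).
have [Lb nL] : exists Lb, nbhs p [set q | `|lambda q| <= Lb].
  by have [L [_ h]] := bl p; exists (L + 1); apply: h; rewrite ltrDl.
have nL' : nbhs yp (nu @^-1` [set q | `|lambda q| <= Lb]).
  by apply: (chart_inv_nbhs Vp); rewrite -/nu nup.
have nE := continuous_near (Ck_continuous (Ck_ellipticity g i 0) Vp) (@ltr01 R).
have nV : nbhs yp V by exact: open_nbhs_nbhs.
have [r /= r0 br] := (nbhs_ballP yp _).1 (filterI nV (filterI nL' nE)).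
pose t := `|ellipticity g i yp| + 1.
have t0 : 0 < t by apply: ltr_wpDl.
have inv y : ball yp r y -> V y /\ `|lambda (nu y)| <= Lb /\ ellipticity g i y <= t.
  move=> /br [Vy [Ly Ey]]; split=> //; split=> //.
  move: Ey; rewrite /= /t; set u := ellipticity g i yp; set v := ellipticity g i y.
  by move=> uv; have := ler_norm u; have := ler_norm (v - u); rewrite distrC; move: uv; move=> *; lra.
have r8 : 0 < r / 8 by rewrite divr_gt0// ltr0Sn.
have npb : nbhs p (mu @^-1` ball yp (r / 8)).
  by apply: chart_map_nbhs => //; exact: nbhsx_ballx.
have nd : nbhs p (dom (atlas i)) by apply: open_nbhs_nbhs; split=> //; exact: dom_open.
have [q0 [iq0 [bq0 dq0]]] := clp _ (filterI npb nd).
set x0 := mu q0; have Vx0 : V x0 by exists q0.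
have nux0 : nu x0 = q0 by apply: chart_mapK; rewrite inE.
have nN : nbhs x0 (nu @^-1` (~` N)) by apply: (chart_inv_nbhs Vx0); rewrite -/nu nux0.
have [r1 /= r10 br1] := (nbhs_ballP x0 _).1 nN.
pose B := ball yp r; pose O := B `&` (nu @^-1` N).
have oB : open B by exact: ball_open.
have oO : open O.
  rewrite openE => y [By Ny]; have [Vy _] := inv y By.
  have n1 : nbhs y B by exact: open_nbhs_nbhs.
  have n2 : nbhs y (nu @^-1` N) by apply: (chart_inv_nbhs Vy); exact: open_nbhs_nbhs.
  exact: filterI n1 n2.
have x0p : `|yp - x0| < r / 8 by move: bq0; rewrite /= -ball_normE.
have BV : B `<=` V by move=> y /inv[].
have ballB x : sqdist x0 x <= (r / 3) ^+ 2 -> B x.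
  move=> sx; have r3 : 0 <= r / 3 by rewrite divr_ge0 ?ler0n// ltW.
  have := sqdist_norm r3 sx; rewrite /B -ball_normE /= -(subrKA x0 yp) => xx.
  apply: le_lt_trans (ler_normD _ _) _; rewrite (distrC x0 x).
  by move: (`|yp - x0|) (`|x - x0|) x0p xx => u v *; lra.
have [K K0 bK] := chart_beltrami curlX divX (compact_sqdist (R:=R) (x0:=x0) (r:=(r / 3) ^+ 2))
  (fun y sy => (inv y (ballB y sy)).1) (fun y sy => (inv y (ballB y sy)).2.1).
have nuK y : V y -> dom (atlas i) (nu y) /\ mu (nu y) = y := @chart_invK _ _ i y.
have Xnz y : V y -> A (nu y) -> X i y != 0.
  move=> Vy Ay; have [dy my] := nuK y Vy; apply/eqP => X0; apply: Ay.
  by apply/(zero_set_chart X dy); rewrite -/mu my.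
have far x : O x -> (r / 4) ^+ 2 <= sqdist x0 x.
  apply: (@local_continuation _ B O (covector g X i) (density g i) x0 t^-1 K
    ((r1 / 2) ^+ 2) ((r / 4) ^+ 2) ((r / 3) ^+ 2)) => //.
  - by move=> y [].
  - by move=> k; exact: Ck_subset (Ck_covector g X i 2 k).
  - by move=> j k; exact: Ck_subset (Ck_density g i 1 j k).
  - by move=> y [By Ny]; have Vy := BV y By; apply: covector_neq0 => //; apply: Xnz => //; exact: NA.
  - move=> y By; have Vy := BV y By; have [dy my] := nuK y Vy.
    have [Ky|Ay] := pselect (zero_set X (nu y)).
      by apply: Or33 => k; apply: covector_eq0; rewrite -my; apply/(zero_set_chart X dy).
    have [Ny|Ny] := pselect (N (nu y)); first by apply: Or31.
    apply: Or32; have : nbhs y (nu @^-1` (A `\` N)).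
      by apply: (chart_inv_nbhs Vy); exact: open_nbhs_nbhs.
    by apply: filterS => z [_ Nz] [].
  - by move=> y By j k; apply: density_sym; exact: BV.
  - by rewrite invr_gt0.
  - by move=> y By; have [Vy [_ Ey]] := inv y By; exact: density_ell.
  - by rewrite exprn_gt0// divr_gt0// ltr0Sn.
  - by rewrite ltrXn2r ?divr_ge0 ?ler0n ?(ltW r0)//; lra.
  - by move=> y _; exact: bK.
  - move=> y [_ Ny]; rewrite leNgt; apply/negP => sy.
    have r12 : 0 <= r1 / 2 by rewrite divr_ge0 ?ler0n// ltW.
    have yx := sqdist_norm r12 (ltW sy); apply: (br1 y) Ny.
    by rewrite -ball_normE /= distrC; apply: le_lt_trans yx _; lra.
have nB : nbhs yp (B `&` [set x | sqdist x0 x < (r / 4) ^+ 2]).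
  apply: filterI; first exact: nbhsx_ballx.
  have cs : {for yp, continuous (sqdist x0)} by apply: Ck_continuous (Ck_sqdist x0 0 openT) _.
  apply: (cs [set z | z < (r / 4) ^+ 2]); apply: open_nbhs_nbhs.
  split; first exact: open_lt.
  have := norm_sqdist (ltW x0p); rewrite /= => sp; apply: le_lt_trans sp _.
  by nra.
apply: filterS2 (chart_map_nbhs di nB) nd => q /= [Bq sq] dq Nq.
have : O (mu q) by split=> //; rewrite /= /nu chart_mapK ?inE.
by move=> /far; rewrite leNgt sq.
Qed.

(** If some point of A were outside N, the interior of the complement of N would
be nonempty, open and closed, hence everything. *)
Lemma nonzero_clopen (N : set M) : N `<=` A -> open N -> open (A `\` N) ->
  N !=set0 -> N = A.
Proof.
move=> NA oN oAN [p Np]; apply/seteqP; split=> // q Aq; apply: contrapT => Nq.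
have intq : interior (~` N) q.
  have : nbhs q (A `\` N) by exact: open_nbhs_nbhs.
  by apply: filterS => z [].
have : interior (~` N) = setT.
  apply: (@space_connected _ M); first by exists q.
    by exists (interior (~` N)); rewrite ?setTI//; exact: open_interior.
  by exists (interior (~` N)); rewrite ?setTI//; exact: vanishing_closed.
by move=> /seteqP[_ /(_ p I) /nbhs_singleton].
Qed.

Lemma connected_nonzero_set : connected A.
Proof.
move=> N N0 [C oC NE] [D cD NE']; have oA := open_nonzero_set X.
apply: nonzero_clopen => //; first by rewrite NE => z [].
  by rewrite NE; exact: openI.
have -> : A `\` N = A `&` ~` D.
  by rewrite NE' setDIr setDv set0U setDE.
by apply: openI => //; exact: closed_openC.
Qed.

End unique_continuation.

(** * Paths *)

Section paths.
Context {R : realType}.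

Lemma continuous_glue (T : topologicalType) (f g : R -> T) (s : R) :
  continuous f -> continuous g -> f s = g s ->
  continuous (fun t => if t <= s then f t else g t).
Proof.
move=> cf cg fg t W /=.
have [ts|st|->] := ltgtP t s => nW.
- have n1 : nbhs t [set u | u < s] by apply: open_nbhs_nbhs; split=> //; exact: open_lt.
  by apply: filterS2 n1 (cf t W nW) => u /= us; rewrite (ltW us).
- have n1 : nbhs t [set u | s < u] by apply: open_nbhs_nbhs; split=> //; exact: open_gt.
  by apply: filterS2 n1 (cg t W nW) => u /= us; rewrite leNgt us.
- have nW' : nbhs (g s) W by rewrite -fg.
  have n2 : nbhs s (f @^-1` W) := cf s W nW.
  have n3 : nbhs s (g @^-1` W) := cg s W nW'.
  by apply: filterS2 n2 n3 => u /= fu gu; case: ifP.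
Qed.

(** Constancy outside the unit interval makes the concatenation of two paths
continuous on the whole line. *)
Definition joined (T : topologicalType) (S : set T) (p q : T) : Prop :=
  exists gamma : R -> T, [/\ continuous gamma,
    forall t, t <= 0 -> gamma t = p, forall t, 1 <= t -> gamma t = q &
    forall t, S (gamma t)].

Lemma joined_sym (T : topologicalType) (S : set T) p q :
  joined S p q -> joined S q p.
Proof.
move=> [f [cf f0 f1 fS]]; exists (f \o (fun t => 1 - t)); split.
- have c1 : continuous (fun t : R => 1 - t).
    by move=> t; apply: cvgB; [exact: cvg_cst|exact: cvg_id].
  by move=> t W nW; exact: c1 (cf _ W nW).
- by move=> t t0 /=; rewrite f1//; lra.
- by move=> t t1 /=; rewrite f0//; lra.
- by move=> t; exact: fS.
Qed.

Lemma joined_trans (T : topologicalType) (S : set T) p q r :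
  joined S p q -> joined S q r -> joined S p r.
Proof.
move=> [f [cf f0 f1 fS]] [h [ch h0 h1 hS]].
exists (fun t => if t <= 2^-1 then f (2 * t) else h (2 * t - 1)); split.
- have c2 : continuous (fun t : R => 2 * t).
    by move=> t; apply: cvgM; [exact: cvg_cst|exact: cvg_id].
  apply: (@continuous_glue _ (f \o (fun t => 2 * t)) (h \o (fun t => 2 * t - 1))).
  + by move=> t W nW; exact: c2 (cf _ W nW).
  + have c3 : continuous (fun t : R => 2 * t - 1).
      by move=> t; apply: cvgB; [exact: c2|exact: cvg_cst].
    by move=> t W nW; exact: c3 (ch _ W nW).
  + by rewrite /= f1 ?h0//; lra.
- by move=> t t0; rewrite ifT ?f0//; lra.
- by move=> t t1; rewrite ifF ?h1//; [lra|apply/negbTE; rewrite -ltNge; lra].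
- by move=> t; case: ifP.
Qed.

Lemma joined_ball (T : topologicalType) (c : chart R T) (S : set T) (y : 'rV[R]_3)
    (r : R) : ball y r `<=` img c `&` (chart_inv c @^-1` S) ->
  forall z, ball y r z -> joined S (chart_inv c y) (chart_inv c z).
Proof.
move=> br z bz.
pose clamp (t : R) : R := if t <= 0 then 0 else if t <= 1 then t else 1.
pose l t := y + clamp t *: (z - y).
have clamp01 t : 0 <= clamp t <= 1.
  rewrite /clamp; case: (leP t 0) => t0; first by rewrite lexx ler01.
  by case: (leP t 1) => t1; rewrite ?ler01 ?lexx// (ltW t0).
have bl t : ball y r (l t).
  move: bz; rewrite -!ball_normE /= /l opprD addNKr normrN normrZ => bz.
  have /andP[c0 c1] := clamp01 t; apply: le_lt_trans bz.
  by rewrite distrC (ger0_norm c0) ler_piMl.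
have cc : continuous clamp.
  apply: (@continuous_glue _ (cst 0) (fun t => if t <= 1 then t else 1)).
  + by move=> t; exact: cvg_cst.
  + apply: (@continuous_glue _ id (cst 1)) => // t; [exact: cvg_id|exact: cvg_cst].
  + by rewrite ler01.
have cl : continuous l.
  move=> t; apply: cvgD; first exact: cvg_cst.
  by apply: cvgZr_tmp; exact: cc.
exists (chart_inv c \o l); split.
- move=> t W nW; have [Vl _] := br _ (bl t).
  exact: cl (chart_inv_nbhs Vl nW).
- move=> t t0 /=; by rewrite /l /clamp t0 scale0r addr0.
- move=> t t1 /=; have c1 : clamp t = 1.
    rewrite /clamp leNgt (lt_le_trans ltr01 t1) /=.
    by case: (leP t 1) => // t1'; apply/le_anti; rewrite t1' t1.
  by rewrite /l c1 scale1r addrC subrK.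
- by move=> t; have [_] := br _ (bl t).
Qed.

Lemma nbhs_joined (M : manifold3 R) (S : set M) p : open S -> S p ->
  nbhs p (joined S p).
Proof.
move=> oS Sp; have [i di] := atlas_cover p.
set mu := chart_map (atlas i); set nu := chart_inv (atlas i).
have Vp : img (atlas i) (mu p) by exists p.
have nup : nu (mu p) = p by apply: chart_mapK; rewrite inE.
have nV : nbhs (mu p) (img (atlas i)) by apply: open_nbhs_nbhs; split=> //; exact: img_open.
have nS : nbhs (mu p) (nu @^-1` S).
  by apply: (chart_inv_nbhs Vp); rewrite -/nu nup; exact: open_nbhs_nbhs.
have [r /= r0 br] := (nbhs_ballP (mu p) _).1 (filterI nV nS).
have nd : nbhs p (dom (atlas i)) by apply: open_nbhs_nbhs; split=> //; exact: dom_open.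
apply: filterS2 (chart_map_nbhs di (nbhsx_ballx _ _ r0)) nd => q /= bq dq.
have := joined_ball br bq; rewrite -/nu nup.
by rewrite /nu chart_mapK ?inE.
Qed.

End paths.

Arguments joined R {T} S p q.

Theorem corollary2p10 (R : realType) (M : manifold3 R)
    (g : riemannian_metric M) (X : vector_field M) (lambda : M -> R)
    (hX : weak_beltrami g X lambda)
    (hlambda : Cinfty_bounded_near (zero_set X) lambda)
    (hX0 : exists p, ~ zero_set X p) :
  path_connected (~` zero_set X) /\ exists! N : set M, nodal_domain X N.
Proof.
have oA := open_nonzero_set X.
have cA := connected_nonzero_set hX.
split; last first.
  have [p Ap] := hX0; exists (~` zero_set X); split.
    by exists p => //; rewrite connected_component_id.
  by move=> N [q Aq ->]; rewrite connected_component_id.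
split=> // p q Ap Aq.
have nj z : (~` zero_set X) z -> nbhs z (joined R (~` zero_set X) z).
  by move=> Az; exact: nbhs_joined oA Az.
have pE : (~` zero_set X) `&` joined R (~` zero_set X) p = ~` zero_set X.
  apply: (nonzero_clopen hX).
  - by move=> z [].
  - rewrite openE => z [Az pz]; apply: filterI; first exact: open_nbhs_nbhs.
    by apply: filterS (nj z Az) => w; exact: joined_trans.
  - rewrite openE => z [Az npz]; apply: filterI; first exact: open_nbhs_nbhs.
    apply: filterS (nj z Az) => w zw [_ pw]; apply: npz; split=> //.
    exact: joined_trans pw (joined_sym zw).
  - by exists p; split=> //; exact: nbhs_singleton (nj p Ap).
have [_ [f [cf f0 f1 fA]]] : ((~` zero_set X) `&` joined R (~` zero_set X) p) q by rewrite pE.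
exists f; split=> //; [exact: continuous_subspaceT|exact: f0|exact: f1].
Qed.
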